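(* Let $u_0:\mathbb{R}\to\mathbb{R}$ satisfy (i) $\mathcal{E}(u_0)<+\infty$ and (ii) there exist constants $a\le b$ such that $\phi(x-b)\le u_0(x)\le\phi(x-a)$ for all $x\in\mathbb{R}$. Let $u(x,t)$ be the solution of $\partial_t u=-(-\partial_{xx})^{1/2}u-f(u)$ with $u(\cdot,0)=u_0$. Then there exists $x_0\in\mathbb{R}$ such that $$\lim_{t\to+\infty}b(t)=0,\qquad b(t):=\max_{x\in\mathbb{R}}|u(x,t)-\phi(x-x_0)|.$$
   Context: $F(u)=\frac{1}{\pi^2}(1+\cos(\pi u))$, $f(u)=F'(u)=-\frac1\pi\sin(\pi u)$, $\phi(x)=\frac{2}{\pi}\arctan x$. The operator $(-\partial_{xx})^{1/2}g(x)=\frac1\pi\,\mathrm{PV}\int_{\mathbb{R}}\frac{g(x)-g(y)}{|x-y|^2}\,dy$ has Fourier symbol $|\xi|$ on $H^1(\mathbb{R})$, and $(-\Delta)^{1/4}$ has symbol $|\xi|^{1/2}$. The profile $\phi$ satisfies $(-\partial_{xx})^{1/2}\phi+f(\phi)=0$. The perturbed energy is $$\mathcal{E}(u)=\int_{\mathbb{R}}\Big(\tfrac12|(-\Delta)^{1/4}(u-\phi)|^2-(u-\phi)f(\phi)+F(u)\Big)\,dx .$$ Hypotheses (i) and (ii) imply $u_0-\phi\in H^{1/2}(\mathbb{R})$. The solution is understood as: $v:=u-\phi$ belongs to $C([0,\infty);H^{1/2}(\mathbb{R}))$ and to $C^k((0,\infty);H^j(\mathbb{R}))$ for all positive integers $k,j$,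 $v(\cdot,0)=u_0-\phi$, and $\partial_t v=-(-\partial_{xx})^{1/2}v-f(v+\phi)+f(\phi)$ in $L^2(\mathbb{R})$ for every $t>0$; such a solution exists and is unique. *)

(* Defs.v *)
From HB Require Import structures.
From mathcomp Require Import all_boot all_order all_algebra.
From mathcomp Require Import all_classical all_reals all_analysis.

Set Implicit Arguments.
Unset Strict Implicit.
Unset Printing Implicit Defensive.

Import Order.TTheory GRing.Theory Num.Theory.
Import numFieldNormedType.Exports.

Local Open Scope classical_set_scope.
Local Open Scope ring_scope.

Section model.
Context {R : realType}.
Implicit Types x u : R.

Definition potential u : R := (1 + cos (pi * u)) / pi ^+ 2.

Definition dpotential u : R := - (sin (pi * u) / pi).

Definition phi x : R := 2 / pi * atan x.

End model.

Section square_integrable.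
Context {R : realType}.
Local Notation mu := (@lebesgue_measure R).

Definition ae_equal (f g : R -> R) := {ae mu, forall x, f x = g x}.

Definition L2norm (f : R -> R) : \bar R := ('N[mu]_2%:E [EFin \o f])%E.

(* Measurability on R is Borel measurability in the library; the Lebesgue
   measurable functions are those a.e. equal to a Borel function. *)
Definition square_integrable (f : R -> R) :=
  exists2 g : R -> R, g \in Lfun mu 2%:E & ae_equal f g.

End square_integrable.

(* The Fourier transform of a real f in L^2 is the L^2 limit, as N -> +oo, of
   xi |-> \int_[-N, N] f(x) exp(- i x xi) dx. It is represented by the pair
   (c, s) such that it equals c - i s. *)
Section fourier.
Context {R : realType}.
Implicit Types (f c s w : R -> R) (xi N : R).
Local Notation mu := (@lebesgue_measure R).

Definition truncated_cos_transform f N xi : R :=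
  (\int[mu]_(x in `[(- N)%R, N]) (f x * cos (x * xi)))%R.

Definition truncated_sin_transform f N xi : R :=
  (\int[mu]_(x in `[(- N)%R, N]) (f x * sin (x * xi)))%R.

Definition is_fourier f (cs : (R -> R) * (R -> R)) :=
  [/\ square_integrable cs.1, square_integrable cs.2,
      L2norm (fun xi => truncated_cos_transform f N xi - cs.1 xi)
        @[N --> +oo] --> 0%E &
      L2norm (fun xi => truncated_sin_transform f N xi - cs.2 xi)
        @[N --> +oo] --> 0%E].

(* Determined up to a null set; meaningful for square integrable f. *)
Definition fourier f : (R -> R) * (R -> R) :=
  xget (cst 0, cst 0) [set cs | is_fourier f cs].

Definition fourier_modulus f xi : R :=
  Num.sqrt ((fourier f).1 xi ^+ 2 + (fourier f).2 xi ^+ 2).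

(* w = (- Laplacian)^(1/4) f, with both functions in L^2 *)
Definition is_quarter_laplacian f w :=
  [/\ square_integrable f, square_integrable w,
      ae_equal (fourier w).1 (fun xi => `|xi| `^ 2^-1 * (fourier f).1 xi) &
      ae_equal (fourier w).2 (fun xi => `|xi| `^ 2^-1 * (fourier f).2 xi)].

Definition quarter_laplacian f : R -> R :=
  xget (cst 0) [set w | is_quarter_laplacian f w].

Definition sobolev_norm (s : R) f : \bar R :=
  L2norm (fun xi => (1 + xi ^+ 2) `^ (s / 2) * fourier_modulus f xi).

Definition sobolev (s : R) : set (R -> R) :=
  [set f | square_integrable f /\ (sobolev_norm s f < +oo)%E].

End fourier.

Section half_laplacian.
Context {R : realType}.
Local Notation mu := (@lebesgue_measure R).

Definition half_laplacian (g : R -> R) (x : R) : R :=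
  pi^-1 *
  lim ((\int[mu]_(y in [set y | (eps < `|x - y|)%R])
          ((g x - g y) / `|x - y| ^+ 2))%R @[eps --> 0^'+]).

End half_laplacian.

(* The quadratic term is +oo when (- Laplacian)^(1/4) (u - phi) is not in L^2.
   For u - phi outside L^2 the energy is +oo by convention; a measurable u
   between two translates of phi always has u - phi in L^2. *)
Definition energy (R : realType) (u : R -> R) : \bar R :=
  let v := u \- phi in
  if `[< exists w, is_quarter_laplacian v w >] then
    (\int[@lebesgue_measure R]_x
       (2^-1 * `|quarter_laplacian v x| ^+ 2
        - (u x - phi x) * dpotential (phi x) + potential (u x))%:E)%E
  else +oo%E.

(* Curves t |-> v t of functions of x; functions equal a.e. are identified. *)
Section curves.
Context {R : realType}.
Implicit Types (A : set R) (s t : R) (v w : R -> R -> R).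

Definition has_time_derivative (N : (R -> R) -> \bar R) v t (g : R -> R) :=
  N (fun x => h^-1 * (v (t + h) x - v t x) - g x) @[h --> 0^'] --> 0%E.

Definition sobolev_continuous A s v :=
  forall t, A t -> sobolev s (v t) /\
    sobolev_norm s (v r \- v t) @[r --> within A (nbhs t)] --> 0%E.

(* for A open *)
Fixpoint sobolev_Ck A s (k : nat) v : Prop :=
  if k is k'.+1 then
    exists2 w : R -> R -> R,
      (forall t, A t ->
        [/\ sobolev s (v t), sobolev s (w t) &
            has_time_derivative (sobolev_norm s) v t (w t)]) &
      sobolev_Ck A s k' w
  else sobolev_continuous A s v.

End curves.

Section solution.
Context {R : realType}.

(* [u t x] is the value at time t and position x. *)
Record is_solution (u0 : R -> R) (u : R -> R -> R) : Prop := IsSolution {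
  solution_continuous :
    sobolev_continuous `[0, +oo[ 2^-1 (fun t => u t \- phi);
  solution_smooth : forall k j : nat, (0 < k)%N -> (0 < j)%N ->
    sobolev_Ck `]0, +oo[ j%:R k (fun t => u t \- phi);
  solution_initial : ae_equal (u 0 \- phi) (u0 \- phi);
  solution_equation : forall t : R, 0 < t ->
    exists g : R -> R,
      [/\ square_integrable g,
          has_time_derivative L2norm (fun r => u r \- phi) t g &
          ae_equal g (fun x =>
            - half_laplacian (u t \- phi) x
            - dpotential ((u t \- phi) x + phi x) + dpotential (phi x))];
  (* the continuous representative of the class of u t - phi in H^j, j >= 1 *)
  solution_representative : forall t : R, 0 < t -> continuous (u t)
}.

Definition is_maximum (A : set R) (m : R) := A m /\ ubound A m.

End solution.

(* Main.v *)
Require Import Defs.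
From mathcomp Require Import all_boot all_order all_algebra.
From mathcomp Require Import ring lra.
From mathcomp Require Import all_classical all_reals all_analysis.
From mathcomp Require Import measurable_realfun.

(* If [phi (x - b) <= u <= phi (x - a)] holds at one time, it holds at all later
   times: with [q] the excess of [u] over a translate, the energy [E] of its
   positive part satisfies [E' <= 2 E], because the half-Laplacian is a
   nonnegative form and the nonlinearity is 1-Lipschitz. The nonlocal kernel
   [(x - y)^-2] moreover makes the gap between [u] and a translate felt
   everywhere at once: with [w >= 0] the gap and
   [bump x = phi (x + 1) - phi (x - 1)], the mass [M = \int w bump] satisfies
   [M' >= - 2 M], and after one unit of time [w >= kap * M * bump] for a universal
   [kap > 0], by comparison with a barrier that grows linearly in time. The masses
   of the two gaps add up to a multiple of [b - a], so that after unit time the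
   interval [a, b] can be shortened by a fixed factor. Hence [b - a] tends to 0,
   and [x0] is the common limit of the endpoints.

   The regularity in the hypotheses enters through Fourier inversion, which
   identifies the principal value with the limit of the operators truncated at
   distance [e]; these are bounded on L2, and their action on [phi] is explicit
   up to [O(e / (1 + x^2))]. The continuity in H^(1/2) at time 0 enters by duality
   with the compactly supported truncations of the positive part. *)

Set Implicit Arguments.
Unset Strict Implicit.
Unset Printing Implicit Defensive.
Import Order.TTheory GRing.Theory Num.Theory.
Import numFieldNormedType.Exports.
Local Open Scope classical_set_scope.
Local Open Scope ring_scope.

(** * Square integrable functions *)

(** The positive part of an excess is the natural test function, but it lies only in L2, where its
    half-Laplacian need not exist. The truncated operators avoid this: they are bounded and
    symmetric on L2, and the sign of their form at [posp q] is exact for every cut-off. Only their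
    action on the smooth argument has to converge, which is why equations are stated as limits of
    pairings. Since [phi] is not in L2, it enters through differences of translates.

    A sign [sg] treats both gaps at once. Their pointwise sum is [phi (x - a) - phi (x - b)],
    whatever the profile between the translates, so one gap carries at least half of the total mass,
    and that end of the interval is moved. The barrier itself consumes part of the gap that feeds
    it, so its speed is the solution of a linear equation and stays proportional to the mass. The
    contraction factor depends only on a bound for [|a|] and [|b|]; the intervals are nested, so one
    factor serves all steps. *)

Section ae_integral.
Context d (T : measurableType d) {R : realType} (mu : {measure set T -> \bar R}).
Implicit Types f g : T -> \bar R.
Import HBNNSimple.

(* Neither function is assumed measurable: the integral of a nonnegative
   function is a supremum over simple functions below it. *)
Lemma ge0_ae_integral f g :
  (forall x, 0 <= f x)%E -> (forall x, 0 <= g x)%E ->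
  {ae mu, forall x, f x = g x} -> (\int[mu]_x f x = \int[mu]_x g x)%E.
Proof.
suff le (f' g' : T -> \bar R) : (forall x, 0 <= f' x)%E ->
    (forall x, 0 <= g' x)%E -> {ae mu, forall x, f' x = g' x} ->
    (\int[mu]_x f' x <= \int[mu]_x g' x)%E.
  move=> f0 g0 fg; apply/eqP; rewrite eq_le !le//.
  by case: fg => N [mN N0 fgN]; exists N; split => // x /= gf; apply: fgN => /= fg; exact: gf.
move=> {}f0 {}g0 [N [mN N0 fgN]].
rewrite (ge0_integralTE mu f0) (ge0_integralTE mu g0).
apply: ge_ereal_sup => _ [h /= hf <-].
have mNC : measurable (~` N) by exact: measurableC.
(* Erasing [h] on the null set keeps its integral and puts it below [g'] everywhere. *)
pose k := mul_nnsfun h (indic_nnsfun R mNC).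
have kE x : k x = h x * \1_(~` N) x by [].
have -> : sintegral mu h = sintegral mu k.
  have sint (l : {nnsfun T >-> R}) : sintegral mu l = (\int[mu]_x (l x)%:E)%E.
    by rewrite integral_nnsfun// patch_setT.
  rewrite !sint; apply: ge0_ae_eq_integral => //.
  - by apply/measurable_EFinP; exact: measurable_funTS.
  - by apply/measurable_EFinP; exact: measurable_funTS.
  - by move=> x _; rewrite lee_fin; exact: fun_ge0.
  - by move=> x _; rewrite lee_fin; exact: fun_ge0.
  exists N; split => // x /= /not_implyP[_ hk].
  apply: contrapT => Nx; apply: hk; congr EFin.
  by rewrite -[RHS]kE kE indicE mem_set// mulr1.
apply: ereal_sup_ubound; exists k => //= x.
rewrite -[X in X%:E]/(k x) kE indicE; case: (pselect (N x)) => Nx.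
  by rewrite memNset ?mulr0//; apply.
rewrite mem_set// mulr1; move: (hf x); suff -> : f' x = g' x by [].
by apply: contrapT => fg; apply: Nx; exact: fgN.
Qed.

End ae_integral.

Section real_integrals.
Context {R : realType}.
Implicit Types (f g h : R -> R) (a b c x y : R).
Local Notation mu := (@lebesgue_measure R).

Definition meas f := measurable_fun [set: R] f.

Definition intg f := mu.-integrable [set: R] (EFin \o f).

Lemma intg_meas f : intg f -> meas f.
Proof. by move=> /integrableP[/measurable_EFinP]. Qed.

Lemma intg_le g f : meas f -> (forall x, `|f x| <= `|g x|) -> intg g -> intg f.
Proof.
move=> mf fg; apply: le_integrable => //; first exact/measurable_EFinP.
by move=> x _ /=; rewrite lee_fin.
Qed.

Lemma eq_intg g f : f =1 g -> intg g -> intg f.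
Proof. by move=> /funext->. Qed.

Lemma intgD f g : intg f -> intg g -> intg (fun x => f x + g x).
Proof. by move=> If Ig; exact: (integrableD measurableT If Ig). Qed.

Lemma intgB f g : intg f -> intg g -> intg (fun x => f x - g x).
Proof. by move=> If Ig; exact: (integrableB measurableT If Ig). Qed.

Lemma intgZ c f : intg f -> intg (fun x => c * f x).
Proof. by move=> If; exact: (integrableZl measurableT c If). Qed.

Lemma intg_norm f : intg f -> intg (fun x => `|f x|).
Proof. by move=> ?; exact: integrable_norm. Qed.

Lemma intgM_bounded M f g : intg f -> meas g -> (forall x, `|g x| <= M) ->
  intg (fun x => f x * g x).
Proof.
move=> intf mg gM; apply: (@intg_le (fun x => M * f x)); last exact: intgZ.
- by apply: measurable_funM => //; exact: intg_meas.
- move=> x; rewrite !normrM mulrC ler_wpM2r//.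
  by rewrite (le_trans (gM x))// ler_norm.
Qed.

Lemma meas_indic (A : set R) : measurable A -> meas (\1_A).
Proof. by move=> mA; exact: measurable_indic. Qed.

Lemma intg_restrict (A : set R) f : measurable A -> intg f -> intg (f \_ A).
Proof.
move=> mA intf; rewrite /intg -restrict_EFin.
apply/integrable_restrict => //; rewrite setTI; exact: integrableS intf.
Qed.

Lemma le_integral_intg f g : intg f -> intg g -> (forall x, f x <= g x) ->
  \int[mu]_x f x <= \int[mu]_x g x.
Proof. by move=> ? ? ?; exact: le_Rintegral. Qed.

Lemma integral_ge0_real f : (forall x, 0 <= f x) -> 0 <= \int[mu]_x f x.
Proof. by move=> f0; apply: Rintegral_ge0. Qed.

Lemma RintD f g : intg f -> intg g ->
  \int[mu]_x (f x + g x) = \int[mu]_x f x + \int[mu]_x g x.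
Proof. by move=> If Ig; rewrite RintegralD. Qed.

Lemma RintB f g : intg f -> intg g ->
  \int[mu]_x (f x - g x) = \int[mu]_x f x - \int[mu]_x g x.
Proof. by move=> If Ig; rewrite RintegralB. Qed.

Lemma RintZ c f : intg f -> \int[mu]_x (c * f x) = c * \int[mu]_x f x.
Proof. by move=> If; rewrite RintegralZl. Qed.

Lemma eq_Rint f g : f =1 g -> \int[mu]_x f x = \int[mu]_x g x.
Proof. by move=> fg; apply: eq_Rintegral => x _; exact: fg. Qed.

Lemma EFin_integral f : intg f -> (\int[mu]_x f x)%:E = (\int[mu]_x (f x)%:E)%E.
Proof. by move=> ?; rewrite fineK//; exact: integrable_fin_num. Qed.

Lemma ler_normr_integral f g : intg f -> intg g -> (forall x, `|f x| <= g x) ->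
  `|\int[mu]_x f x| <= \int[mu]_x g x.
Proof.
move=> ? ? fg; apply: (le_trans (le_normr_Rintegral _ _)) => //.
by apply: le_Rintegral => //; exact: intg_norm.
Qed.

Lemma ge0_intg f : meas f -> (forall x, 0 <= f x) ->
  (\int[mu]_x (f x)%:E < +oo)%E -> intg f.
Proof.
move=> mf f0 foo; apply/integrableP; split; first exact/measurable_EFinP.
by under eq_integral do rewrite /= ger0_norm//.
Qed.

Lemma intg_bounded_itv f a b : meas f -> (exists M, forall x, `|f x| <= M) ->
  intg (f \_ `[a, b]).
Proof.
move=> mf [M fM]; apply: (@intg_le (fun x => M * \1_(`[a, b] : set R) x)).
- by apply/measurable_restrict => //; rewrite setTI; apply: measurable_funTS.
- move=> x; rewrite patchE indicE; case: ifP => _.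
    by rewrite mulr1 (le_trans (fM x))// ler_norm.
  by rewrite mulr0.
- by apply: intgZ; exact: integrable_indic_itv.
Qed.

Lemma ae_Rintegral (D : set R) f g : ae_equal f g ->
  \int[mu]_(x in D) f x = \int[mu]_(x in D) g x.
Proof.
move=> fg; rewrite /Rintegral; congr fine.
rewrite integral_mkcond [RHS]integral_mkcond integralE [RHS]integralE.
case: fg => N [mN N0 fgN].
by congr (_ - _)%E; apply: ge0_ae_integral => //; exists N; split => // x /= xD;
  apply: fgN => /= fgx; apply: xD; rewrite !(funeposE, funenegE) !patchE fgx.
Qed.

End real_integrals.

Section square_integrable_functions.
Context {R : realType}.
Implicit Types (f g h : R -> R) (a b c x y : R).
Local Notation mu := (@lebesgue_measure R).

Definition sqint f := meas f /\ intg (fun x => f x ^+ 2).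

Definition sqnorm f := \int[mu]_x (f x ^+ 2).

Lemma sqnorm_ge0 f : 0 <= sqnorm f.
Proof. by apply: integral_ge0_real => x; exact: sqr_ge0. Qed.

Lemma measX2 f : meas f -> meas (fun x => f x ^+ 2).
Proof. by move=> mf; exact: measurable_funX. Qed.

Lemma sqint_le g f : meas f -> (forall x, `|f x| <= `|g x|) -> sqint g -> sqint f.
Proof.
move=> mf fg [mg ig]; split => //; apply: intg_le ig; first exact: measX2.
by move=> x; rewrite !normrX lerXn2r// nnegrE.
Qed.

Lemma sqintM f g : sqint f -> sqint g -> intg (fun x => f x * g x).
Proof.
move=> [mf ff] [mg gg]; apply: intg_le (intgD ff gg).
  exact: measurable_funM.
move=> x; rewrite ler_norml ger0_norm ?addr_ge0 ?sqr_ge0//.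
have := sqr_ge0 (f x + g x); have := sqr_ge0 (f x - g x).
by have := sqr_ge0 (f x); have := sqr_ge0 (g x); lra.
Qed.

Lemma sqintD f g : sqint f -> sqint g -> sqint (fun x => f x + g x).
Proof.
move=> ff gg; split; first by apply: measurable_funD; [case: ff|case: gg].
have ffgg := intgD (intgD ff.2 gg.2) (intgZ 2 (sqintM ff gg)).
by apply: eq_intg ffgg => x; ring.
Qed.

Lemma sqintZ c f : sqint f -> sqint (fun x => c * f x).
Proof.
move=> [mf ff]; split; first exact: measurable_funM.
by apply: eq_intg (intgZ (c ^+ 2) ff) => x; ring.
Qed.

Lemma sqintN f : sqint f -> sqint (fun x => - f x).
Proof. by move=> /(sqintZ (-1)) h; congr sqint: h; apply/funext => x; ring. Qed.

Lemma sqintB f g : sqint f -> sqint g -> sqint (fun x => f x - g x).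
Proof. by move=> ff /sqintN gg; exact: sqintD. Qed.

Lemma sqint_norm f : sqint f -> sqint (fun x => `|f x|).
Proof.
move=> [mf ff]; apply: (@sqint_le f) => //; first exact: measurableT_comp.
by move=> x; rewrite normr_id.
Qed.

Lemma sqintM_bounded M f g : sqint f -> meas g -> (forall x, `|g x| <= M) ->
  sqint (fun x => f x * g x).
Proof.
move=> sf mg gM; apply: (@sqint_le (fun x => M * f x)); last exact: sqintZ.
  by apply: measurable_funM => //; case: sf.
move=> x; rewrite !normrM mulrC ler_wpM2r//.
by rewrite (le_trans (gM x))// ler_norm.
Qed.

Lemma intg_bounded_sqint M f : intg f -> (forall x, `|f x| <= M) -> sqint f.
Proof.
move=> fi fM; split; first exact: intg_meas.
apply: eq_intg (intgM_bounded fi (intg_meas fi) fM) => x; exact: expr2.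
Qed.

Lemma sqnormZ c f : sqint f -> sqnorm (fun x => c * f x) = c ^+ 2 * sqnorm f.
Proof.
move=> [mf ff]; rewrite /sqnorm -RintegralZl//.
by apply: eq_Rintegral => x _; rewrite exprMn.
Qed.

Lemma le_sqnorm f g : sqint f -> sqint g -> (forall x, `|f x| <= `|g x|) ->
  sqnorm f <= sqnorm g.
Proof.
move=> [mf ff] [mg gg] fg; apply: le_integral_intg => // x.
by rewrite -real_normK ?num_real// -[leRHS]real_normK ?num_real// lerXn2r// nnegrE.
Qed.

Lemma sqnormD f g : sqint f -> sqint g ->
  sqnorm (fun x => f x + g x) =
  sqnorm f + sqnorm g + 2 * \int[mu]_x (f x * g x).
Proof.
move=> ff gg; rewrite /sqnorm -RintegralZl//; last exact: sqintM.
rewrite -RintegralD//; [|exact: ff.2|exact: gg.2].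
rewrite -RintegralD//; [|exact: (intgD ff.2 gg.2)|exact: (intgZ _ (sqintM ff gg))].
by apply: eq_Rintegral => x _; ring.
Qed.

Lemma sqnormB f g : sqint f -> sqint g ->
  sqnorm (fun x => f x - g x) =
  sqnorm f + sqnorm g - 2 * \int[mu]_x (f x * g x).
Proof.
move=> ff gg; rewrite (sqnormD ff (sqintN gg)).
have -> : sqnorm (fun x => - g x) = sqnorm g.
  by apply: eq_Rintegral => x _; rewrite sqrrN.
have -> : \int[mu]_x (f x * - g x) = -1 * \int[mu]_x (f x * g x).
  rewrite -RintegralZl//; last exact: sqintM.
  by apply: eq_Rintegral => x _; ring.
by ring.
Qed.

Lemma cauchy_schwarz f g : sqint f -> sqint g ->
  (\int[mu]_x (f x * g x)) ^+ 2 <= sqnorm f * sqnorm g.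
Proof.
move=> ff gg; set B := \int[mu]_x _.
have key l : 0 <= sqnorm f + l ^+ 2 * sqnorm g - 2 * (l * B).
  rewrite -sqnormZ// /B -RintegralZl//; last exact: sqintM.
  have -> : \int[mu]_x (l * (f x * g x)) = \int[mu]_x (f x * (l * g x)).
    by apply: eq_Rintegral => x _; rewrite mulrCA.
  by rewrite -(sqnormB ff (sqintZ l gg)) sqnorm_ge0.
have := sqnorm_ge0 g; rewrite le_eqVlt => /predU1P[g0|g0].
  rewrite -g0 mulr0 leNgt; apply/negP => B0.
  have := key ((sqnorm f + 1) / (2 * B)); rewrite -g0 mulr0 addr0.
  have B0' : B != 0 by move: B0; case: eqP => // ->; rewrite expr0n ltxx.
  have -> : 2 * ((sqnorm f + 1) / (2 * B) * B) = sqnorm f + 1.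
    by field.
  by lra.
have := key (B / sqnorm g).
have -> : sqnorm f + (B / sqnorm g) ^+ 2 * sqnorm g - 2 * (B / sqnorm g * B) =
  (sqnorm f * sqnorm g - B ^+ 2) / sqnorm g by field; rewrite gt_eqF.
by rewrite pmulr_lge0 ?invr_gt0// subr_ge0.
Qed.

Lemma cauchy_schwarz_sqrt f g : sqint f -> sqint g ->
  `|\int[mu]_x (f x * g x)| <= Num.sqrt (sqnorm f) * Num.sqrt (sqnorm g).
Proof.
move=> ff gg; rewrite -sqrtrM ?sqnorm_ge0// -sqrtr_sqr ler_wsqrtr//.
exact: cauchy_schwarz.
Qed.

Lemma sqnormD_le f g : sqint f -> sqint g ->
  sqnorm (fun x => f x + g x) <= 2 * sqnorm f + 2 * sqnorm g.
Proof.
move=> ff gg; have := sqnorm_ge0 (fun x => f x - g x).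
by rewrite sqnormB// sqnormD//; lra.
Qed.

Lemma L2normE f : L2norm f = ((\int[mu]_x (f x ^+ 2)%:E) `^ 2^-1)%E.
Proof.
rewrite /L2norm unlock; congr poweR; apply: eq_integral => x _ /=.
by rewrite powR_mulrn// real_normK// num_real.
Qed.

Lemma L2norm_sqint f : sqint f -> L2norm f = (Num.sqrt (sqnorm f))%:E.
Proof.
move=> [mf ff]; rewrite L2normE -EFin_integral// poweR_EFin powR12_sqrt//.
exact: sqnorm_ge0.
Qed.

Lemma L2norm_lty_sqint f : meas f -> (L2norm f < +oo)%E -> sqint f.
Proof.
move=> mf; rewrite L2normE => fy; split => //; apply: ge0_intg; first exact: measX2.
  by move=> x; exact: sqr_ge0.
by apply: (@lty_poweRy _ _ 2^-1) => //; rewrite invr_eq0.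
Qed.

Lemma sqint_Lfun f : f \in Lfun mu 2%:E -> sqint f.
Proof.
move=> fL; split; last exact: Lfun2_integrable_sqr.
by move: fL; rewrite inE => /andP[/[!inE]].
Qed.

Lemma Lfun_sqint f : sqint f -> f \in Lfun mu 2%:E.
Proof.
move=> ff; rewrite inE; apply/andP; split; first by rewrite inE; case: ff.
by rewrite inE/= /finite_norm -/(L2norm f) L2norm_sqint// ltry.
Qed.

Lemma ae_L2norm f g : ae_equal f g -> L2norm f = L2norm g.
Proof.
case=> N [mN N0 fgN]; rewrite !L2normE; congr poweR.
apply: ge0_ae_integral => [x|x|]; rewrite ?lee_fin ?sqr_ge0//.
exists N; split => // x /= fgx.
by apply: fgN => /= fgx'; apply: fgx; rewrite fgx'.
Qed.

Lemma square_integrableP f :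
  square_integrable f <-> exists2 g, sqint g & ae_equal f g.
Proof.
split=> -[g gg fg]; exists g => //; [exact: sqint_Lfun|exact: Lfun_sqint].
Qed.

End square_integrable_functions.

Section limit_theorems.
Context {R : realType}.
Implicit Types (f g h : R -> R).
Local Notation mu := (@lebesgue_measure R).

Lemma cvg_comp_EFin (T : Type) (F : set_system T) {FF : Filter F} (u : T -> R) l :
  u x @[x --> F] --> l -> (u x)%:E @[x --> F] --> l%:E.
Proof. by move=> ul; apply: cvg_EFin; [exact: nearW|exact: ul]. Qed.

Lemma cvg_eqr (T : Type) (F : set_system T) {FF : ProperFilter F} (u w : T -> R) (l l' : R) :
  u x @[x --> F] --> l -> w x @[x --> F] --> l' -> u =1 w -> l = l'.
Proof.
move=> ul wl /funext uw; rewrite -uw in wl.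
by rewrite -(cvg_lim (@Rhausdorff R) ul) -(cvg_lim (@Rhausdorff R) wl).
Qed.

Lemma cvg_ler (T : Type) (F : set_system T) {FF : ProperFilter F} (u : T -> R) l C :
  u x @[x --> F] --> l -> (\forall x \near F, u x <= C) -> l <= C.
Proof.
move=> ul uC; rewrite -(cvg_lim (@Rhausdorff R) ul); apply: limr_le => //.
by apply/cvg_ex; exists l.
Qed.

Lemma cvg_ger (T : Type) (F : set_system T) {FF : ProperFilter F} (u : T -> R) l C :
  u x @[x --> F] --> l -> (\forall x \near F, C <= u x) -> C <= l.
Proof.
move=> ul uC; rewrite -(cvg_lim (@Rhausdorff R) ul); apply: limr_ge => //.
by apply/cvg_ex; exists l.
Qed.

Lemma dominated_cvg_real (f_ : nat -> R -> R) f g : (forall n, meas (f_ n)) -> meas f ->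
  {ae mu, forall x, f_ n x @[n --> \oo] --> f x} -> intg g ->
  (forall n x, `|f_ n x| <= g x) ->
  \int[mu]_x f_ n x @[n --> \oo] --> \int[mu]_x f x.
Proof.
move=> mf_ mf [N [mN N0 f_fN]] ig f_g.
have if_ n : intg (f_ n).
  by apply: intg_le ig => // x; rewrite (le_trans (f_g n x))// ler_norm.
have [] := @dominated_convergence _ _ _ mu setT measurableT
  (fun n => EFin \o f_ n) (EFin \o f) (EFin \o g) => //.
- by move=> n; apply/measurable_EFinP; exact: mf_.
- exact/measurable_EFinP.
- exists N; split => // x /= nx; apply: f_fN => /= cx; apply: nx => _.
  exact: cvg_comp_EFin.
- by apply: aeW => x n _; rewrite lee_fin.
move=> if1 _ cf; rewrite /Rintegral; apply: fine_cvg.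
by rewrite fineK//; exact: integrable_fin_num.
Qed.

Lemma fatou_real (f_ : nat -> R -> R) f C : (forall n, meas (f_ n)) -> meas f ->
  (forall n x, 0 <= f_ n x) -> (forall x, f_ n x @[n --> \oo] --> f x) ->
  (forall n, intg (f_ n)) -> (forall n, \int[mu]_x f_ n x <= C) ->
  intg f /\ \int[mu]_x f x <= C.
Proof.
move=> mf_ mf f0 cf if_ fC.
have f0' x : 0 <= f x by apply: cvg_ger (cf x) _; exact: nearW.
have fE x : (limn_einf (fun n => (f_ n x)%:E) = (f x)%:E)%E.
  apply: (cvg_limn_einf_sup _).1; exact: cvg_comp_EFin.
have le : (\int[mu]_x (f x)%:E <= C%:E)%E.
  have := @fatou _ _ _ mu setT measurableT (fun n => EFin \o f_ n) _ _.
  under eq_integral do rewrite /= fE.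
  move=> h; apply: (le_trans (h _ _)).
  - by move=> n; apply/measurable_EFinP; exact: mf_.
  - by move=> n x _ /=; rewrite lee_fin.
  rewrite limn_einf_lim; apply: lime_le; first exact: is_cvg_einfs.
  apply: nearW => n; apply: (@le_trans _ _ (\int[mu]_x (f_ n x)%:E)%E).
    by apply: ereal_inf_lbound; exists n => /=.
  by rewrite -EFin_integral// lee_fin.
have intf : intg f by apply: ge0_intg => //; exact: le_lt_trans le (ltry _).
by split => //; rewrite -lee_fin EFin_integral.
Qed.

End limit_theorems.

(** * Fubini and reflections *)

Section fubini.
Context {R : realType}.
Implicit Types (f g a b : R -> R) (F : R * R -> R).
Local Notation mu := (@lebesgue_measure R).

(** The integral is the difference of the integrals of the positive and negative parts, each
    measurable in [x] by Tonelli, and [fine] is measurable. Thus no integrability of [F] has to be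
    checked. *)
Lemma meas_integral2 F : measurable_fun [set: R * R] F ->
  meas (fun x => \int[mu]_y F (x, y)).
Proof.
move=> mF; rewrite /meas /Rintegral.
apply: measurableT_comp => //.
rewrite (_ : (fun x => _) = (fun x => (\int[mu]_y (EFin \o F)^\+ (x, y)) -
                                     (\int[mu]_y (EFin \o F)^\- (x, y)))%E); last first.
  by apply/funext => x; rewrite integralE; congr (_ - _)%E; apply: eq_integral => y _;
     rewrite ?(funeposE, funenegE).
apply: emeasurable_funB.
  apply: (@measurable_fun_fubini_tonelli_F _ _ _ _ _ mu (EFin \o F)^\+%E) => //.
  by apply: measurable_funepos; exact/measurable_EFinP.
apply: (@measurable_fun_fubini_tonelli_F _ _ _ _ _ mu (EFin \o F)^\-%E) => //.
by apply: measurable_funeneg; exact/measurable_EFinP.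
Qed.

Lemma fubini_real F g : measurable_fun [set: R * R] F ->
  (forall x, intg (fun y => F (x, y))) -> (forall y, intg (fun x => F (x, y))) ->
  (forall x, \int[mu]_y `|F (x, y)| <= g x) -> intg g ->
  [/\ intg (fun x => \int[mu]_y F (x, y)),
      intg (fun y => \int[mu]_x F (x, y)) &
      \int[mu]_x (\int[mu]_y F (x, y)) = \int[mu]_y (\int[mu]_x F (x, y))].
Proof.
move=> mF iF1 iF2 Fg ig.
have iF : (mu \x mu)%E.-integrable [set: R * R] (EFin \o F).
  apply/integrable12ltyP; first exact/measurable_EFinP.
  have : (\int[mu]_x `|(g x)%:E| < +oo)%E by case/integrableP : ig.
  apply: le_lt_trans; apply: ge0_le_integral => //.
  - by move=> x _; exact: integral_ge0.
  - apply: (@measurable_fun_fubini_tonelli_F _ _ _ _ _ mu (abse \o (EFin \o F))) => //.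
      by apply: measurableT_comp => //; exact/measurable_EFinP.
    by move=> x; exact: abse_ge0.
  - by apply: measurableT_comp => //; apply/measurable_EFinP; exact: intg_meas.
  - move=> x _.
    under eq_integral do rewrite /= -/(EFin _).
    rewrite -(EFin_integral (intg_norm (iF1 x))) lee_fin (le_trans (Fg x))//.
    exact: ler_norm.
have E1 x : (\int[mu]_y F (x, y))%:E = (\int[mu]_y (EFin \o F) (x, y))%E.
  by rewrite (EFin_integral (iF1 x)).
have E2 y : (\int[mu]_x F (x, y))%:E = (\int[mu]_x (EFin \o F) (x, y))%E.
  by rewrite (EFin_integral (iF2 y)).
have intG : mu.-integrable [set: R] (fun y => \int[mu]_x (EFin \o F) (x, y))%E.
  have mG := @measurable_fubini_G _ _ _ _ _ mu mu _ iF.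
  apply/integrableP; split; first exact: mG.
  have mEF := measurable_int _ iF.
  apply: le_lt_trans ((integrable21ltyP mu mu mEF).1 iF).
  apply: ge0_le_integral => //.
  - by apply: measurableT_comp => //; exact: mG.
  - apply: (@measurable_fun_fubini_tonelli_G _ _ _ _ _ mu (abse \o (EFin \o F))) => //.
      exact: measurableT_comp.
    by move=> z; exact: abse_ge0.
  - move=> y _; apply: le_abse_integral => //; apply/measurable_EFinP.
    exact: intg_meas.
split.
- apply: eq_integrable (@integrable_fubini_F _ _ _ _ _ mu mu _ iF) => // x _.
  by rewrite /= E1.
- apply: eq_integrable intG => // x _.
  by rewrite /= E2.
- rewrite /Rintegral -/(Rintegral _ _ _); congr fine.
  transitivity (\int[mu]_x \int[mu]_y (EFin \o F) (x, y))%E.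
    by apply: eq_integral => x _; rewrite -E1.
  rewrite (Fubini iF).
  by apply: eq_integral => x _; rewrite -E2.
Qed.

(** [a x * b y] is integrable on the plane and a bounded kernel preserves this. It is applied to [k]
    made of values of sine and cosine, to exchange a transform with another integral. *)
Lemma fubini_bounded_kernel a b (k : R * R -> R) M : intg a -> intg b ->
  measurable_fun [set: R * R] k -> (forall z, `|k z| <= M) ->
  [/\ intg (fun x => a x * \int[mu]_y (b y * k (x, y))),
      intg (fun y => b y * \int[mu]_x (a x * k (x, y))) &
      \int[mu]_x (a x * \int[mu]_y (b y * k (x, y))) =
      \int[mu]_y (b y * \int[mu]_x (a x * k (x, y)))].
Proof.
move=> ia ib mk kM.
pose F z := a z.1 * (b z.2 * k z).
have ma := intg_meas ia; have mb := intg_meas ib.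
have mF : measurable_fun [set: R * R] F.
  apply: measurable_funM; first exact: measurableT_comp.
  by apply: measurable_funM => //; exact: measurableT_comp.
have mk1 x : meas (fun y => k (x, y)) by exact: measurable_fun_pair2.
have mk2 y : meas (fun x => k (x, y)) by exact: measurable_fun_pair1.
have ibk x : intg (fun y => b y * k (x, y)) by exact: (@intgM_bounded _ M).
have iak y : intg (fun x => a x * k (x, y)) by exact: (@intgM_bounded _ M).
have iF1 x : intg (fun y => F (x, y)) by exact: (intgZ (a x) (ibk x)).
have iF2 y : intg (fun x => F (x, y)).
  by apply: eq_intg (intgZ (b y) (iak y)) => x; rewrite /F/=; ring.
have [] := @fubini_real F (fun x => M * (\int[mu]_y `|b y|) * `|a x|) mF iF1 iF2.
- move=> x; have -> : M * (\int[mu]_y `|b y|) * `|a x| =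
      \int[mu]_y (M * `|a x| * `|b y|).
    by rewrite RintegralZl//; [ring|exact: intg_norm].
  apply: le_integral_intg; [exact: intg_norm|exact: (intgZ _ (intg_norm ib))|].
  move=> y; rewrite /F/= !normrM mulrA mulrC mulrA ler_wpM2r// ler_wpM2r//.
- exact: (intgZ _ (intg_norm ia)).
have E1 x : \int[mu]_y F (x, y) = a x * \int[mu]_y (b y * k (x, y)).
  by rewrite -RintegralZl//; exact: ibk.
have E2 y : \int[mu]_x F (x, y) = b y * \int[mu]_x (a x * k (x, y)).
  rewrite -RintegralZl//; last exact: iak.
  by apply: eq_Rintegral => x _; rewrite /F/=; ring.
move=> I1 I2 I12; split.
- by apply: eq_intg I1 => x; rewrite E1.
- by apply: eq_intg I2 => x; rewrite E2.
- transitivity (\int[mu]_x (\int[mu]_y F (x, y))).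
    by apply: eq_Rintegral => x _; rewrite E1.
  by rewrite I12; apply: eq_Rintegral => y _; rewrite E2.
Qed.

End fubini.

Section reflections.
Context {R : realType}.
Implicit Types (f g : R -> R) (a : R).
Local Notation mu := (@lebesgue_measure R).

Lemma meas_reflect a : measurable_fun [set: R] (fun x : R => a - x).
Proof. exact: measurable_funB. Qed.

Lemma lebesgue_measure_reflect a (A : set R) : measurable A ->
  pushforward mu (fun x : R => a - x : measurableTypeR R) A = mu A.
Proof.
move=> mA; apply/esym/lebesgue_measure_unique => //=.
  exact: meas_reflect.
move=> _ _ [[u v]] _ <-.
rewrite /pushforward.
(* Half-open intervals change type under a reflection, but keep their length, which is what
   characterizes the measure. *)
have -> : (fun x : R => a - x) @^-1` `]u, v]%classic = `[a - v, a - u[%classic.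
  by apply/seteqP; split => x /=; rewrite !in_itv/=; lra.
rewrite !lebesgue_measure_itv/= !lte_fin.
have -> : (a - v < a - u) = (u < v) by lra.
by case: ifP => // _; rewrite -!EFinD; congr EFin; ring.
Qed.

Lemma integral_pushforward_reflect a (g : R -> \bar R) :
  (\int[mu]_x g x =
   \int[pushforward mu (fun x : R => (a - x)%R : measurableTypeR R)]_x g x)%E.
Proof.
apply: eq_measure_integral => [|mphi A mA _]; first exact: meas_reflect.
exact/esym/lebesgue_measure_reflect.
Qed.

Lemma intg_reflect a f : intg f -> intg (fun x => f (a - x)).
Proof.
move=> /integrableP[/measurable_EFinP mf foo].
apply/integrableP; split.
  apply/measurable_EFinP; apply: (@measurableT_comp _ _ _ _ _ _ f) => //.
  exact: meas_reflect.
move: foo; rewrite (integral_pushforward_reflect a) ge0_integral_pushforward//.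
  exact: meas_reflect.
by apply: measurableT_comp => //; exact/measurable_EFinP.
Qed.

Lemma integral_reflect a f : intg f -> \int[mu]_x f (a - x) = \int[mu]_x f x.
Proof.
move=> fi; have mf := intg_meas fi.
rewrite /Rintegral; congr fine; apply/esym.
rewrite (integral_pushforward_reflect a) integral_pushforward//.
- exact: meas_reflect.
- exact/measurable_EFinP.
- exact: intg_reflect.
Qed.

(** A translation is a composition of two reflections, so its invariance follows from that of
    reflections. *)
Lemma shiftE a x : 0 - (- a - (x : R)) = x + a.
Proof. by ring. Qed.

Lemma intg_shift a f : intg f -> intg (fun x => f (x + a)).
Proof.
move=> /(intg_reflect 0)/(intg_reflect (- a)).
by apply: eq_intg => x; rewrite shiftE.
Qed.

Lemma integral_shift a f : intg f -> \int[mu]_x f (x + a) = \int[mu]_x f x.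
Proof.
move=> fi; rewrite -[RHS](integral_reflect 0)// -[RHS](integral_reflect (- a))//.
  by apply: eq_Rintegral => x _; rewrite shiftE.
exact: intg_reflect.
Qed.

End reflections.

(** * Exponential and Poisson kernels *)

Section exponential_kernel.
Context {R : realType}.
Implicit Types (f F : R -> R) (d x y : R).
Local Notation mu := (@lebesgue_measure R).

Lemma integral_even f : intg f -> (forall x, f (- x) = f x) ->
  \int[mu]_x f x = 2 * \int[mu]_(x in `[0, +oo[) f x.
Proof.
move=> fi fe; have mf := intg_meas fi.
have i1 : mu.-integrable `[(0:R), +oo[ (EFin \o f) by exact: integrableS fi.
have i2 : mu.-integrable `](0:R), +oo[ (EFin \o f) by exact: integrableS fi.
have i3 : mu.-integrable `]-oo, (0:R)] (EFin \o f) by exact: integrableS fi.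
have -> : \int[mu]_x f x =
    \int[mu]_(x in `]-oo, 0]) f x + \int[mu]_(x in `]0, +oo[) f x.
  have -> : [set: R] = `]-oo, 0] `|` `]0, +oo[.
    apply/esym/seteqP; split => x //= _; rewrite !in_itv/= andbT.
    by case: (leP x 0); [left|right].
  rewrite Rintegral_setU//=.
  - apply: integrableS fi => //; exact: measurableU.
  - by apply/disj_setPS => x /=; rewrite !in_itv/= andbT; lra.
rewrite Rintegral_itv_obnd_cbnd//.
suff -> : \int[mu]_(x in `]-oo, 0]) f x = \int[mu]_(x in `[0, +oo[) f x by ring.
rewrite Rintegral_mkcond [RHS]Rintegral_mkcond.
rewrite -(integral_reflect 0); last exact: intg_restrict.
apply: eq_Rintegral => x _; rewrite !patchE !mem_setE !in_itv/= andbT sub0r.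
by rewrite oppr_le0 fe.
Qed.

Lemma integral_halfline f F l : continuous f ->
  (forall x, is_derive x 1 F (f x)) -> intg (f \_ `[0, +oo[) ->
  F x @[x --> +oo] --> l -> \int[mu]_(x in `[0, +oo[) f x = l - F 0.
Proof.
move=> cf dF fi Fl.
have mf : meas f by exact: continuous_measurable_fun.
have dF' x : derivable F x 1 by have [] := dF x.
have cF : continuous F.
  by move=> x; exact/differentiable_continuous/derivable1_diffP.
pose g n := f \_ (`[0, n.+1%:R] : set R).
have gE n : \int[mu]_x g n x = F n.+1%:R - F 0.
  rewrite -Rintegral_mkcond /Rintegral (@continuous_FTC2 _ f F)//=.
  - exact: continuous_subspaceT.
  - split; first by move=> x _; exact: dF'.
      by apply: cvg_at_right_filter; exact: cF.
    by apply: cvg_at_left_filter; exact: cF.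
  - by move=> x _; rewrite derive1E (@derive_val _ _ _ _ _ _ _ (dF x)).
have : \int[mu]_x g n x @[n --> \oo] --> \int[mu]_x (f \_ `[0, +oo[) x.
  apply: (@dominated_cvg_real _ _ _ (fun x => `|(f \_ `[0, +oo[) x|)).
  - by move=> n; apply/measurable_restrict => //; exact: measurable_funTS.
  - exact: intg_meas fi.
  - apply: aeW => x; apply: (@cvg_near_cst).
    near=> n; rewrite /g !patchE !mem_setE !in_itv/= andbT.
    have -> : x <= n.+1%:R.
      near: n; exists (Num.truncn `|x|).+1 => // n /= xn.
      apply: (le_trans (ler_norm x)); apply: ltW.
      apply: (lt_le_trans (truncnS_gt _)); rewrite ler_nat.
      exact: (leq_trans xn).
    by rewrite andbT.
  - exact: intg_norm.
  - move=> n x; rewrite /g !patchE !mem_setE !in_itv/= andbT.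
    by case: ifPn => [/andP[-> _]//|_]; rewrite normr0.
rewrite -Rintegral_mkcond; under eq_cvg do rewrite gE.
move=> h; apply/esym/(cvg_unique _ _ h); first exact: Rhausdorff.
apply: cvgB; last exact: cvg_cst.
move/cvg_pinftyP : Fl; apply.
by rewrite (cvg_shiftS (fun n => n%:R : R)); exact: cvgr_idn.
Unshelve. all: by end_near. Qed.

Definition expker d x : R := expR (- (d * `|x|)).

Lemma expker_ge0 d x : 0 <= expker d x.
Proof. exact: expR_ge0. Qed.

Lemma expker_le1 d x : 0 <= d -> expker d x <= 1.
Proof. by move=> d0; rewrite -expR0 ler_expR oppr_le0 mulr_ge0. Qed.

Lemma expker_bounded d x : 0 < d -> `|expker d x| <= 1.
Proof. by move=> d0; rewrite ger0_norm ?expker_ge0 ?expker_le1 ?ltW. Qed.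

Lemma continuous_expker d : continuous (expker d).
Proof.
move=> x; apply: continuous_comp; last exact: continuous_expR.
apply: cvgN; apply: cvgM; [exact: cvg_cst|exact: norm_continuous].
Qed.

Lemma meas_expker d : meas (expker d).
Proof. by apply: continuous_measurable_fun; exact: continuous_expker. Qed.

Lemma cvg_expR_decay d : 0 < d -> expR (- (d * x)) @[x --> +oo] --> (0 : R).
Proof.
move=> d0; have h : d * x @[x --> (+oo : set_system R)] --> +oo.
  apply/cvgryPge => A; near=> x.
  rewrite -ler_pdivrMl//; near: x; apply: nbhs_pinfty_ge; exact: num_real.
exact: (cvg_comp _ _ h (@cvgr_expR R)).
Unshelve. all: by end_near. Qed.

Lemma intg_expker d : 0 < d -> intg (expker d).
Proof.
move=> d0; apply: ge0_intg; [exact: meas_expker|exact: expker_ge0|].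
rewrite ge0_symfun_integralT//; last 3 first.
- exact: expker_ge0.
- exact: continuous_expker.
- by move=> x; rewrite /expker /= normrN.
rewrite -set_itvcy.
have -> : (\int[mu]_(x in `[0%R, +oo[) (expker d x)%:E =
    \int[mu]_(x in `[0%R, +oo[) (expR (- (d * x)))%:E)%E.
  apply: eq_integral; by move=> x; rewrite inE/= in_itv/= andbT => x0; rewrite /expker ger0_norm.
rewrite (@ge0_continuous_FTC2y _ _ (fun x => - expR (- (d * x)) / d) _ 0).
- by rewrite -EFinB -EFinM ltry.
- by move=> x _; exact: expR_ge0.
- apply: continuous_subspaceT => x; apply: continuous_comp; last exact: continuous_expR.
  by apply: cvgN; apply: cvgM; [exact: cvg_cst|exact: cvg_id].
- rewrite -[X in _ --> X](mul0r d^-1); apply: cvgM; last exact: cvg_cst.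
  by rewrite -[X in _ --> X]oppr0; apply: cvgN; exact: cvg_expR_decay.
- by move=> x _.
- apply: cvg_at_right_filter; apply: cvgM; last exact: cvg_cst.
  apply: cvgN; apply: continuous_comp; last exact: continuous_expR.
  by apply: cvgN; apply: cvgM; [exact: cvg_cst|exact: cvg_id].
- move=> x _; rewrite derive1E.
  have dF : is_derive x 1 (fun x => - expR (- (d * x)) / d) (expR (- (d * x))).
    apply: is_derive_eq; rewrite !(scaler0, scale0r, scalerN, scalerA, addr0, add0r).
    rewrite /GRing.scale/=; field; lra.
  by rewrite (@derive_val _ _ _ _ _ _ _ dF).
Qed.

(** Fourier transform of [expker d]: the Poisson kernel of the half-plane at height [d], multiplied
    by [2 * pi]. *)
Definition poisker d x : R := 2 * d / (d ^+ 2 + x ^+ 2).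

Lemma integral_cos_expker d y : 0 < d ->
  \int[mu]_x (expker d x * cos (x * y)) = poisker d y.
Proof.
move=> d0.
have mcos : meas (fun x => cos (x * y)).
  by apply: continuous_measurable_fun => x; apply: continuous_comp;
    [apply: cvgM; [exact: cvg_id|exact: cvg_cst]|exact: continuous_cos].
have fi : intg (fun x => expker d x * cos (x * y)).
  apply: (@intgM_bounded _ 1) => //; first exact: intg_expker.
  by move=> x; rewrite ler_norml cos_geN1 cos_le1.
have dy0 : 0 < d ^+ 2 + y ^+ 2 by rewrite ltr_wpDr ?sqr_ge0// exprn_gt0.
rewrite integral_even//; last by move=> x; rewrite /expker normrN mulNr cosN.
have -> : \int[mu]_(x in `[0, +oo[) (expker d x * cos (x * y)) =
    \int[mu]_(x in `[0, +oo[) (expR (- (d * x)) * cos (x * y)).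
  apply: eq_Rintegral; by move=> x; rewrite inE/= in_itv/= andbT => x0; rewrite /expker ger0_norm.
(* Real part of the primitive [exp ((- d + i y) x) / (- d + i y)]. *)
pose F x := expR (- (d * x)) * (y * sin (x * y) - d * cos (x * y)) / (d ^+ 2 + y ^+ 2).
have cf : continuous (fun x => expR (- (d * x)) * cos (x * y)).
  move=> x; apply: cvgM; last first.
    by apply: continuous_comp; [apply: cvgM; [exact: cvg_id|exact: cvg_cst]|exact: continuous_cos].
  apply: continuous_comp; last exact: continuous_expR.
  by apply: cvgN; apply: cvgM; [exact: cvg_cst|exact: cvg_id].
have dF x : is_derive x 1 F (expR (- (d * x)) * cos (x * y)).
  rewrite /F; apply: is_derive_eq.
  rewrite !(scaler0, scale0r, scalerN, scalerA, addr0, add0r).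
  rewrite /GRing.scale/=; field; lra.
rewrite (integral_halfline cf dF (l := 0)).
- rewrite /F mul0r mulr0 oppr0 expR0 sin0 cos0 /poisker; field; lra.
- apply: eq_intg (intg_restrict (measurable_itv `[0, +oo[) fi) => x.
  by rewrite !patchE mem_setE in_itv/= andbT; case: ifP => // x0; rewrite /expker ger0_norm.
- apply/cvgrPdist_lt => e e0; rewrite /F.
  have := cvg_expR_decay d0 => /cvgrPdist_lt.
  pose C := (`|y| + `|d|) / (d ^+ 2 + y ^+ 2) + 1.
  have C0 : 0 < C by rewrite /C ltr_pwDr// mulr_ge0// ?addr_ge0// invr_ge0 ltW.
  move=> /(_ (e / C) (divr_gt0 e0 C0)); apply: filterS => x.
  rewrite !sub0r !normrN ltr_pdivlMr// => h; apply: le_lt_trans h.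
  rewrite -mulrA normrM ler_wpM2l// normrM (gtr0_norm (_ : 0 < _^-1)) ?invr_gt0//.
  rewrite /C ler_wpDr//; apply: ler_wpM2r; first by rewrite invr_ge0 ltW.
  apply: (le_trans (ler_normB _ _)); rewrite !normrM.
  by apply: lerD; rewrite -[leRHS]mulr1 ler_wpM2l// ler_norml ?sin_geN1 ?sin_le1 ?cos_geN1 ?cos_le1.
Qed.

Lemma poisker_den d x : 0 < d -> 0 < d ^+ 2 + x ^+ 2.
Proof. by move=> d0; rewrite ltr_wpDr ?sqr_ge0// exprn_gt0. Qed.

Lemma poisker_ge0 d x : 0 < d -> 0 <= poisker d x.
Proof.
by move=> d0; rewrite /poisker mulr_ge0// ?mulr_ge0// ?ltW// ?invr_gt0 ?poisker_den.
Qed.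

Lemma poiskerN d x : poisker d (- x) = poisker d x.
Proof. by rewrite /poisker sqrrN. Qed.

Lemma continuous_poisker d : 0 < d -> continuous (poisker d).
Proof.
move=> d0 x; apply: cvgM; first exact: cvg_cst.
apply: cvgV; first by rewrite gt_eqF// poisker_den.
by apply: cvgD; [exact: cvg_cst|exact: exprn_continuous].
Qed.

Lemma meas_poisker d : 0 < d -> meas (poisker d).
Proof. by move=> d0; apply: continuous_measurable_fun; exact: continuous_poisker. Qed.

Lemma EFin_integral_poisker d : 0 < d -> (\int[mu]_x (poisker d x)%:E = (2 * pi)%:E)%E.
Proof.
move=> d0; rewrite ge0_symfun_integralT//; last 3 first.
- by move=> x; exact: poisker_ge0.
- exact: continuous_poisker.
- by move=> x; rewrite /= poiskerN.
have dF x : is_derive x 1 (fun x => 2 * atan (x / d)) (poisker d x).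
  apply: is_derive_eq.
  rewrite !(scaler0, scale0r, scalerN, scalerA, addr0, add0r) /poisker.
  have := poisker_den x d0; rewrite /GRing.scale/= => h; field.
  by rewrite !gt_eqF.
have dF' x : derivable (fun x => 2 * atan (x / d)) x 1 by have [] := dF x.
rewrite -set_itvcy.
rewrite (@ge0_continuous_FTC2y _ _ (fun x => 2 * atan (x / d)) _ pi).
- by rewrite mul0r atan0 mulr0 -EFinB -EFinM subr0.
- by move=> x _; exact: poisker_ge0.
- by apply: continuous_subspaceT; exact: continuous_poisker.
- rewrite [X in _ --> X](_ : _ = 2 * (pi / 2)); last by field.
  apply: cvgM; first exact: cvg_cst.
  have h : x / d @[x --> (+oo : set_system R)] --> +oo.
    apply/cvgryPge => A; near=> x.
    rewrite ler_pdivlMr//; near: x; apply: nbhs_pinfty_ge; exact: num_real.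
  exact: (cvg_comp _ _ h (@cvgy_atan R)).
- by move=> x _.
- apply: cvg_at_right_filter.
  have /derivable1_diffP/differentiable_continuous := dF' 0.
  by [].
- by move=> x _; rewrite derive1E (@derive_val _ _ _ _ _ _ _ (dF x)).
Unshelve. all: by end_near. Qed.

Lemma intg_poisker d : 0 < d -> intg (poisker d).
Proof.
move=> d0; apply: ge0_intg; first exact: meas_poisker.
  by move=> x; exact: poisker_ge0.
by rewrite EFin_integral_poisker// ltry.
Qed.

Lemma integral_poisker d : 0 < d -> \int[mu]_x poisker d x = 2 * pi.
Proof. by move=> d0; rewrite /Rintegral EFin_integral_poisker. Qed.

End exponential_kernel.

(** * Fourier transform in L2 *)

Section schur.
Context {R : realType}.
Implicit Types (f g : R -> R) (k c : R * R -> R).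
Local Notation mu := (@lebesgue_measure R).

Lemma schur_square g k M B : sqint g ->
  measurable_fun [set: R * R] k -> (forall z, 0 <= k z <= B) ->
  (forall x, intg (fun y => k (x, y))) -> (forall y, intg (fun x => k (x, y))) ->
  (forall y, \int[mu]_x k (x, y) <= M) ->
  intg (fun x => \int[mu]_y (g y ^+ 2 * k (x, y))) /\
  \int[mu]_x (\int[mu]_y (g y ^+ 2 * k (x, y))) <= M * sqnorm g.
Proof.
move=> sg mk kB ik1 ik2 kM2.
have igk1 x : intg (fun y => g y ^+ 2 * k (x, y)).
  apply: (@intgM_bounded _ B _ _ sg.2); first exact: measurable_fun_pair2.
  by move=> y; rewrite ger0_norm; case/andP: (kB (x, y)).
have igk2 y : intg (fun x => g y ^+ 2 * k (x, y)) by exact: (intgZ _ (ik2 y)).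
pose G z := g z.1 ^+ 2 * k (z.2, z.1).
have mG : measurable_fun [set: R * R] G.
  apply: measurable_funM.
    by apply: measurable_funX; exact: (measurableT_comp sg.1).
  by apply: (measurableT_comp mk); apply: measurable_fun_pair.
have kME y : \int[mu]_x (g y ^+ 2 * k (x, y)) <= M * g y ^+ 2.
  by rewrite (RintZ _ (ik2 y)) mulrC; apply: ler_wpM2r => //; exact: sqr_ge0.
have nG y : \int[mu]_x `|g y ^+ 2 * k (x, y)| <= M * g y ^+ 2.
  apply: le_trans (kME y); rewrite le_eqVlt; apply/orP; left; apply/eqP.
  apply: eq_Rint => x; rewrite ger0_norm// mulr_ge0 ?sqr_ge0//.
  by case/andP: (kB (x, y)).
have [iG2 iG1 EG] := @fubini_real _ G (fun y => M * g y ^+ 2) mG igk2 igk1 nG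
  (intgZ M sg.2).
split; first exact: iG1.
rewrite -[X in X <= _]EG -(RintZ M sg.2).
exact: (le_integral_intg iG2 (intgZ M sg.2) kME).
Qed.

Lemma normM_amgm (a b c k : R) : `|c| <= k ->
  `|a * (b * c)| <= 2^-1 * (a ^+ 2 * k) + 2^-1 * (b ^+ 2 * k).
Proof.
move=> ck; rewrite !normrM -(real_normK (num_real a)) -(real_normK (num_real b)).
have fg : `|a| * `|b| <= 2^-1 * `|a| ^+ 2 + 2^-1 * `|b| ^+ 2.
  by have := sqr_ge0 (`|a| - `|b|); lra.
have := ler_pM (mulr_ge0 (normr_ge0 a) (normr_ge0 b)) (normr_ge0 c) fg ck.
by rewrite mulrA => /le_trans; apply; rewrite mulrDl !mulrA.
Qed.

(** The inequality [|f g c| <= (f^2 k + g^2 k) / 2] reduces the bilinear form to row and column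
    integrals of [k], and the same majorant justifies Fubini. A signed [c] with a separate majorant
    [k] is allowed because the sine transform leads to a kernel that changes sign. *)
Lemma schur_test f g k c M B : sqint f -> sqint g ->
  measurable_fun [set: R * R] c -> measurable_fun [set: R * R] k ->
  (forall z, `|c z| <= k z) -> (forall z, k z <= B) ->
  (forall x, intg (fun y => k (x, y))) -> (forall y, intg (fun x => k (x, y))) ->
  (forall x, \int[mu]_y k (x, y) <= M) -> (forall y, \int[mu]_x k (x, y) <= M) ->
  [/\ intg (fun x => f x * \int[mu]_y (g y * c (x, y))),
      intg (fun y => g y * \int[mu]_x (f x * c (x, y))),
      \int[mu]_x (f x * \int[mu]_y (g y * c (x, y))) =
      \int[mu]_y (g y * \int[mu]_x (f x * c (x, y))) &
      `|\int[mu]_x (f x * \int[mu]_y (g y * c (x, y)))| <=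
      M / 2 * (sqnorm f + sqnorm g)].
Proof.
move=> sf sg mc mk ck kB ik1 ik2 kM1 kM2.
have k0B z : 0 <= k z <= B by rewrite kB andbT (le_trans _ (ck z)).
have [iG GM] := schur_square sg mk k0B ik1 ik2 kM2.
have sc1 x : sqint (fun y => c (x, y)).
  apply: (@sqint_le _ (fun y => k (x, y))); first exact: measurable_fun_pair2.
    by move=> y; rewrite (le_trans (ck _))// ler_norm.
  apply: (@intg_bounded_sqint _ B _ (ik1 x)) => y.
  by rewrite ger0_norm; case/andP: (k0B (x, y)).
have sc2 y : sqint (fun x => c (x, y)).
  apply: (@sqint_le _ (fun x => k (x, y))); first exact: measurable_fun_pair1.
    by move=> x; rewrite (le_trans (ck _))// ler_norm.
  apply: (@intg_bounded_sqint _ B _ (ik2 y)) => x.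
  by rewrite ger0_norm; case/andP: (k0B (x, y)).
have igk x : intg (fun y => g y ^+ 2 * k (x, y)).
  apply: (@intgM_bounded _ B _ _ sg.2); first exact: measurable_fun_pair2.
  by move=> y; rewrite ger0_norm; case/andP: (k0B (x, y)).
pose F z := f z.1 * (g z.2 * c z).
have mF : measurable_fun [set: R * R] F.
  apply: measurable_funM; first exact: (measurableT_comp sf.1).
  by apply: (measurable_funM _ mc); exact: (measurableT_comp sg.1).
have igc x := sqintM sg (sc1 x).
have ifc y := sqintM sf (sc2 y).
have iF1 x : intg (fun y => F (x, y)) by exact: (intgZ (f x) (igc x)).
have EF2 y x : F (x, y) = g y * (f x * c (x, y)) by rewrite /F mulrCA.
have iF2 y : intg (fun x => F (x, y)).
  by apply: eq_intg (intgZ (g y) (ifc y)) => x; exact: EF2.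
pose D x := 2^-1 * (M * f x ^+ 2) + 2^-1 * \int[mu]_y (g y ^+ 2 * k (x, y)).
have iD : intg D.
  exact: (intgD (intgZ _ (intgZ _ sf.2)) (intgZ _ iG)).
have FD x : \int[mu]_y `|F (x, y)| <= D x.
  pose L y := 2^-1 * (f x ^+ 2 * k (x, y)) + 2^-1 * (g y ^+ 2 * k (x, y)).
  have iL : intg L by exact: (intgD (intgZ _ (intgZ _ (ik1 x))) (intgZ _ (igk x))).
  apply: (@le_trans _ _ (\int[mu]_y L y)).
    apply: (le_integral_intg (intg_norm (iF1 x)) iL) => y.
    exact: normM_amgm.
  rewrite (RintD (intgZ _ (intgZ _ (ik1 x))) (intgZ _ (igk x))).
  rewrite (RintZ _ (intgZ _ (ik1 x))) (RintZ _ (ik1 x)) (RintZ _ (igk x)) /D.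
  rewrite lerD2r ler_wpM2l ?invr_ge0// mulrC.
  by apply: ler_wpM2r; [exact: sqr_ge0|exact: kM1].
have [I1 I2 I12] := fubini_real mF iF1 iF2 FD iD.
have E1 x : \int[mu]_y F (x, y) = f x * \int[mu]_y (g y * c (x, y)).
  exact: (RintZ (f x) (igc x)).
have E2 y : \int[mu]_x F (x, y) = g y * \int[mu]_x (f x * c (x, y)).
  by rewrite -(RintZ (g y) (ifc y)); apply: eq_Rint => x; exact: EF2.
have E1' : \int[mu]_x (f x * \int[mu]_y (g y * c (x, y))) =
    \int[mu]_x (\int[mu]_y F (x, y)) by apply: eq_Rint => x; rewrite E1.
split.
- by apply: eq_intg I1 => x; rewrite E1.
- by apply: eq_intg I2 => x; rewrite E2.
- by rewrite E1' I12; apply: eq_Rint => y; rewrite E2.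
rewrite E1'; apply: (@le_trans _ _ (\int[mu]_x D x)).
  apply: (ler_normr_integral I1 iD) => x; apply: le_trans (FD x).
  exact: (le_normr_Rintegral measurableT (iF1 x)).
rewrite (RintD (intgZ _ (intgZ _ sf.2)) (intgZ _ iG)).
rewrite (RintZ _ (intgZ _ sf.2)) (RintZ _ sf.2) (RintZ _ iG) -/(sqnorm f).
rewrite [leRHS](_ : _ = 2^-1 * (M * sqnorm f) + 2^-1 * (M * sqnorm g)); last first.
  clear; ring.
by rewrite lerD2l ler_wpM2l ?invr_ge0.
Qed.

End schur.

Section bessel.
Context {R : realType}.
Implicit Types (f g : R -> R) (b : bool) (x y d : R).
Local Notation mu := (@lebesgue_measure R).

Definition trig b x : R := if b then sin x else cos x.

Lemma trig_bounded b x : `|trig b x| <= 1.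
Proof. by case: b => /=; rewrite ler_norml ?sin_geN1 ?sin_le1 ?cos_geN1 ?cos_le1. Qed.

Lemma continuous_trig b : continuous (trig b).
Proof. by case: b; [exact: continuous_sin|exact: continuous_cos]. Qed.

Lemma trigM b x y :
  trig b x * trig b y = (cos (x - y) + (-1) ^+ b * cos (x + y)) / 2.
Proof. by case: b; rewrite /= cosB cosD ?expr1 ?expr0; field. Qed.

Lemma meas_trigM b x : meas (fun y => trig b (x * y)).
Proof.
apply: continuous_measurable_fun => y; apply: continuous_comp.
  by apply: cvgM; [exact: cvg_cst|exact: cvg_id].
exact: continuous_trig.
Qed.

Lemma measurable_trig2 b : measurable_fun [set: R * R] (fun z : R * R => trig b (z.1 * z.2)).
Proof.
apply: (@measurableT_comp _ _ _ _ _ _ (trig b)).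
  by apply: continuous_measurable_fun; exact: continuous_trig.
by apply: measurable_funM.
Qed.

(* [b = false] gives the cosine transform, [b = true] the sine transform. *)
Definition trigT b f y := \int[mu]_x (f x * trig b (x * y)).

Lemma intg_trig b f y : intg f -> intg (fun x => f x * trig b (x * y)).
Proof.
move=> fi; apply: (@intgM_bounded _ 1) => //; last by move=> x; exact: trig_bounded.
by under [X in meas X]eq_fun do rewrite mulrC; exact: meas_trigM.
Qed.

Lemma meas_trigT b f : meas f -> meas (trigT b f).
Proof.
move=> mf; apply: (@meas_integral2 _ (fun z => f z.2 * trig b (z.2 * z.1))).
apply: measurable_funM; first exact: measurableT_comp.
under [X in measurable_fun _ X]eq_fun do rewrite mulrC; exact: measurable_trig2.
Qed.

Lemma trigT_bounded b f y : intg f -> `|trigT b f y| <= \int[mu]_x `|f x|.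
Proof.
move=> fi; apply: ler_normr_integral; [exact: intg_trig|exact: intg_norm|].
by move=> x; rewrite normrM ler_piMr// trig_bounded.
Qed.

Lemma integral_trig_expker b d x y : 0 < d ->
  \int[mu]_z (expker d z * trig b (x * z) * trig b (y * z)) =
  (poisker d (x - y) + (-1) ^+ b * poisker d (x + y)) / 2.
Proof.
move=> d0.
have ic u : intg (fun z => expker d z * cos (z * u)).
  exact: (intg_trig false u (intg_expker d0)).
rewrite -!integral_cos_expker// -(RintZ _ (ic (x + y))).
rewrite -(RintD (ic _) (intgZ _ (ic _))) mulrC.
rewrite -(RintZ _ (intgD (ic _) (intgZ _ (ic _)))).
apply: eq_Rint => z; rewrite -mulrA trigM.
have -> : x * z - y * z = z * (x - y) by ring.
have -> : x * z + y * z = z * (x + y) by ring.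
by ring.
Qed.

Lemma poisker_le d x : 0 < d -> poisker d x <= 2 / d.
Proof.
move=> d0; rewrite /poisker ler_pdivrMr ?poisker_den//.
rewrite mulrDr (_ : 2 / d * d ^+ 2 = 2 * d); last by field; lra.
by rewrite lerDl mulr_ge0 ?sqr_ge0// divr_ge0// ltW.
Qed.

(** Kernel obtained by composing a transform, the damping [expker d] and the same transform: [s = 1]
    for cosines, [s = -1] for sines. The reflected term appears because these transforms see only
    the even or the odd part of a function. *)
Definition reflker s d (z : R * R) :=
  (poisker d (z.1 - z.2) + s * poisker d (z.1 + z.2)) / 2.

Lemma measurable_reflker s d : 0 < d -> measurable_fun [set: R * R] (reflker s d).
Proof.
move=> d0; apply: measurable_funM => //; apply: measurable_funD.
  by apply: (measurableT_comp (meas_poisker d0)); exact: measurable_funB.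
apply: measurable_funM => //.
by apply: (measurableT_comp (meas_poisker d0)); exact: measurable_funD.
Qed.

Lemma reflker_bounded s d z : `|s| <= 1 -> 0 < d -> `|reflker s d z| <= reflker 1 d z.
Proof.
move=> s1 d0; rewrite /reflker normrM (@ger0_norm _ 2^-1) ?invr_ge0//.
apply: ler_wpM2r; rewrite ?invr_ge0//.
apply: (le_trans (ler_normD _ _)); rewrite (normrM s) !(ger0_norm (poisker_ge0 _ d0)).
by rewrite lerD2l mul1r ler_piMl// poisker_ge0.
Qed.

Lemma reflker_le d z : 0 < d -> reflker 1 d z <= 2 / d.
Proof.
move=> d0; rewrite /reflker ler_pdivrMr// mulr_natr mul1r.
by apply: lerD; exact: poisker_le.
Qed.

Lemma reflkerC d x y : reflker 1 d (x, y) = reflker 1 d (y, x).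
Proof. by rewrite /reflker/= -(poiskerN d (x - y)) opprB (addrC x y). Qed.

Lemma intg_reflker d x : 0 < d ->
  intg (fun y => reflker 1 d (x, y)) /\ \int[mu]_y reflker 1 d (x, y) = 2 * pi.
Proof.
move=> d0; have ip := intg_poisker d0.
have ipm := intg_reflect x ip; have ipp := intg_shift x ip.
have E y : reflker 1 d (x, y) = 2^-1 * (poisker d (x - y) + poisker d (y + x)).
  by rewrite /reflker/= mul1r mulrC (addrC x y).
split; first by apply: eq_intg (intgZ 2^-1 (intgD ipm ipp)) => y; exact: E.
rewrite (eq_Rint E) (RintZ _ (intgD ipm ipp)) (RintD ipm ipp).
rewrite (integral_reflect x ip) (integral_shift x ip) integral_poisker//.
clear; lra.
Qed.

Lemma trigT_expker b f d x : 0 < d -> intg f ->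
  \int[mu]_y (trigT b f y * (expker d y * trig b (x * y))) =
  \int[mu]_z (f z * reflker ((-1) ^+ b) d (x, z)).
Proof.
move=> d0 fi.
have tr1 (z : R * R) : `|trig b (z.1 * z.2)| <= 1 by exact: trig_bounded.
have iex : intg (fun y => expker d y * trig b (y * x)).
  by apply: intg_trig; exact: intg_expker.
have [_ _ E] := fubini_bounded_kernel iex fi (measurable_trig2 b) tr1.
transitivity (\int[mu]_y (expker d y * trig b (y * x) *
                  \int[mu]_z (f z * trig b (y * z)))).
  apply: eq_Rint => y; rewrite mulrC (mulrC x); congr (_ * _).
  by apply: eq_Rint => z; rewrite (mulrC y).
rewrite E; apply: eq_Rint => z; congr (_ * _).
rewrite /reflker/= -(integral_trig_expker b x z d0).
by apply: eq_Rint => y; rewrite (mulrC x) (mulrC z).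
Qed.

(** The damped square integral of the transform is the quadratic form of [reflker] at [f]. The
    majorant [reflker 1 d] has all row integrals equal to [2 * pi], so the Schur test gives a bound
    independent of [d], and the damping can be removed by Fatou's lemma in [bessel]. *)
Lemma bessel_damped b f d : 0 < d -> intg f -> sqint f ->
  intg (fun y => trigT b f y ^+ 2 * expker d y) /\
  \int[mu]_y (trigT b f y ^+ 2 * expker d y) <= 2 * pi * sqnorm f.
Proof.
move=> d0 fi sf; set G := trigT b f.
have mG : meas G by apply: meas_trigT; exact: intg_meas.
have iGe : intg (fun y => G y * expker d y).
  apply: (@eq_intg _ (fun y => expker d y * G y)); first by move=> y; rewrite mulrC.
  apply: (intgM_bounded (intg_expker d0) mG) => y.
  exact: (trigT_bounded b y fi).
have tr1 (z : R * R) : `|trig b (z.1 * z.2)| <= 1 by exact: trig_bounded.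
have [J1 J2 J12] := fubini_bounded_kernel iGe fi (measurable_trig2 b) tr1.
have GE y : G y = \int[mu]_x (f x * trig b (y * x)).
  by apply: eq_Rint => x; rewrite (mulrC y).
have eqG y : G y ^+ 2 * expker d y =
    G y * expker d y * \int[mu]_x (f x * trig b (y * x)).
  by rewrite -GE; ring.
split; first by apply: eq_intg J1 => y; exact: eqG.
rewrite (eq_Rint eqG) J12.
pose c := reflker ((-1) ^+ b) d.
have inner x : f x * \int[mu]_y (G y * expker d y * trig b (y * x)) =
    f x * \int[mu]_z (f z * c (x, z)).
  congr (_ * _); rewrite -trigT_expker//; apply: eq_Rint => y.
  by rewrite mulrA (mulrC x).
rewrite (eq_Rint inner).
have mc := measurable_reflker ((-1) ^+ b) d0.
have mk := measurable_reflker 1 d0.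
have ck z : `|c z| <= reflker 1 d z.
  by apply: reflker_bounded => //; rewrite normrX normrN1 expr1n.
have ik1 x := (intg_reflker x d0).1.
have kM1 x : \int[mu]_y reflker 1 d (x, y) <= 2 * pi by rewrite (intg_reflker x d0).2.
have ik2 y : intg (fun x => reflker 1 d (x, y)).
  by apply: eq_intg (ik1 y) => x; exact: reflkerC.
have kM2 y : \int[mu]_x reflker 1 d (x, y) <= 2 * pi.
  by rewrite (eq_Rint (fun x => reflkerC d x y)).
have [_ _ _] := schur_test sf sf mc mk ck (fun z => reflker_le z d0) ik1 ik2 kM1 kM2.
move=> h; apply: (le_trans (ler_norm _)); apply: (le_trans h).
rewrite le_eqVlt; apply/orP; left; apply/eqP.
by clear; field.
Qed.

Lemma cvg_expker x : expker n.+1%:R^-1 x @[n --> \oo] --> (1 : R).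
Proof.
have h : - (n.+1%:R^-1 * `|x|) @[n --> \oo] --> (0 : R).
  rewrite -[X in _ --> X]oppr0 -[X in _ --> - X](mul0r `|x|).
  by apply: cvgN; apply: cvgM; [exact: cvg_harmonic|exact: cvg_cst].
have := cvg_comp _ _ h (@continuous_expR R 0).
by rewrite expR0.
Qed.

Lemma bessel b f : intg f -> sqint f ->
  sqint (trigT b f) /\ sqnorm (trigT b f) <= 2 * pi * sqnorm f.
Proof.
move=> fi sf.
have mG : meas (trigT b f) by apply: meas_trigT; exact: intg_meas.
have d0 n : 0 < n.+1%:R^-1 :> R by rewrite invr_gt0.
have [] := @fatou_real _ (fun n y => trigT b f y ^+ 2 * expker n.+1%:R^-1 y)
  (fun y => trigT b f y ^+ 2) (2 * pi * sqnorm f); last by [].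
- move=> n; apply: measurable_funM; [exact: measX2|exact: meas_expker].
- exact: measX2.
- by move=> n x; rewrite mulr_ge0 ?sqr_ge0 ?expker_ge0.
- move=> x; rewrite -[X in _ --> X]mulr1; apply: cvgM; first exact: cvg_cst.
  exact: cvg_expker.
- by move=> n; exact: (bessel_damped b (d0 n) fi sf).1.
- by move=> n; exact: (bessel_damped b (d0 n) fi sf).2.
Qed.

End bessel.

(** * Completeness of L2, with an explicit rate *)

Section completeness.
Context {R : realType}.
Local Notation mu := (@lebesgue_measure R).

Lemma cvg_series_weighted (d : nat -> R -> R) (w : R -> R) x : 0 < w x ->
  (\sum_(0 <= k <oo) (`|d k x| * w x)%:E < +oo)%E ->
  cvgn (series (fun k => d k x)).
Proof.
move=> w0 Hfin; apply: normed_cvg.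
apply: nondecreasing_is_cvgn.
  apply/nondecreasing_seqP => n; rewrite /normed_series_of /= !/series /=.
  by rewrite big_nat_recr//= lerDl.
have H0 : (0 <= \sum_(0 <= k <oo) (`|d k x| * w x)%:E)%E.
  by apply: nneseries_ge0 => k _ _; rewrite lee_fin mulr_ge0// ltW.
exists (fine (\sum_(0 <= k <oo) (`|d k x| * w x)%:E) / w x) => _ [n _ <-].
rewrite ler_pdivlMr// -lee_fin fineK; last by rewrite ge0_fin_numE.
rewrite /series/= mulr_suml -sumEFin.
by apply: nneseries_lim_ge => k _ _; rewrite lee_fin mulr_ge0// ltW.
Qed.

(** A subsequence with geometrically small increments converges off a null set, and Fatou's lemma
    transfers the Cauchy rate [e] to the distance from the limit. The rate is kept because it
    identifies the limit of the truncated transforms quantitatively. *)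
Lemma sqint_complete (g : nat -> R -> R) (e : nat -> R) :
  (forall n, sqint (g n)) ->
  (forall n m, (n <= m)%N -> sqnorm (fun x => g n x - g m x) <= e n) ->
  e n @[n --> \oo] --> 0 ->
  exists2 l, sqint l & forall n, sqnorm (fun x => g n x - l x) <= e n.
Proof.
move=> sg ge e0.
pose dl k : R := 2^-1 ^+ k.
have dl0 k : 0 < dl k by rewrite exprn_gt0// invr_gt0.
have next k m : exists N, (m < N)%N && (e N <= dl k ^+ 2).
  have /cvgrPdist_le/(_ _ (exprn_gt0 2 (dl0 k)))[N _ HN] := e0.
  exists (maxn m.+1 N); rewrite leq_maxl/=.
  have := HN (maxn m.+1 N) (leq_maxr _ _).
  by rewrite sub0r normrN; apply: le_trans; exact: ler_norm.
pose nx k m := projT1 (cid (next k m)).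
have nxP k m : (m < nx k m)%N && (e (nx k m) <= dl k ^+ 2).
  by rewrite /nx; case: cid.
pose nk := fix nk k := if k is k'.+1 then nx k (nk k') else nx 0%N 0%N.
have nkS k : (nk k < nk k.+1)%N by rewrite /=; case/andP: (nxP k.+1 (nk k)).
have nke k : e (nk k) <= dl k ^+ 2.
  by case: k => [|k]; [case/andP: (nxP 0%N 0%N)|case/andP: (nxP k.+1 (nk k))].
have nk_ge k : (k <= nk k)%N.
  by elim: k => // k IH; exact: leq_ltn_trans IH (nkS k).
pose d k x := g (nk k.+1) x - g (nk k) x.
have sd k : sqint (d k) by exact: sqintB.
(* Square integrable increments need not be integrable. Against this weight they are, by
   Cauchy-Schwarz, and since it is positive it does not affect pointwise convergence. *)
pose w := @expker R 1.
have w0 x : 0 < w x by exact: expR_gt0.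
have iw : intg w by exact: intg_expker.
have sw : sqint w.
  apply: (intg_bounded_sqint iw (M := 1)) => x.
  by rewrite ger0_norm ?expker_ge0// expker_le1.
pose C := Num.sqrt (sqnorm w).
have idw k : intg (fun x => `|d k x| * w x) by apply: sqintM => //; exact: sqint_norm.
have dC k : \int[mu]_x (`|d k x| * w x) <= C * dl k.
  apply: (le_trans (ler_norm _)).
  apply: (le_trans (cauchy_schwarz_sqrt (sqint_norm (sd k)) sw)).
  rewrite mulrC ler_wpM2l ?sqrtr_ge0//.
  rewrite -(ger0_norm (ltW (dl0 k))) -sqrtr_sqr ler_wsqrtr//.
  apply: le_trans (nke k); apply: le_trans (ge _ _ (ltnW (nkS k))).
  rewrite le_eqVlt; apply/orP; left; apply/eqP; apply: eq_Rint => x.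
  by rewrite real_normK ?num_real// /d; ring.
pose H x := (\sum_(0 <= k <oo) (`|d k x| * w x)%:E)%E.
have mdw k : measurable_fun [set: R] (fun x => (`|d k x| * w x)%:E).
  by apply/measurable_EFinP; exact: intg_meas (idw k).
have dw0 k x : (0 <= (`|d k x| * w x)%:E)%E by rewrite lee_fin mulr_ge0// ltW.
have iH : mu.-integrable [set: R] H.
  apply/integrableP; split.
    by apply: (@ge0_emeasurable_sum _ _ _ _ (fun k x => (`|d k x| * w x)%:E) xpredT) => [k x _ _|k _]; [exact: dw0|exact: mdw].
  have -> : (\int[mu]_x `|H x| = \int[mu]_x H x)%E.
    by apply: eq_integral => x _; rewrite gee0_abs// nneseries_ge0.
  rewrite integral_nneseries//.
  apply: (@le_lt_trans _ _ (\sum_(0 <= k <oo) (C * dl k)%:E)%E).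
    apply: lee_nneseries => k _; first by move=> _; exact: integral_ge0.
    by rewrite -EFin_integral// lee_fin.
  have half1 : `|2^-1 : R| < 1 by rewrite ger0_norm ?invr_ge0//; clear; lra.
  have h := cvg_comp_EFin (@cvg_geometric_series R C 2^-1 half1).
  rewrite (_ : (\sum_(0 <= k <oo) (C * dl k)%:E)%E = (C * (1 - 2^-1)^-1)%:E) ?ltry//.
  apply/cvg_lim => //; rewrite [X in X x @[x --> _] --> _](_ : _ = (fun n => (series (geometric C 2^-1) n)%:E)).
    exact: h.
  by apply/funext => n /=; rewrite -sumEFin.
have [N [mN N0 HN]] := integrable_ae measurableT iH.
have good x : ~ N x -> cvgn (fun k => g (nk k) x).
  move=> Nx; have Hx : (H x < +oo)%E.
    have : H x \is a fin_num.
      by apply: contrapT => nf; apply: Nx; apply: HN => /= /(_ I).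
    by rewrite fin_numE => /andP[_ h]; rewrite ltey.
  have := cvg_series_weighted (w0 x) Hx.
  rewrite (_ : series _ = (fun k => g (nk k) x - g (nk 0%N) x)); last first.
    exact: (telescopeK (fun k => g (nk k) x)).
  move=> /cvg_ex[l hl]; apply/cvg_ex; exists (l + g (nk 0%N) x).
  rewrite (_ : (fun k => _) = (fun k => g (nk k) x - g (nk 0%N) x + g (nk 0%N) x)).
    by apply: cvgD => //; exact: cvg_cst.
  by apply/funext => k; rewrite subrK.
have mNC : measurable (~` N) by exact: measurableC.
(* Vanishing on the exceptional set makes the sequence converge everywhere, hence to a Borel
   function. *)
pose h k x := g (nk k) x * \1_(~` N) x.
pose l x := limn (fun k => h k x).
have hl x : h k x @[k --> \oo] --> l x.
  have [Nx|Nx] := pselect (N x).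
    have h0 k : h k x = 0 by rewrite /h indicE memNset ?mulr0//; apply.
    by rewrite /l; under eq_fun do rewrite h0; exact: is_cvg_cst.
  have h1 k : h k x = g (nk k) x by rewrite /h indicE mem_set ?mulr1.
  by rewrite /l; under eq_fun do rewrite h1; exact: good.
have mh k : meas (h k) by apply: measurable_funM; [case: (sg (nk k))|exact: meas_indic].
have ml : meas l.
  by apply: (@measurable_fun_cvg _ _ _ _ h) => // x _; exact: hl.
have sh k : sqint (h k).
  apply: (sqintM_bounded (M := 1) (sg (nk k))); first exact: meas_indic.
  by move=> x; rewrite indicE; case: (_ \in _); rewrite ?normr1 ?normr0.
have main n : intg (fun x => (g n x - l x) ^+ 2) /\
    \int[mu]_x (g n x - l x) ^+ 2 <= e n.
  (* The index [k + n] ensures [n <= nk (k + n)], so that the Cauchy bound [e n] holds for every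
     term. *)
  apply: (@fatou_real _ (fun k x => (g n x - h (k + n)%N x) ^+ 2)).
  - by move=> k; apply: measX2; exact: (measurable_funB (sg n).1 (mh _)).
  - by apply: measX2; exact: (measurable_funB (sg n).1 ml).
  - by move=> k x; exact: sqr_ge0.
  - move=> x; have hn : h (k + n)%N x @[k --> \oo] --> l x.
      by rewrite (cvg_shiftn n (fun k => h k x)); exact: hl.
    have hb : g n x - h (k + n)%N x @[k --> \oo] --> g n x - l x.
      by apply: cvgB => //; exact: cvg_cst.
    exact: (cvg_comp _ _ hb (@exprn_continuous R 2 _)).
  - by move=> k; exact: (sqintB (sg n) (sh _)).2.
  - move=> k; apply: le_trans (ge n (nk (k + n)%N) _); last first.
      exact: leq_trans (leq_addl k n) (nk_ge _).
    rewrite le_eqVlt; apply/orP; left; apply/eqP; apply: ae_Rintegral.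
    exists N; split => // x /= gh; apply: contrapT => Nx; apply: gh.
    by rewrite /h indicE mem_set ?mulr1.
exists l; last by move=> n; exact: (main n).2.
have s0 : sqint (fun x => g 0%N x - l x).
  by split; [exact: (measurable_funB (sg 0%N).1 ml)|exact: (main 0%N).1].
have := sqintB (sg 0%N) s0; congr sqint.
by apply/funext => x; ring.
Qed.

End completeness.

Section truncation.
Context {R : realType}.
Implicit Types (f g : R -> R) (b : bool) (x y N : R).
Local Notation mu := (@lebesgue_measure R).

Definition trunc N f := f \_ (`[- N, N] : set R).

Lemma truncE N f x : trunc N f x = if `|x| <= N then f x else 0.
Proof. by rewrite /trunc patchE mem_setE in_itv/= ler_norml. Qed.

Lemma meas_trunc N f : meas f -> meas (trunc N f).
Proof. by move=> mf; apply/measurable_restrict => //; exact: measurable_funTS. Qed.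

Lemma trunc_le N f x : `|trunc N f x| <= `|f x|.
Proof. by rewrite truncE; case: ifP => // _; rewrite normr0. Qed.

Lemma sqint_trunc N f : sqint f -> sqint (trunc N f).
Proof.
by move=> sf; apply: (sqint_le (meas_trunc N sf.1) _ sf) => x; exact: trunc_le.
Qed.

Lemma intg_cst_itv N : intg (trunc N (cst 1)).
Proof.
apply: intg_bounded_itv; first exact: measurable_cst.
by exists 1 => x; rewrite normr1.
Qed.

Lemma intg_trunc N f : sqint f -> intg (trunc N f).
Proof.
move=> sf.
apply: (intg_le (meas_trunc N sf.1) _ (intgD sf.2 (intg_cst_itv N))) => x.
rewrite !truncE; case: ifP => _; last first.
  by rewrite normr0.
have := sqr_ge0 (`|f x| - 1); have := normr_ge0 (f x).
rewrite /= (@ger0_norm _ (_ + _)) ?addr_ge0 ?sqr_ge0//.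
rewrite -(real_normK (num_real (f x))); clear; nra.
Qed.

Definition tail N f := sqnorm (fun x => f x - trunc N f x).

Lemma sqint_tail N f : sqint f -> sqint (fun x => f x - trunc N f x).
Proof. by move=> sf; apply: sqintB => //; exact: sqint_trunc. Qed.

Lemma cvg_tail f : sqint f -> tail n%:R f @[n --> \oo] --> 0.
Proof.
move=> sf; have mf := sf.1.
have -> : 0 = \int[mu]_x (cst 0 x : R) by rewrite Rintegral_cst// mul0r.
apply: (@dominated_cvg_real _ _ _ (fun x => f x ^+ 2)).
- by move=> n; apply: measX2; exact: (sqint_tail _ sf).1.
- exact: measurable_cst.
- apply: aeW => x; apply: cvg_near_cst; near=> n.
  rewrite truncE ifT ?subrr ?expr0n//.
  near: n; exists (Num.truncn `|x|).+1 => // n /= xn.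
  by apply/ltW/(lt_le_trans (truncnS_gt _)); rewrite ler_nat.
- exact: sf.2.
- move=> n x; rewrite truncE normrX -(real_normK (num_real (f x))).
  case: ifP => _; last by rewrite subr0.
  by rewrite subrr normr0 expr0n/= sqr_ge0.
Unshelve. all: by end_near. Qed.

Lemma sqnorm_trunc_diff N M f : N <= M -> sqint f ->
  sqnorm (fun x => trunc N f x - trunc M f x) <= tail N f.
Proof.
move=> NM sf; apply: le_sqnorm; [|exact: sqint_tail|].
  by apply: sqintB; exact: sqint_trunc.
move=> x; rewrite !truncE; case: ifPn => xN.
  by rewrite (le_trans xN NM) !subrr.
by case: ifP => _; rewrite ?subr0 ?normr0// sub0r normrN.
Qed.

Lemma trigTB b f g y : intg f -> intg g ->
  trigT b (fun x => f x - g x) y = trigT b f y - trigT b g y.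
Proof.
move=> fi gi; rewrite /trigT -(RintB (intg_trig b y fi) (intg_trig b y gi)).
by apply: eq_Rint => x; rewrite mulrBl.
Qed.

Lemma sqnorm_trigT_trunc b N M f : N <= M -> sqint f ->
  sqnorm (fun y => trigT b (trunc N f) y - trigT b (trunc M f) y) <=
  2 * pi * tail N f.
Proof.
move=> NM sf; have iN := intg_trunc N sf; have iM := intg_trunc M sf.
have [_] := bessel b (intgB iN iM) (sqintB (sqint_trunc N sf) (sqint_trunc M sf)).
have -> : trigT b (fun x => trunc N f x - trunc M f x) =
    (fun y => trigT b (trunc N f) y - trigT b (trunc M f) y).
  by apply/funext => y; exact: trigTB.
move=> /le_trans; apply; apply: ler_wpM2l; last exact: sqnorm_trunc_diff.
by rewrite mulr_ge0// pi_ge0.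
Qed.

(* [c] is the L2 limit of the transforms of the truncations of [f]. *)
Definition is_trigT b f c := sqint c /\
  forall n : nat, sqnorm (fun y => trigT b (trunc n%:R f) y - c y) <=
    2 * pi * tail n%:R f.

Lemma sqint_trigT_trunc b N f : sqint f -> sqint (trigT b (trunc N f)).
Proof.
by move=> sf; exact: (bessel b (intg_trunc N sf) (sqint_trunc N sf)).1.
Qed.

Lemma exists_trigT b f : sqint f -> exists c, is_trigT b f c.
Proof.
move=> sf.
have e0 : 2 * pi * tail n%:R f @[n --> \oo] --> 0.
  rewrite -[X in _ --> X](mulr0 (2 * pi)).
  by apply: cvgM; [exact: cvg_cst|exact: cvg_tail].
have cauchy n m : (n <= m)%N ->
    sqnorm (fun y => trigT b (trunc n%:R f) y - trigT b (trunc m%:R f) y) <=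
    2 * pi * tail n%:R f.
  by move=> nm; apply: sqnorm_trigT_trunc => //; rewrite ler_nat.
have [c sc cP] := sqint_complete (fun n => sqint_trigT_trunc b n%:R sf) cauchy e0.
by exists c.
Qed.

(** Passes from integer cut-offs to real ones: for [N >= n] both differences, to the transform at
    cut-off [n] and from there to [c], are bounded by the same tail. *)
Lemma cvg_is_trigT b f c : is_trigT b f c -> sqint f ->
  sqnorm (fun y => trigT b (trunc N f) y - c y) @[N --> +oo] --> 0.
Proof.
move=> [sc cP] sf.
have bound (n : nat) N : n%:R <= N ->
    sqnorm (fun y => trigT b (trunc N f) y - c y) <= 4 * (2 * pi * tail n%:R f).
  move=> nN.
  have s1 := sqintB (sqint_trigT_trunc b N sf) (sqint_trigT_trunc b n%:R sf).
  have s2 := sqintB (sqint_trigT_trunc b n%:R sf) sc.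
  have -> : (fun y => trigT b (trunc N f) y - c y) =
      (fun x => trigT b (trunc N f) x - trigT b (trunc n%:R f) x +
      (trigT b (trunc n%:R f) x - c x)).
    by apply/funext => x; ring.
  apply: (le_trans (sqnormD_le s1 s2)).
  have -> : sqnorm (fun x => trigT b (trunc N f) x - trigT b (trunc n%:R f) x) =
      sqnorm (fun x => trigT b (trunc n%:R f) x - trigT b (trunc N f) x).
    by apply: eq_Rint => x; ring.
  have -> : 4 * (2 * pi * tail n%:R f) =
      2 * (2 * pi * tail n%:R f) + 2 * (2 * pi * tail n%:R f) by clear; ring.
  by apply: lerD; apply: ler_wpM2l => //; exact: sqnorm_trigT_trunc.
have e0 : 4 * (2 * pi * tail n%:R f) @[n --> \oo] --> 0.
  rewrite (_ : 0 = 4 * (2 * pi * 0)); last by rewrite !mulr0.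
  by apply: cvgM; [exact: cvg_cst|apply: cvgM; [exact: cvg_cst|exact: cvg_tail]].
apply/cvgrPdist_le => e e_gt0.
have /cvgrPdist_le/(_ _ e_gt0)[n _ Hn] := e0.
near=> N; rewrite sub0r normrN ger0_norm ?sqnorm_ge0//.
apply: (@le_trans _ _ (4 * (2 * pi * tail n%:R f))).
  by apply: bound; near: N; apply: nbhs_pinfty_ge; exact: num_real.
by have := Hn n (leqnn n); rewrite sub0r normrN; apply: le_trans; exact: ler_norm.
Unshelve. all: by end_near. Qed.

End truncation.

Section fourier_transform.
Context {R : realType}.
Implicit Types (f g c s : R -> R) (b : bool) (x y N : R).
Local Notation mu := (@lebesgue_measure R).

Lemma truncated_cosE f N : truncated_cos_transform f N = trigT false (trunc N f).
Proof.
apply/funext => y; rewrite /truncated_cos_transform Rintegral_mkcond.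
by apply: eq_Rint => x; rewrite truncE patchE mem_setE in_itv/= -ler_norml;
  case: ifP => //; rewrite mul0r.
Qed.

Lemma truncated_sinE f N : truncated_sin_transform f N = trigT true (trunc N f).
Proof.
apply/funext => y; rewrite /truncated_sin_transform Rintegral_mkcond.
by apply: eq_Rint => x; rewrite truncE patchE mem_setE in_itv/= -ler_norml;
  case: ifP => //; rewrite mul0r.
Qed.

Lemma sqint_square_integrable f : sqint f -> square_integrable f.
Proof.
by move=> sf; apply/square_integrableP; exists f => //; apply: aeW.
Qed.

Lemma ae_equal_refl f : ae_equal f f.
Proof. exact: aeW. Qed.

Lemma ae_equal_sym f g : ae_equal f g -> ae_equal g f.
Proof.
move=> [N [mN N0 fgN]]; exists N; split => // x /= gf; apply: fgN => /= fg.
by apply: gf; rewrite fg.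
Qed.

Lemma ae_equal2 (f f' g g' : R -> R) (op : R -> R -> R) :
  ae_equal f f' -> ae_equal g g' ->
  ae_equal (fun x => op (f x) (g x)) (fun x => op (f' x) (g' x)).
Proof.
move=> [N [mN N0 fN]] [M [mM M0 gM]]; exists (N `|` M); split.
- exact: measurableU.
- apply/eqP; rewrite eq_le measure_ge0 andbT.
  have NM0 : (mu N + mu M <= 0)%E by rewrite N0 M0 adde0.
  exact: le_trans (measureU2 mu mN mM) NM0.
move=> x /= fgx; apply: contrapT => /not_orP[Nx Mx]; apply: fgx.
have -> : f x = f' x by apply: contrapT => h1; apply: Nx; exact: fN.
by have -> : g x = g' x by apply: contrapT => h1; apply: Mx; exact: gM.
Qed.

Lemma ae_truncated f g : ae_equal f g ->
  truncated_cos_transform f = truncated_cos_transform g /\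
  truncated_sin_transform f = truncated_sin_transform g.
Proof.
move=> fg; split; apply/funext => N; apply/funext => y; apply: ae_Rintegral.
  exact: (ae_equal2 *%R fg (ae_equal_refl _)).
exact: (ae_equal2 *%R fg (ae_equal_refl _)).
Qed.

Lemma cvg_L2norm0 (F : R -> R -> R) : (forall N, sqint (F N)) ->
  L2norm (F N) @[N --> +oo] --> 0%E <-> sqnorm (F N) @[N --> +oo] --> 0.
Proof.
move=> sF; under eq_cvg do rewrite L2norm_sqint//.
split=> [/fine_cvg|] h.
  have := cvgM h h; rewrite mulr0 => h'.
  rewrite (_ : (fun N => sqnorm (F N)) = (fun N => Num.sqrt (sqnorm (F N))) \* (fun N => Num.sqrt (sqnorm (F N)))).
    exact: h'.
  by apply/funext => N /=; rewrite -expr2 sqr_sqrtr// sqnorm_ge0.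
apply: cvg_comp_EFin; rewrite -[X in _ --> X](sqrtr0 R).
exact: (cvg_comp _ _ h (@sqrt_continuous R 0)).
Qed.

(** Existence guarantees that the choice in [fourier] returns a genuine transform and not its zero
    default. Truncated transforms ignore null sets, so a Borel representative of [f] may be used. *)
Lemma is_fourier_exists f : square_integrable f -> exists cs, is_fourier f cs.
Proof.
move=> /square_integrableP[g sg fg].
have [c cP] := exists_trigT false sg; have [s sP] := exists_trigT true sg.
exists (c, s); rewrite /is_fourier (ae_truncated fg).1 (ae_truncated fg).2.
split; [exact: (sqint_square_integrable cP.1)|
        exact: (sqint_square_integrable sP.1)| |].
  under eq_cvg do rewrite truncated_cosE.
  apply/cvg_L2norm0; last exact: cvg_is_trigT.
  by move=> N; exact: (sqintB (sqint_trigT_trunc _ _ sg) cP.1).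
under eq_cvg do rewrite truncated_sinE.
apply/cvg_L2norm0; last exact: cvg_is_trigT.
by move=> N; exact: (sqintB (sqint_trigT_trunc _ _ sg) sP.1).
Qed.

(* A pair of Borel functions [c], [s] such that [c - i s] is the Fourier
   transform of the Borel function [f] *)
Definition ft f c s := [/\ sqint f, sqint c, sqint s,
  sqnorm (fun y => trigT false (trunc N f) y - c y) @[N --> +oo] --> 0 &
  sqnorm (fun y => trigT true (trunc N f) y - s y) @[N --> +oo] --> 0].

(** The components of [fourier f] are only almost everywhere equal to Borel functions. Replacing
    them by representatives gives access to everything stated for [sqint]. *)
Lemma fourier_rep f g : sqint g -> ae_equal f g ->
  exists c s, [/\ ft g c s, ae_equal (fourier f).1 c & ae_equal (fourier f).2 s].
Proof.
move=> sg fg.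
have : is_fourier f (fourier f).
  rewrite /fourier; apply: xgetPex; apply: is_fourier_exists.
  by apply/square_integrableP; exists g.
move: (fourier f) => [c' s'] [/= /square_integrableP[c sc cc]].
move=> /square_integrableP[s ss ss'].
rewrite (ae_truncated fg).1 (ae_truncated fg).2 => hc hs.
exists c, s; split => //; split => //.
  apply/cvg_L2norm0.
    by move=> N; exact: (sqintB (sqint_trigT_trunc _ _ sg) sc).
  under eq_cvg => N.
    rewrite -truncated_cosE (_ : L2norm _ = L2norm (fun y => truncated_cos_transform g N y - c' y)); first over.
    exact/esym/ae_L2norm/(ae_equal2 (fun x y => x - y) (ae_equal_refl _) cc).
  exact: hc.
apply/cvg_L2norm0.
  by move=> N; exact: (sqintB (sqint_trigT_trunc _ _ sg) ss).
under eq_cvg => N.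
  rewrite -truncated_sinE (_ : L2norm _ = L2norm (fun y => truncated_sin_transform g N y - s' y)); first over.
  exact/esym/ae_L2norm/(ae_equal2 (fun x y => x - y) (ae_equal_refl _) ss').
exact: hs.
Qed.

End fourier_transform.

(** * Poisson summation, duality and inversion *)

Section poisson_summation.
Context {R : realType}.
Implicit Types (f g k c s : R -> R) (b : bool) (x y z d N M : R).
Local Notation mu := (@lebesgue_measure R).

Lemma cvg_sqnorm_integral (T : Type) (F : set_system T) {FF : Filter F}
    (g_ : T -> R -> R) g h : (forall n, sqint (g_ n)) -> sqint g -> sqint h ->
  sqnorm (fun x => g_ n x - g x) @[n --> F] --> 0 ->
  \int[mu]_x (g_ n x * h x) @[n --> F] --> \int[mu]_x (g x * h x).
Proof.
move=> sg_ sg sh cg.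
have key n : `|\int[mu]_x (g x * h x) - \int[mu]_x (g_ n x * h x)| <=
    Num.sqrt (sqnorm (fun x => g_ n x - g x)) * Num.sqrt (sqnorm h).
  rewrite distrC -(RintB (sqintM (sg_ n) sh) (sqintM sg sh)).
  apply: le_trans (cauchy_schwarz_sqrt (sqintB (sg_ n) sg) sh).
  by under eq_Rintegral do rewrite -mulrBl.
have c0 : Num.sqrt (sqnorm (fun x => g_ n x - g x)) * Num.sqrt (sqnorm h) @[n --> F] --> 0.
  rewrite -[X in _ --> X](mul0r (Num.sqrt (sqnorm h))); apply: cvgM; last exact: cvg_cst.
  rewrite -[X in _ --> X](sqrtr0 R).
  exact: (cvg_comp _ _ cg (@sqrt_continuous R 0)).
apply/cvgrPdist_le => e e0; move/cvgrPdist_le : c0 => /(_ _ e0).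
apply: filterS => n; rewrite sub0r normrN => h1; apply: le_trans (key n) _.
exact: le_trans (ler_norm _) h1.
Qed.

Lemma sqint_expker d : 0 < d -> sqint (expker d).
Proof.
move=> d0; apply: (intg_bounded_sqint (intg_expker d0) (M := 1)) => x.
by rewrite ger0_norm ?expker_ge0// expker_le1// ltW.
Qed.

Lemma sqint_expker_trig b d x : 0 < d -> sqint (fun y => expker d y * trig b (x * y)).
Proof.
move=> d0; apply: (sqintM_bounded (M := 1) (sqint_expker d0)).
  exact: meas_trigM.
by move=> y; exact: trig_bounded.
Qed.

Lemma poisker_bounded d x : 0 < d -> `|poisker d x| <= 2 / d.
Proof. by move=> d0; rewrite ger0_norm ?poisker_ge0// poisker_le. Qed.

Lemma sqint_poisker d : 0 < d -> sqint (poisker d).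
Proof.
move=> d0; apply: (intg_bounded_sqint (intg_poisker d0)) => x.
exact: poisker_bounded.
Qed.

Lemma intg_poisker_reflect d x : 0 < d -> intg (fun z => poisker d (x - z)).
Proof. by move=> d0; exact: (intg_reflect x (intg_poisker d0)). Qed.

Lemma sqint_reflker r d x : `|r| <= 1 -> 0 < d -> sqint (fun z => reflker r d (x, z)).
Proof.
move=> r1 d0; apply: (@sqint_le _ (fun z => reflker 1 d (x, z))).
- by apply: (@measurable_fun_pair2 _ _ _ _ _ _ (reflker r d)); exact: measurable_reflker.
- move=> z; apply: (le_trans (reflker_bounded _ r1 d0)); exact: ler_norm.
- apply: (intg_bounded_sqint (intg_reflker x d0).1 (M := 2 / d)) => z.
  rewrite ger0_norm ?reflker_le//.
  by apply: le_trans (normr_ge0 _) (reflker_bounded (x, z) r1 d0).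
Qed.

(** Fourier inversion with damping. For truncations of [f] it is [trigT_expker], and both sides are
    continuous in L2. In the sum of the cosine and sine parts the reflected halves of [reflker]
    cancel. *)
Lemma poisson_identity f c s x d : 0 < d -> ft f c s ->
  \int[mu]_y (c y * (expker d y * cos (x * y))) +
  \int[mu]_y (s y * (expker d y * sin (x * y))) =
  \int[mu]_z (f z * poisker d (x - z)).
Proof.
move=> d0 [sf sc ss hc hs].
have lim b g : sqint g ->
    sqnorm (fun y => trigT b (trunc N f) y - g y) @[N --> +oo] --> 0 ->
    \int[mu]_y (g y * (expker d y * trig b (x * y))) =
    \int[mu]_z (f z * reflker ((-1) ^+ b) d (x, z)).
  move=> sg /cvg_pinftyP/(_ (fun n => n%:R) (@cvgr_idn R)) hg.
  have h1 := cvg_sqnorm_integral (fun n => sqint_trigT_trunc b n%:R sf) sg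
    (sqint_expker_trig b x d0) hg.
  have sr : sqint (fun z => reflker ((-1) ^+ b) d (x, z)).
    by apply: sqint_reflker => //; rewrite normrX normrN1 expr1n.
  have ht : sqnorm (fun z => trunc n%:R f z - f z) @[n --> \oo] --> 0.
    have := cvg_tail sf; apply: cvg_trans; apply: near_eq_cvg; apply: nearW => n.
    by apply: eq_Rint => z; ring.
  have h2 := cvg_sqnorm_integral (fun n => sqint_trunc n%:R sf) sf sr ht.
  apply: (cvg_eqr (h1 _) (h2 _)) => n; apply: trigT_expker => //; exact: intg_trunc.
rewrite (lim false _ sc hc) (lim true _ ss hs) -RintD.
- by apply: eq_Rint => z; rewrite /reflker/= expr0 expr1; field.
- by apply: sqintM => //; apply: sqint_reflker => //; rewrite expr0 normr1.
- by apply: sqintM => //; apply: sqint_reflker => //; rewrite expr1 normrN1.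
Qed.

Lemma measurable_poisker2 d : 0 < d ->
  measurable_fun [set: R * R] (fun z : R * R => poisker d (z.1 - z.2)).
Proof.
by move=> d0; apply: (measurableT_comp (meas_poisker d0)); exact: measurable_funB.
Qed.

Lemma poisson_swap f k d : 0 < d -> sqint f -> sqint k ->
  intg (fun x => k x * \int[mu]_z (f z * poisker d (x - z))) /\
  \int[mu]_z (f z * \int[mu]_x (k x * poisker d (x - z))) =
  \int[mu]_x (k x * \int[mu]_z (f z * poisker d (x - z))).
Proof.
move=> d0 sf sk.
have E x z : poisker d (x - z) = poisker d (z - x) by rewrite -poiskerN opprB.
have mp := measurable_poisker2 d0.
have i1 x := intg_poisker_reflect x d0.
have i2 y : intg (fun x => poisker d (x - y)).
  by apply: eq_intg (i1 y) => x; exact: E.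
have M1 x : \int[mu]_z poisker d (x - z) <= 2 * pi.
  by rewrite (integral_reflect x (intg_poisker d0)) integral_poisker.
have M2 y : \int[mu]_x poisker d (x - y) <= 2 * pi.
  by rewrite (eq_Rint (fun x => E x y)).
have ck (z : R * R) : `|poisker d (z.1 - z.2)| <= poisker d (z.1 - z.2).
  by rewrite ger0_norm// poisker_ge0.
have kB (z : R * R) : poisker d (z.1 - z.2) <= 2 / d by exact: poisker_le.
have [I1 _ I12 _] := schur_test sk sf mp mp ck kB i1 i2 M1 M2.
by split; [exact: I1|exact/esym/I12].
Qed.

(** Moved to the frequency side, the pairing becomes one of [c] and [s] with the transforms of [k],
    which [bessel] controls. The outcome bounds [f] by its transform, the direction opposite to
    [bessel], in dual form. *)
Lemma fourier_pairing f c s k d : 0 < d -> ft f c s -> intg k -> sqint k ->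
  `|\int[mu]_z (f z * \int[mu]_x (k x * poisker d (x - z)))| <=
  Num.sqrt (2 * pi * sqnorm k) * (Num.sqrt (sqnorm c) + Num.sqrt (sqnorm s)).
Proof.
move=> d0 fcs ik sk; have [sf sc ss _ _] := fcs.
have [I1 ->] := poisson_swap d0 sf sk.
have part b g : sqint g ->
    intg (fun x => k x * \int[mu]_y (g y * (expker d y * trig b (x * y)))) /\
    `|\int[mu]_x (k x * \int[mu]_y (g y * (expker d y * trig b (x * y))))| <=
    Num.sqrt (2 * pi * sqnorm k) * Num.sqrt (sqnorm g).
  move=> sg; have ige := sqintM sg (sqint_expker d0).
  have tr1 (z : R * R) : `|trig b (z.1 * z.2)| <= 1 by exact: trig_bounded.
  have [J1 _ J12] := fubini_bounded_kernel ik ige (measurable_trig2 b) tr1.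
  have E x : k x * \int[mu]_y (g y * (expker d y * trig b (x * y))) =
      k x * \int[mu]_y (g y * expker d y * trig b (x * y)).
    by congr (_ * _); apply: eq_Rint => y; rewrite mulrA.
  split; first by apply: eq_intg J1 => x; exact: E.
  rewrite (eq_Rint E) J12 /=.
  have [st bt] := bessel b ik sk.
  have sge : sqint (fun y => g y * expker d y).
    apply: (sqintM_bounded (M := 1) sg (meas_expker d)) => y.
    exact: expker_bounded.
  apply: (le_trans (cauchy_schwarz_sqrt sge st)).
  rewrite mulrC; apply: ler_pM; [exact: sqrtr_ge0|exact: sqrtr_ge0| |].
    exact: (ler_wsqrtr bt).
  apply/ler_wsqrtr/(le_sqnorm sge sg) => y; rewrite normrM.
  apply: ler_piMr => //; exact: expker_bounded.
have [ic bc] := part false c sc; have [is_ bs] := part true s ss.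
have -> : \int[mu]_x (k x * \int[mu]_z (f z * poisker d (x - z))) =
    \int[mu]_x (k x * \int[mu]_y (c y * (expker d y * cos (x * y)))) +
    \int[mu]_x (k x * \int[mu]_y (s y * (expker d y * sin (x * y)))).
  rewrite -(RintD ic is_); apply: eq_Rint => x.
  by rewrite -mulrDr (poisson_identity x d0 fcs).
by apply: (le_trans (ler_normD _ _)); rewrite mulrDr; apply: lerD.
Qed.

End poisson_summation.

Section continuous_ae.
Context {R : realType}.
Implicit Types (f g : R -> R) (x y : R).
Local Notation mu := (@lebesgue_measure R).

Lemma integral0_continuous f N : 0 < N -> continuous f -> (forall x, 0 <= f x) ->
  intg (trunc N f) -> \int[mu]_x trunc N f x = 0 -> forall x, `|x| < N -> f x = 0.
Proof.
move=> N0 cf f0 ifN int0 x xN; apply/eqP; apply: contrapT => /negP fx.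
have {}fx : 0 < f x by rewrite lt_neqAle eq_sym fx f0.
have /nbhs_ballP[r /= r0 hr] : \forall y \near x, f x / 2 < f y.
  by apply: (cvgr_gt _ (cf x)); rewrite ltr_pdivrMr// mulr_natr mulr2n ltrDl.
pose r' := Num.min r (N - `|x|).
have r'0 : 0 < r' by rewrite lt_min r0/= subr_gt0.
have iI : intg (\1_(`]x - r', x + r'[ : set R)) by exact: integrable_indic_itv.
have : \int[mu]_y (f x / 2 * \1_(`]x - r', x + r'[ : set R) y) <= \int[mu]_y trunc N f y.
  apply: (le_integral_intg (intgZ _ iI) ifN) => y.
  rewrite indicE truncE; case: (boolP (y \in _)) => [|_]; last first.
    by rewrite mulr0; case: ifP.
  rewrite inE/= in_itv/= mulr1 => /andP[y1 y2].
  have rr : r' <= r by rewrite ge_min lexx.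
  have rN : r' <= N - `|x| by rewrite ge_min lexx orbT.
  have yx : `|y - x| < r' by rewrite ltr_distl y1 y2.
  rewrite ifT; last first.
    have := ler_normD (y - x) x; rewrite subrK => /le_trans; apply.
    by apply: ltW; lra.
  by apply/ltW/hr; rewrite /ball/= distrC; exact: lt_le_trans yx rr.
rewrite int0 (RintZ _ iI) leNgt; apply/negP/negPn; apply: mulr_gt0.
  by rewrite divr_gt0.
rewrite /Rintegral integral_indic//= setIT lebesgue_measure_itv/= lte_fin ifT/=; lra.
Qed.

End continuous_ae.

Section poisson_limit.
Context {R : realType}.
Implicit Types (f g k c s : R -> R) (b : bool) (x y z d N M : R).
Local Notation mu := (@lebesgue_measure R).

Lemma poisker_far (d r x : R) : 0 < d -> 0 < r -> r <= `|x| ->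
  poisker d x <= d * (1 + r ^- 2) * poisker 1 x.
Proof.
move=> d0 r0 rx.
have x2 : r ^+ 2 <= x ^+ 2.
  by rewrite -(real_normK (num_real x)) lerXn2r// nnegrE// ltW.
have r2 : 0 < r ^+ 2 by rewrite exprn_gt0.
have rx1 : 1 <= r ^- 2 * x ^+ 2 by rewrite mulrC ler_pdivlMr// mul1r.
have ri : 0 < r ^- 2 by rewrite invr_gt0.
rewrite /poisker expr1n mulr1 ler_pdivrMr; last exact: poisker_den.
have B0 : 0 < 1 + x ^+ 2 by rewrite ltr_wpDr// sqr_ge0.
rewrite [leRHS](_ : _ = 2 * d * ((1 + r ^- 2) * (d ^+ 2 + x ^+ 2)) / (1 + x ^+ 2)).
  rewrite ler_pdivlMr//; apply: ler_wpM2l; first by rewrite mulr_ge0// ltW.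
  have : 0 <= r ^- 2 * d ^+ 2 by rewrite mulr_ge0 ?ltW// exprn_gt0.
  have : 0 <= d ^+ 2 by rewrite sqr_ge0.
  by rewrite mulrDl mul1r mulrDr; move: rx1; clear; lra.
by field; rewrite !gt_eqF.
Qed.

Lemma cvg_poisson k M x : intg k -> (forall y, `|k y| <= M) ->
  {for x, continuous k} ->
  \int[mu]_y (k y * poisker n.+1%:R^-1 (y - x)) @[n --> \oo] --> 2 * pi * k x.
Proof.
move=> ik kM ckx; have M0 : 0 <= M by exact: le_trans (kM 0).
have d0 n : 0 < n.+1%:R^-1 :> R by rewrite invr_gt0.
have ip (d : R) : 0 < d -> intg (fun y => poisker d (y - x)) /\
    \int[mu]_y poisker d (y - x) = 2 * pi.
  move=> d1; split; first exact: (intg_shift (- x) (intg_poisker d1)).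
  by rewrite (integral_shift (- x) (intg_poisker d1)) integral_poisker.
have mk := intg_meas ik.
apply/cvgrPdist_le => e e0.
(* The near part then contributes at most [2 * pi * eta = e / 2]. *)
pose eta := e / (4 * pi).
have pi0 := @pi_gt0 R.
have eta0 : 0 < eta by rewrite divr_gt0// mulr_gt0.
have /cvgrPdist_lt/(_ _ eta0)/nbhs_ballP[r /= r0 hr] := ckx.
pose C := 2 * M * (1 + r ^- 2) * (2 * pi).
have key n : `|2 * pi * k x - \int[mu]_y (k y * poisker n.+1%:R^-1 (y - x))| <=
    2 * pi * eta + n.+1%:R^-1 * C.
  set d := n.+1%:R^-1; have [ipd Epd] := ip d (d0 n); have [ip1 Ep1] := ip 1 ltr01.
  have ikp : intg (fun y => k y * poisker d (y - x)).
    apply: (intgM_bounded ik (intg_meas ipd)) => y; exact: (poisker_bounded _ (d0 n)).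
  have -> : 2 * pi * k x = \int[mu]_y (k x * poisker d (y - x)).
    by rewrite (RintZ _ ipd) Epd mulrC.
  rewrite -(RintB (intgZ _ ipd) ikp).
  pose B y := eta * poisker d (y - x) + (2 * M * (d * (1 + r ^- 2))) * poisker 1 (y - x).
  have iB : intg B by exact: (intgD (intgZ _ ipd) (intgZ _ ip1)).
  have -> : 2 * pi * eta + d * C = \int[mu]_y B y.
    rewrite (RintD (intgZ _ ipd) (intgZ _ ip1)) (RintZ _ ipd) (RintZ _ ip1) Epd Ep1.
    by rewrite /C; clear; ring.
  apply: (ler_normr_integral (intgB (intgZ _ ipd) ikp) iB) => y.
  rewrite -mulrBl normrM (ger0_norm (poisker_ge0 _ (d0 n))) /B.
  have p0 := poisker_ge0 (y - x) (d0 n); have p1 := poisker_ge0 (y - x) (@ltr01 R).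
  have r2 : 0 < 1 + r ^- 2 by rewrite ltr_wpDr// invr_ge0 ltW// exprn_gt0.
  have [yr|yr] := ltP `|y - x| r.
    have h : `|k x - k y| <= eta by apply/ltW/hr; rewrite /ball/= distrC.
    apply: (le_trans (ler_wpM2r p0 h)); rewrite lerDl.
    apply: mulr_ge0 => //; apply: mulr_ge0; first by apply: mulr_ge0.
    by apply: mulr_ge0; [exact: (ltW (d0 n))|exact: ltW].
  have h : `|k x - k y| <= 2 * M.
    by apply: (le_trans (ler_normB _ _)); rewrite mulr_natl mulr2n; apply: lerD.
  apply: (le_trans (ler_wpM2r p0 h)).
  rewrite -[leLHS]add0r; apply: lerD; first by rewrite mulr_ge0// ltW.
  rewrite -[leRHS]mulrA; apply: ler_wpM2l; first by apply: mulr_ge0.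
  apply: (le_trans (poisker_far (d0 n) r0 yr)).
  by rewrite mulrA.
have c0 : n.+1%:R^-1 * C @[n --> \oo] --> 0.
  rewrite -[X in _ --> X](mul0r C).
  by apply: cvgM; [exact: cvg_harmonic|exact: cvg_cst].
have e2 : 0 < e / 2 by rewrite divr_gt0.
move/cvgrPdist_le : c0 => /(_ _ e2); apply: filterS => n h.
apply: (le_trans (key n)).
rewrite [leRHS](_ : _ = 2 * pi * eta + e / 2); last first.
  move: pi0; rewrite /eta; clear; move: (@pi R) => p p0; field.
  by rewrite gt_eqF.
rewrite lerD2l; apply: (le_trans (ler_norm _)).
by rewrite -normrN -sub0r.
Qed.

End poisson_limit.

Section poisson_pairing.
Context {R : realType}.
Implicit Types (f g k c s : R -> R) (b : bool) (x y z d N M : R).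
Local Notation mu := (@lebesgue_measure R).

Lemma inv_sqr_poisker x : 1 <= `|x| -> 8 / x ^+ 2 <= 8 * poisker 1 x.
Proof.
move=> x1; have x2 : 1 <= x ^+ 2.
  by rewrite -(real_normK (num_real x)) expr_ge1.
rewrite /poisker expr1n mulr1 ler_pM2l// -[X in X <= _]mul1r.
rewrite ler_pdivrMr; last exact: lt_le_trans x2.
rewrite mulrAC ler_pdivlMr; last by rewrite ltr_wpDr// sqr_ge0.
by move: x2; clear; lra.
Qed.

(** Supplies a majorant independent of [d] and square integrable. For [|x| <= 2 N + 1],
    [poisker 1 x] is bounded below and the total mass [2 * pi] suffices; beyond,
    [|y - x| >= |x| / 2] on the support of [k], so that [poisker d (y - x) <= 8 / x^2]. *)
Lemma poisson_dominated k M N : intg k -> (forall y, `|k y| <= M) -> 0 <= N ->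
  (forall y, N < `|y| -> k y = 0) ->
  exists C, forall d x, 0 < d -> d <= 1 ->
    `|\int[mu]_y (k y * poisker d (y - x))| <= C * poisker 1 x.
Proof.
move=> ik kM N0 k0; have M0 : 0 <= M by exact: le_trans (kM 0).
have mk := intg_meas ik; have pi0 := @pi_ge0 R.
pose C1 := M * pi * (1 + (2 * N + 1) ^+ 2).
pose A := \int[mu]_y `|k y|.
have A0 : 0 <= A by exact: integral_ge0_real.
have C10 : 0 <= C1.
  by apply: mulr_ge0; [exact: mulr_ge0|rewrite addr_ge0// sqr_ge0].
exists (C1 + 8 * A) => d x d0 d1.
have p0 := poisker_ge0 x (@ltr01 R).
have ipd : intg (fun y => poisker d (y - x)) by exact: (intg_shift (- x) (intg_poisker d0)).
have ikp : intg (fun y => k y * poisker d (y - x)).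
  by apply: (intgM_bounded ik (intg_meas ipd)) => y; exact: (poisker_bounded _ d0).
rewrite mulrDl; have [xN|xN] := leP `|x| (2 * N + 1).
  apply: (@le_trans _ _ (C1 * poisker 1 x)); last first.
    by rewrite lerDl; apply: mulr_ge0 => //; apply: mulr_ge0.
  apply: (@le_trans _ _ (\int[mu]_y (M * poisker d (y - x)))).
    apply: (ler_normr_integral ikp (intgZ _ ipd)) => y.
    have py := poisker_ge0 (y - x) d0.
    by rewrite normrM (ger0_norm py); exact: ler_wpM2r.
  rewrite (RintZ _ ipd) (integral_shift (- x) (intg_poisker d0)) integral_poisker//.
  rewrite /C1 /poisker expr1n mulr1.
  rewrite [leRHS](_ : _ = M * (2 * pi) * ((1 + (2 * N + 1) ^+ 2) / (1 + x ^+ 2))); last first.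
    by move: (1 + (2 * N + 1) ^+ 2) ((1 + x ^+ 2)^-1) (pi) => ? ? ?; clear; ring.
  apply: ler_peMr; first by apply: mulr_ge0 => //; apply: mulr_ge0.
  rewrite ler_pdivlMr; last by rewrite ltr_wpDr// sqr_ge0.
  rewrite mul1r lerD2l -(real_normK (num_real x)) lerXn2r// nnegrE//.
  by rewrite addr_ge0// mulr_ge0.
apply: (@le_trans _ _ (8 * A * poisker 1 x)); last by rewrite lerDr mulr_ge0.
have -> : 8 * A * poisker 1 x = \int[mu]_y (8 * poisker 1 x * `|k y|).
  by rewrite (RintZ _ (intg_norm ik)) /A; ring.
apply: (ler_normr_integral ikp (intgZ _ (intg_norm ik))) => y.
have [yN|yN] := ltP N `|y|; first by rewrite k0// mul0r normr0 mulr0.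
have py := poisker_ge0 (y - x) d0.
rewrite normrM (ger0_norm py) mulrC; apply: ler_wpM2r => //.
have yx : `|x| / 2 <= `|y - x|.
  have := ler_normB y x; have := lerB_dist x y; rewrite distrC.
  by move: xN yN; clear; lra.
have x1 : 1 <= `|x| by move: xN N0; clear; lra.
apply: le_trans (inv_sqr_poisker x1).
have x2 : 0 < x ^+ 2 by rewrite -(real_normK (num_real x)) exprn_gt0//; move: x1; clear; lra.
rewrite /poisker ler_pdivrMr; last exact: poisker_den.
rewrite mulrAC ler_pdivlMr//.
have : x ^+ 2 / 4 <= (y - x) ^+ 2.
  rewrite -(real_normK (num_real x)) -(real_normK (num_real (y - x))).
  have -> : `|x| ^+ 2 / 4 = (`|x| / 2) ^+ 2 by field.
  by rewrite lerXn2r// nnegrE// divr_ge0.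
have : 0 <= d ^+ 2 by rewrite sqr_ge0.
have : d * x ^+ 2 <= x ^+ 2 by rewrite ler_piMl// ltW.
by clear; lra.
Qed.

Lemma trunc_bounded g N : continuous g -> exists M, forall y, `|trunc N g y| <= M.
Proof.
move=> cg; have [N0|N0] := leP 0 N; last first.
  exists 0 => y; rewrite truncE ifF ?normr0//; apply/negbTE.
  by rewrite -ltNge (lt_le_trans N0).
have cn : {within `[- N, N], continuous (fun y => `|g y|)}.
  apply: continuous_subspaceT => y.
  by apply: continuous_comp; [exact: cg|exact: norm_continuous].
have NN : - N <= N by move: N0; clear; lra.
have [c _ hc] := EVT_max NN cn.
exists `|g c| => y; rewrite truncE; case: ifPn => [yN|_]; last by rewrite normr0.
by apply: hc; rewrite in_itv/= -ler_norml.
Qed.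

Lemma trunc_continuous g N x : continuous g -> `|x| != N ->
  {for x, continuous (trunc N g)}.
Proof.
have nx : `|y| @[y --> x] --> `|x| by exact: norm_continuous.
move=> cg xN; rewrite /prop_for /continuous_at truncE.
case: ifPn => [xN1|]; last rewrite -ltNge => xN1.
  have {}xN1 : `|x| < N by rewrite lt_neqAle xN.
  have nN : \forall y \near x, `|y| < N by apply: (cvgr_lt _ nx).
  apply: cvg_trans (cg x); apply: near_eq_cvg; near=> y.
  by rewrite truncE ltW//; near: y.
have nN : \forall y \near x, N < `|y| by apply: (cvgr_gt _ nx).
have hc : (cst 0 : R -> R) y @[y --> x] --> (0 : R) by exact: cvg_cst.
apply: cvg_trans hc; apply: near_eq_cvg; near=> y; rewrite truncE leNgt.
by have -> : N < `|y| by near: y.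
Unshelve. all: by end_near. Qed.

Lemma meas_continuous f : continuous f -> meas f.
Proof. exact: continuous_measurable_fun. Qed.

Lemma intg_trunc_continuous g N : continuous g -> intg (trunc N g).
Proof.
move=> cg; have [M gM] := trunc_bounded N cg.
apply: (@intg_le _ (trunc N (cst M))).
- by apply: meas_trunc; exact: meas_continuous.
- move=> x; move: (gM x); rewrite !truncE; case: ifP => //= _ /le_trans; apply.
  exact: ler_norm.
- have := intgZ M (intg_cst_itv N); congr intg; apply/funext => x.
  by rewrite !truncE; case: ifP => //= _; rewrite ?mulr1 ?mulr0.
Qed.

Lemma sqint_trunc_continuous g N : continuous g -> sqint (trunc N g).
Proof.
move=> cg; have [M gM] := trunc_bounded N cg.
exact: (intg_bounded_sqint (intg_trunc_continuous N cg) gM).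
Qed.

(** The truncation of a continuous function at [N] can jump only at these two points. *)
Lemma ae_norm_neq N : {ae mu, forall x : R, `|x| != N}.
Proof.
exists [set N; - N]; split.
- by apply: measurableU; exact: measurable_set1.
- by apply: countable_lebesgue_measure0; apply: finite_set_countable; exact: finite_set2.
move=> x /= /negP; rewrite negbK => /eqP xN.
by have [x0|x0] := leP 0 x;
  [left; rewrite -xN ger0_norm|right; rewrite -xN ltr0_norm// opprK].
Qed.

Lemma cvg_poisson_pairing f g N : sqint f -> continuous g -> 0 <= N ->
  \int[mu]_z (f z * \int[mu]_y (trunc N g y * poisker n.+1%:R^-1 (y - z)))
    @[n --> \oo] --> \int[mu]_z (f z * (2 * pi * trunc N g z)).
Proof.
move=> sf cg N0; have ik := intg_trunc_continuous N cg.
have [M kM] := trunc_bounded N cg.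
have k0 y : N < `|y| -> trunc N g y = 0 by rewrite truncE ltNge => /negbTE ->.
have [C hC] := poisson_dominated ik kM N0 k0.
have d0 n : 0 < n.+1%:R^-1 :> R by rewrite invr_gt0.
have d1 n : n.+1%:R^-1 <= 1 :> R by rewrite invf_le1// ler1n.
apply: (@dominated_cvg_real _ _ _ (fun z => `|f z| * (C * poisker 1 z))).
- move=> n; apply: measurable_funM; first exact: sf.1.
  have mF : measurable_fun [set: R * R]
      (fun z : R * R => trunc N g z.2 * poisker n.+1%:R^-1 (z.2 - z.1)).
    apply: measurable_funM; first exact: (measurableT_comp (intg_meas ik)).
    by apply: (measurableT_comp (meas_poisker (d0 n))); exact: measurable_funB.
  exact: (meas_integral2 mF).
- apply: measurable_funM; first exact: sf.1.
  by apply: measurable_funM => //; exact: intg_meas ik.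
- have [Z [mZ Z0 hZ]] := ae_norm_neq N; exists Z; split => // x /= nx.
  apply: hZ => /= xN; apply: nx; apply: cvgM; first exact: cvg_cst.
  by apply: (cvg_poisson ik kM); exact: trunc_continuous.
- by apply: (sqintM (sqint_norm sf)); apply: sqintZ; exact: sqint_poisker.
- by move=> n z; rewrite normrM; apply: ler_wpM2l => //; exact: hC.
Qed.

(** This is [fourier_pairing] in the limit of vanishing damping. Its right-hand side involves the
    norms of [c] and [s] only, so choosing [g] related to [f] gives a bound of [f] by its
    transform. *)
Lemma fourier_duality_bound f c s g N : ft f c s -> continuous g -> 0 <= N ->
  2 * pi * `|\int[mu]_z (f z * trunc N g z)| <=
  Num.sqrt (2 * pi * sqnorm (trunc N g)) *
  (Num.sqrt (sqnorm c) + Num.sqrt (sqnorm s)).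
Proof.
move=> fcs cg N0; have [sf _ _ _ _] := fcs.
have sk := sqint_trunc_continuous N cg.
have h := cvg_poisson_pairing sf cg N0.
have E : \int[mu]_z (f z * (2 * pi * trunc N g z)) =
    2 * pi * \int[mu]_z (f z * trunc N g z).
  by rewrite -(RintZ _ (sqintM sf sk)); apply: eq_Rint => z; rewrite mulrCA.
rewrite E in h.
have pi0 : 0 <= 2 * pi :> R by rewrite mulr_ge0// pi_ge0.
rewrite -[X in X * `|_|]ger0_norm// -normrM.
apply: (cvg_ler (cvg_norm h)); apply: nearW => n.
apply: (fourier_pairing _ fcs (intg_trunc_continuous N cg) sk).
by rewrite invr_gt0.
Qed.

End poisson_pairing.

Section inversion.
Context {R : realType}.
Implicit Types (f g k c s v : R -> R) (b : bool) (x y z d N M : R).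
Local Notation mu := (@lebesgue_measure R).

Lemma continuous_trigT b f : intg f -> continuous (trigT b f).
Proof.
move=> fi y.
apply: (@continuity_under_integral _ _ _ mu (fun l x => f x * trig b (x * l))
  setT measurableT (y - 1) (y + 1) _ _ (fun x => `|f x|)).
- by move=> l _; exact: intg_trig.
- apply: aeW => x _ l _; apply: cvgM; first exact: cvg_cst.
  apply: continuous_comp; last exact: continuous_trig.
  by apply: cvgM; [exact: cvg_cst|exact: cvg_id].
- exact: intg_norm.
- by move=> l _; apply: aeW => x _; rewrite normrM ler_piMr// trig_bounded.
- by rewrite inE/= in_itv/=; lra.
Qed.

Definition synthesis c s x := trigT false c x + trigT true s x.

Lemma continuous_synthesis c s : intg c -> intg s -> continuous (synthesis c s).
Proof.
by move=> ic is_ x; apply: cvgD; exact: continuous_trigT.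
Qed.

Lemma cvg_damped_trigT b f x : intg f ->
  \int[mu]_y (f y * (expker n.+1%:R^-1 y * trig b (x * y))) @[n --> \oo] -->
  trigT b f x.
Proof.
move=> fi; have d0 n : 0 < n.+1%:R^-1 :> R by rewrite invr_gt0.
apply: (@dominated_cvg_real _ _ _ (fun y => `|f y|)).
- move=> n; apply: measurable_funM; first exact: intg_meas.
  by apply: measurable_funM; [exact: meas_expker|exact: meas_trigM].
- exact: intg_meas (intg_trig b x fi).
- apply: aeW => y; apply: cvgM; first exact: cvg_cst.
  rewrite -[X in _ --> X]mul1r (mulrC x); apply: cvgM; last exact: cvg_cst.
  exact: cvg_expker.
- exact: intg_norm.
- move=> n y; rewrite normrM; apply: ler_piMr => //; rewrite normrM.
  by apply: mulr_ile1 => //; [exact: expker_bounded|exact: trig_bounded].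
Qed.

(** By [poisson_identity], [v] and the synthesis have the same pairing with any truncated continuous
    function. Taking their difference [g] itself, truncated at some [N > |x|], shows that [g^2] has
    integral 0 over [[- N, N]], and continuity gives [g x = 0]. *)
Lemma fourier_inversion v c s : ft v c s -> intg c -> intg s -> continuous v ->
  forall x, 2 * pi * v x = synthesis c s x.
Proof.
move=> vcs ic is_ cv x; have [sv sc ss _ _] := vcs.
pose W x := (2 * pi)^-1 * synthesis c s x.
have pi0 := @pi_gt0 R.
have cW : continuous W.
  by move=> y; apply: cvgM; [exact: cvg_cst|exact: continuous_synthesis].
pose g y := v y - W y.
have cg : continuous g by move=> y; apply: cvgB; [exact: cv|exact: cW].
suff g0 : g x = 0.
  have -> : v x = W x by apply/eqP; rewrite -subr_eq0; apply/eqP.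
  by rewrite /W mulVKf// gt_eqF// mulr_gt0.
pose N := `|x| + 1; have N0 : 0 < N by rewrite /N ltr_wpDl.
pose k := trunc N g.
have ik : intg k by exact: intg_trunc_continuous.
have sk : sqint k by exact: sqint_trunc_continuous.
have d0 n : 0 < n.+1%:R^-1 :> R by rewrite invr_gt0.
have h1 := cvg_poisson_pairing sv cg (ltW N0).
pose K n x := \int[mu]_y (c y * (expker n.+1%:R^-1 y * cos (x * y))) +
              \int[mu]_y (s y * (expker n.+1%:R^-1 y * sin (x * y))).
have E n : \int[mu]_z (v z * \int[mu]_y (k y * poisker n.+1%:R^-1 (y - z))) =
    \int[mu]_x (k x * K n x).
  rewrite (poisson_swap (d0 n) sv sk).2; apply: eq_Rint => y.
  by rewrite -(poisson_identity y (d0 n) vcs).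
have h2 : \int[mu]_x (k x * K n x) @[n --> \oo] --> \int[mu]_x (k x * synthesis c s x).
  pose B := \int[mu]_y `|c y| + \int[mu]_y `|s y|.
  apply: (@dominated_cvg_real _ _ _ (fun y => B * `|k y|)).
  - move=> n; have := intg_meas (poisson_swap (d0 n) sv sk).1.
    congr meas; apply/funext => y.
    by rewrite -(poisson_identity y (d0 n) vcs).
  - apply: measurable_funM; first exact: intg_meas.
    by apply: meas_continuous; exact: continuous_synthesis.
  - apply: aeW => y; apply: cvgM; first exact: cvg_cst.
    exact: (cvgD (@cvg_damped_trigT false c y ic) (@cvg_damped_trigT true s y is_)).
  - exact: (intgZ _ (intg_norm ik)).
  - move=> n y; rewrite normrM mulrC; apply: ler_wpM2r => //.
    apply: (le_trans (ler_normD _ _)); apply: lerD.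
      apply: ler_normr_integral; [|exact: intg_norm|].
        exact: (sqintM sc (sqint_expker_trig false y (d0 n))).
      move=> z; rewrite normrM; apply: ler_piMr => //; rewrite normrM.
      by apply: mulr_ile1 => //; [exact: expker_bounded|exact: (trig_bounded false)].
    apply: ler_normr_integral; [|exact: intg_norm|].
      exact: (sqintM ss (sqint_expker_trig true y (d0 n))).
    move=> z; rewrite normrM; apply: ler_piMr => //; rewrite normrM.
    by apply: mulr_ile1 => //; [exact: expker_bounded|exact: (trig_bounded true)].
have E2 := cvg_eqr h1 h2 E.
have [M kM] := trunc_bounded N cW.
have isyn : intg (fun x => k x * synthesis c s x).
  have [M' kM'] := trunc_bounded N (continuous_synthesis ic is_).
  have := intgM_bounded ik (meas_trunc N (meas_continuous (continuous_synthesis ic is_))) kM'.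
  congr intg; apply/funext => y; rewrite /k !truncE.
  by case: ifP => //; rewrite !mul0r.
have iv : intg (fun z => v z * (2 * pi * k z)) by exact: (sqintM sv (sqintZ _ sk)).
have int0 : \int[mu]_y trunc N (fun y => g y ^+ 2) y = 0.
  have h0 : \int[mu]_z (v z * (2 * pi * k z) - k z * synthesis c s z) = 0.
    by rewrite (RintB iv isyn) E2 subrr.
  have i0 := intgB iv isyn.
  rewrite -[RHS](mulr0 (2 * pi)^-1) -[in RHS]h0 -(RintZ _ i0).
  apply: eq_Rint => y; rewrite truncE /k truncE; case: ifP => _; last first.
    by rewrite !(mulr0, mul0r) subr0 mulr0.
  rewrite /g /W; move: (v y) (synthesis c s y) pi0; clear; move: (@pi R) => p w S p0.
  by field; rewrite gt_eqF.
have cg2 : continuous (fun y => g y ^+ 2).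
  by move=> y; exact: (cvg_comp _ _ (cg y) (@exprn_continuous R 2 _)).
have xN : `|x| < N by rewrite /N ltrDl.
have := integral0_continuous N0 cg2 (fun y => sqr_ge0 (g y))
  (intg_trunc_continuous N cg2) int0 xN.
by move/eqP; rewrite sqrf_eq0 => /eqP.
Qed.

End inversion.

(** * Truncated half-Laplacian *)

Section truncated_half_laplacian.
Context {R : realType}.
Implicit Types (f g p q : R -> R) (e x y z : R).
Local Notation mu := (@lebesgue_measure R).

Definition sker e z : R := if e < `|z| then z ^- 2 else 0.

Lemma sker_ge0 e z : 0 <= sker e z.
Proof. by rewrite /sker; case: ifP => // _; rewrite invr_ge0 sqr_ge0. Qed.

Lemma skerN e z : sker e (- z) = sker e z.
Proof. by rewrite /sker normrN sqrrN. Qed.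

Lemma meas_inv_sqr : meas (fun z : R => z ^- 2).
Proof.
have -> : (fun z : R => z ^- 2) = (fun z => (z ^+ 2) `^ (-1)).
  by apply/funext => z; rewrite powR_inv1// sqr_ge0.
by apply: (measurableT_comp (measurable_powR (-1))); exact: measurable_funX.
Qed.

Lemma meas_sker e : meas (sker e).
Proof.
apply: measurable_fun_ifT.
- apply: measurable_fun_ltr; first exact: measurable_cst.
  exact: normr_measurable.
- by apply: measurable_funTS; exact: meas_inv_sqr.
- exact: measurable_cst.
Qed.

Lemma sker_le e z : 0 < e -> sker e z <= e ^- 2.
Proof.
move=> e0; rewrite /sker; case: ifPn => [ez|_]; last by rewrite invr_ge0 sqr_ge0.
rewrite -(real_normK (num_real z)) lef_pV2 ?posrE ?exprn_gt0//; last exact: lt_trans ez.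
by rewrite lerXn2r// ?nnegrE ltW.
Qed.

Lemma sker_le_poisker e z : 0 < e -> sker e z <= (1 + e ^- 2) * poisker 1 z.
Proof.
move=> e0; have e20 : 0 <= e ^- 2 by rewrite invr_ge0 sqr_ge0.
rewrite /sker; case: ifPn => [ez|_]; last first.
  by rewrite mulr_ge0 ?poisker_ge0// addr_ge0.
have z0 : 0 < `|z| by exact: lt_trans ez.
have z20 : 0 < z ^+ 2 by rewrite -(real_normK (num_real z)) exprn_gt0.
have ez2 : 1 <= e ^- 2 * z ^+ 2.
  rewrite mulrC ler_pdivlMr ?exprn_gt0// mul1r -(real_normK (num_real z)).
  by rewrite lerXn2r// ?nnegrE ltW.
rewrite /poisker expr1n mulr1 -[leLHS]mul1r ler_pdivrMr//.
rewrite [leRHS](_ : _ = 2 * ((1 + e ^- 2) * z ^+ 2) / (1 + z ^+ 2)); last first.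
  by move: (1 + e ^- 2) ((1 + z ^+ 2)^-1) (z ^+ 2); clear => ? ? ?; ring.
rewrite ler_pdivlMr; last by rewrite ltr_wpDr// sqr_ge0.
by move: ez2 z20; rewrite mulrDl; clear; lra.
Qed.

Lemma intg_sker e : 0 < e -> intg (sker e).
Proof.
move=> e0; apply: (intg_le (meas_sker e) _ (intgZ (1 + e ^- 2) (intg_poisker ltr01))) => z.
rewrite ger0_norm ?sker_ge0// (le_trans (sker_le_poisker z e0))// ler_norm//.
Qed.

Lemma sker_bounded e z : 0 < e -> `|sker e z| <= e ^- 2.
Proof. by move=> e0; rewrite ger0_norm ?sker_ge0 ?sker_le. Qed.

Lemma intg_sker_reflect e x : 0 < e -> intg (fun y => sker e (x - y)).
Proof. by move=> e0; exact: (intg_reflect x (intg_sker e0)). Qed.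

Lemma sqint_sker_reflect e x : 0 < e -> sqint (fun y => sker e (x - y)).
Proof.
move=> e0; apply: (intg_bounded_sqint (intg_sker_reflect x e0)) => y.
exact: sker_bounded.
Qed.

Definition smass e := \int[mu]_z sker e z.

(** The expression whose limit defines [half_laplacian], with the domain of integration absorbed
    into the kernel. *)
Definition trunc_lap e g x := pi^-1 * \int[mu]_y ((g x - g y) * sker e (x - y)).

Definition sconv e g x := \int[mu]_y (g y * sker e (x - y)).

Lemma sconv_symm e : 0 < e -> forall p q, sqint p -> sqint q ->
  [/\ intg (fun x => p x * sconv e q x),
      \int[mu]_x (p x * sconv e q x) = \int[mu]_x (q x * sconv e p x) &
      `|\int[mu]_x (p x * sconv e q x)| <= smass e / 2 * (sqnorm p + sqnorm q)].
Proof.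
move=> e0 p q sp sq.
have E x y : sker e (x - y) = sker e (y - x) by rewrite -skerN opprB.
have mk : measurable_fun [set: R * R] (fun z : R * R => sker e (z.1 - z.2)).
  by apply: (measurableT_comp (meas_sker e)); exact: measurable_funB.
have ck (z : R * R) : `|sker e (z.1 - z.2)| <= sker e (z.1 - z.2).
  by rewrite ger0_norm// sker_ge0.
have kB (z : R * R) : sker e (z.1 - z.2) <= e ^- 2 by exact: sker_le.
have i1 x := intg_sker_reflect x e0.
have i2 y : intg (fun x => sker e (x - y)).
  by apply: eq_intg (i1 y) => x; exact: E.
have M1 x : \int[mu]_y sker e (x - y) <= smass e.
  by rewrite (integral_reflect x (intg_sker e0)).
have M2 y : \int[mu]_x sker e (x - y) <= smass e.
  by rewrite (eq_Rint (fun x => E x y)).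
have [I1 _ I12 b] := schur_test sp sq mk mk ck kB i1 i2 M1 M2.
split; [exact: I1| |exact: b].
transitivity (\int[mu]_y (q y * \int[mu]_x (p x * sker e (x - y)))); first exact: I12.
apply: eq_Rint => y; congr (_ * _); apply: eq_Rint => x.
by rewrite (E x y).
Qed.

Lemma trunc_lapE e q x : 0 < e -> sqint q ->
  trunc_lap e q x = pi^-1 * (smass e * q x - sconv e q x).
Proof.
move=> e0 sq; congr (_ * _).
have i1 := intg_sker_reflect x e0.
have i2 := sqintM sq (sqint_sker_reflect x e0).
rewrite /smass -(integral_reflect x (intg_sker e0)) mulrC -(RintZ _ i1).
rewrite -(RintB (intgZ _ i1) i2); apply: eq_Rint => y.
by rewrite mulrBl.
Qed.

Lemma trunc_lap_pairing e p q : 0 < e -> sqint p -> sqint q ->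
  intg (fun x => p x * trunc_lap e q x) /\
  \int[mu]_x (p x * trunc_lap e q x) =
    pi^-1 * (smass e * \int[mu]_x (p x * q x) - \int[mu]_x (p x * sconv e q x)).
Proof.
move=> e0 sp sq; have [i1 _ _] := sconv_symm e0 sp sq.
have i2 := intgZ (smass e) (sqintM sp sq).
have E x : p x * trunc_lap e q x =
    pi^-1 * (smass e * (p x * q x) - p x * sconv e q x).
  by rewrite trunc_lapE//; ring.
split; first by apply: eq_intg (intgZ pi^-1 (intgB i2 i1)) => x; exact: E.
by rewrite (eq_Rint E) (RintZ _ (intgB i2 i1)) (RintB i2 i1) (RintZ _ (sqintM sp sq)).
Qed.

Lemma trunc_lap_symm e p q : 0 < e -> sqint p -> sqint q ->
  \int[mu]_x (p x * trunc_lap e q x) = \int[mu]_x (q x * trunc_lap e p x).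
Proof.
move=> e0 sp sq; have [_ S _] := sconv_symm e0 sp sq.
rewrite (trunc_lap_pairing e0 sp sq).2 (trunc_lap_pairing e0 sq sp).2 S.
by congr (_ * (_ * _ - _)); apply: eq_Rint => x; rewrite mulrC.
Qed.

Definition posp q x := Num.max (q x) 0.
Definition negp q x := Num.max (- q x) 0.

Lemma posp_ge0 q x : 0 <= posp q x.
Proof. by rewrite /posp le_max lexx orbT. Qed.

Lemma negp_ge0 q x : 0 <= negp q x.
Proof. by rewrite /negp le_max lexx orbT. Qed.

Lemma posp_le q x : `|posp q x| <= `|q x|.
Proof.
by rewrite ger0_norm ?posp_ge0// /posp ge_max ler_norm normr_ge0.
Qed.

Lemma negp_le q x : `|negp q x| <= `|q x|.
Proof.
by rewrite ger0_norm ?negp_ge0// /negp ge_max normr_ge0 andbT -normrN ler_norm.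
Qed.

Lemma posp_negp q x : q x = posp q x - negp q x.
Proof.
rewrite /posp /negp; have [q0|q0] := leP 0 (q x).
  by rewrite (max_idPr _) ?subr0// oppr_le0.
by rewrite (max_idPl _) ?sub0r ?opprK// oppr_ge0 ltW.
Qed.

Lemma posp_mul q x : posp q x * q x = posp q x ^+ 2.
Proof.
rewrite /posp; have [q0|q0] := leP 0 (q x); first by rewrite expr2.
by rewrite mul0r expr0n.
Qed.

Lemma sqint_posp q : sqint q -> sqint (posp q).
Proof.
move=> sq; apply: (sqint_le _ (posp_le q) sq).
by apply: measurable_maxr; [exact: sq.1|exact: measurable_cst].
Qed.

Lemma sqint_negp q : sqint q -> sqint (negp q).
Proof.
move=> sq; apply: (sqint_le _ (negp_le q) sq).
apply: measurable_maxr; last exact: measurable_cst.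
exact: (sqintN sq).1.
Qed.

(* The quadratic form is nonnegative at [posp q]; only the cross term is kept. *)
Lemma trunc_lap_posp e q : 0 < e -> sqint q ->
  pi^-1 * \int[mu]_x (posp q x * sconv e (negp q) x) <=
  \int[mu]_x (posp q x * trunc_lap e q x).
Proof.
move=> e0 sq; have sp := sqint_posp sq; have sn := sqint_negp sq.
rewrite (trunc_lap_pairing e0 sp sq).2.
have [i1 _ b1] := sconv_symm e0 sp sp; have [i2 _ _] := sconv_symm e0 sp sn.
have -> : \int[mu]_x (posp q x * q x) = sqnorm (posp q).
  by apply: eq_Rint => x; exact: posp_mul.
have -> : \int[mu]_x (posp q x * sconv e q x) =
    \int[mu]_x (posp q x * sconv e (posp q) x) -
    \int[mu]_x (posp q x * sconv e (negp q) x).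
  rewrite -(RintB i1 i2); apply: eq_Rint => x; rewrite -mulrBr; congr (_ * _).
  have j r : sqint r -> intg (fun y => r y * sker e (x - y)).
    by move=> sr; exact: (sqintM sr (sqint_sker_reflect x e0)).
  rewrite /sconv -(RintB (j _ sp) (j _ sn)); apply: eq_Rint => y.
  by rewrite -mulrBl -posp_negp.
apply: ler_wpM2l; first by rewrite invr_ge0 pi_ge0.
have := le_trans (ler_norm _) b1.
move: (\int[mu]_x _) (\int[mu]_x _) (sqnorm _) (smass e) => A B C D; clear.
by rewrite (_ : D / 2 * (C + C) = D * C); [lra|field].
Qed.

End truncated_half_laplacian.

Section half_laplacian_symbol.
Context {R : realType}.
Implicit Types (f g p q c s v : R -> R) (b : bool) (e x y z w : R).
Local Notation mu := (@lebesgue_measure R).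

Lemma lipschitz_derive f (df : R -> R) (M : R) :
  (forall x, is_derive x 1 f (df x)) -> (forall x, `|df x| <= M) ->
  forall x y, `|f x - f y| <= M * `|x - y|.
Proof.
move=> fdf dfM.
have cf x : {for x, continuous f}.
  by apply/differentiable_continuous/derivable1_diffP; have [] := fdf x.
suff lt x y : x < y -> `|f y - f x| <= M * `|y - x|.
  move=> x y; case: (ltgtP x y) => [xy|xy|->]; last by rewrite !subrr !normr0 mulr0.
    by rewrite distrC (distrC x); exact: lt.
  exact: lt.
move=> xy; have [|c _ ->] := @MVT _ f df x y xy (fun z _ => fdf z).
  exact: continuous_subspaceT.
by rewrite normrM; apply: ler_wpM2r.
Qed.

Lemma one_sub_cos_ge0 x : 0 <= 1 - cos x.
Proof. by rewrite subr_ge0 cos_le1. Qed.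

Lemma one_sub_cos_le x : 1 - cos x <= x ^+ 2 / 2.
Proof.
have sinle y : `|sin y| <= `|y|.
  have := @lipschitz_derive (@sin R) cos 1 (fun z => is_derive_sin z) (@cos_max R) y 0.
  by rewrite sin0 !subr0 mul1r.
have -> : 1 - cos x = 2 * sin (x / 2) ^+ 2.
  rewrite [in LHS](_ : x = x / 2 + x / 2); last by field.
  by rewrite cosD -!expr2 cos2sin2; ring.
have := sinle (x / 2) => h.
have : sin (x / 2) ^+ 2 <= (x / 2) ^+ 2.
  by rewrite -(real_normK (num_real (sin _))) -[leRHS](real_normK (num_real _)) lerXn2r// nnegrE.
have -> : (x / 2) ^+ 2 = x ^+ 2 / 4 by field.
by clear; lra.
Qed.

Lemma one_sub_cos_bounded x : `|1 - cos x| <= 2.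
Proof.
by rewrite ger0_norm ?one_sub_cos_ge0//; have := cos_geN1 x; clear; lra.
Qed.

(** Multiplier of [pi * trunc_lap e] on the Fourier side. Its limit [symb0 w] is [pi * |w|]; the two
    are compared through [symb0B]. *)
Definition symb e w := \int[mu]_z (sker e z * (1 - cos (z * w))).

Definition symb0 w := \int[mu]_z (z ^- 2 * (1 - cos (z * w))).

Lemma meas_one_sub_cos w : meas (fun z => 1 - cos (z * w)).
Proof.
apply: measurable_funB; first exact: measurable_cst.
by under [X in measurable_fun _ X]eq_fun do rewrite mulrC; exact: (meas_trigM false w).
Qed.

Lemma intg_symb e w : 0 < e -> intg (fun z => sker e z * (1 - cos (z * w))).
Proof.
move=> e0; apply: (intgM_bounded (intg_sker e0) (meas_one_sub_cos w)) => z.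
exact: one_sub_cos_bounded.
Qed.

Lemma measurable_one_sub_cos2 :
  measurable_fun [set: R * R] (fun z : R * R => 1 - cos (z.2 * z.1)).
Proof.
apply: measurable_funB; first exact: measurable_cst.
under [X in measurable_fun _ X]eq_fun do rewrite mulrC.
exact: (measurable_trig2 false).
Qed.

Lemma meas_symb e : meas (symb e).
Proof.
have mF : measurable_fun [set: R * R]
    (fun z : R * R => sker e z.2 * (1 - cos (z.2 * z.1))).
  apply: measurable_funM; first exact: (measurableT_comp (meas_sker e)).
  exact: measurable_one_sub_cos2.
exact: (meas_integral2 mF).
Qed.

Lemma meas_symb0 : meas symb0.
Proof.
have mF : measurable_fun [set: R * R]
    (fun z : R * R => z.2 ^- 2 * (1 - cos (z.2 * z.1))).
  apply: measurable_funM; first exact: (measurableT_comp meas_inv_sqr).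
  exact: measurable_one_sub_cos2.
exact: (meas_integral2 mF).
Qed.

Definition near_part e w z := (z ^- 2 - sker e z) * (1 - cos (z * w)).

Lemma near_part_bound e w z : 0 < e ->
  0 <= near_part e w z <= w ^+ 2 / 2 * trunc e (cst 1) z.
Proof.
move=> e0; rewrite /near_part /sker truncE (leNgt `|z| e); case: (ltP e `|z|) => ez /=.
  by rewrite subrr mul0r mulr0 lexx.
rewrite subr0 mulr1 mulr_ge0 ?invr_ge0 ?sqr_ge0 ?one_sub_cos_ge0//=.
have [->|z0] := eqVneq z 0.
  by rewrite expr0n/= invr0 mul0r divr_ge0// sqr_ge0.
have z20 : 0 < z ^+ 2 by rewrite exprn_even_gt0.
rewrite mulrC ler_pdivrMr//; apply: le_trans (one_sub_cos_le _) _.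
by rewrite exprMn le_eqVlt; apply/orP; left; apply/eqP; ring.
Qed.

Lemma intg_near_part e w : 0 < e -> intg (near_part e w).
Proof.
move=> e0.
apply: (@intg_le _ (fun z => w ^+ 2 / 2 * trunc e (cst 1) z)).
- apply: measurable_funM; last exact: meas_one_sub_cos.
  by apply: measurable_funB; [exact: meas_inv_sqr|exact: meas_sker].
- move=> z; have /andP[n0 nle] := near_part_bound w z e0.
  by rewrite ger0_norm//; apply: (le_trans nle); exact: ler_norm.
- exact: (intgZ _ (intg_cst_itv e)).
Qed.

Lemma integral_cst_itv e : 0 < e -> \int[mu]_z trunc e (cst 1) z = 2 * e.
Proof.
move=> e0; have -> : trunc e (cst 1) = \1_(`[- e, e] : set R).
  by apply/funext => z; rewrite /trunc patchE indicE; case: ifP.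
rewrite /Rintegral integral_indic//= setIT lebesgue_measure_itv/= lte_fin ifT/=; last by move: e0; clear; lra.
by ring.
Qed.

(** Only [|z| <= e] contributes, where [1 - cos (z w) <= (z w)^2 / 2]; integrating [w^2 / 2] over a
    length [2 * e] gives the bound. The factor [w^2] is the reason for the weight in [decay]. *)
Lemma symb0B e w : 0 < e -> 0 <= symb0 w - symb e w <= e * w ^+ 2.
Proof.
move=> e0; have i1 := intg_symb w e0; have i2 := intg_near_part w e0.
have -> : symb0 w - symb e w = \int[mu]_z near_part e w z.
  have -> : symb0 w = \int[mu]_z (near_part e w z + sker e z * (1 - cos (z * w))).
    by apply: eq_Rint => z; rewrite /near_part; ring.
  by rewrite (RintD i2 i1) addrK.
apply/andP; split.
  by apply: integral_ge0_real => z; case/andP: (near_part_bound w z e0).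
apply: (@le_trans _ _ (\int[mu]_z (w ^+ 2 / 2 * trunc e (cst 1) z))).
  apply: (le_integral_intg i2 (intgZ _ (intg_cst_itv e))) => z.
  by case/andP: (near_part_bound w z e0).
rewrite (RintZ _ (intg_cst_itv e)) integral_cst_itv//.
by rewrite le_eqVlt; apply/orP; left; apply/eqP; field.
Qed.

Lemma symb_bounded e w : 0 < e -> `|symb e w| <= 2 * smass e.
Proof.
move=> e0; rewrite /smass -(RintZ _ (intg_sker e0)).
apply: (ler_normr_integral (intg_symb w e0) (intgZ _ (intg_sker e0))) => z.
rewrite normrM ger0_norm ?sker_ge0// mulrC.
by apply: ler_wpM2r; [exact: sker_ge0|exact: one_sub_cos_bounded].
Qed.

(** After Fubini, the frequency [w] contributes [trig b (w x) - trig b (w (x - z))] integrated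
    against an even kernel. Averaging over [z] and [- z] replaces the second term by
    [trig b (w x) * cos (z w)]. *)
Lemma trunc_lap_trigT b c e x : 0 < e -> intg c ->
  \int[mu]_y ((trigT b c x - trigT b c y) * sker e (x - y)) =
  trigT b (fun w => c w * symb e w) x.
Proof.
move=> e0 ic; have ik := intg_sker e0.
pose A := trigT b c.
have iA : intg (fun z => sker e z * (A x - A (x - z))).
  apply: (@intgM_bounded _ (2 * \int[mu]_w `|c w|) _ _ ik).
    apply: measurable_funB; first exact: measurable_cst.
    have mA : meas A by apply: meas_trigT; exact: intg_meas.
    by apply: (measurableT_comp mA); exact: measurable_funB.
  move=> z; apply: (le_trans (ler_normB _ _)); rewrite mulr_natl mulr2n.
  by apply: lerD; exact: trigT_bounded.
transitivity (\int[mu]_z (sker e z * (A x - A (x - z)))).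
  rewrite -(integral_reflect x iA); apply: eq_Rint => y.
  by rewrite mulrC; congr (_ * (_ - A _)); ring.
pose k (z : R * R) := trig b (z.2 * x) - trig b (z.2 * (x - z.1)).
have mt : meas (trig b : R -> R) by exact: (meas_continuous (@continuous_trig _ b)).
have mk : measurable_fun [set: R * R] k.
  have m1 : measurable_fun [set: R * R] (fun z : R * R => z.2 * x).
    exact: measurable_funM.
  have m2 : measurable_fun [set: R * R] (fun z : R * R => z.2 * (x - z.1)).
    by apply: measurable_funM => //; exact: measurable_funB.
  exact: (measurable_funB (measurableT_comp mt m1) (measurableT_comp mt m2)).
have k2 (z : R * R) : `|k z| <= 2.
  apply: (le_trans (ler_normB _ _)); rewrite (_ : 2 = 1 + 1); last by clear; ring.
  by apply: lerD; exact: trig_bounded.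
have [_ _ F] := fubini_bounded_kernel ik ic mk k2.
transitivity (\int[mu]_z (sker e z * \int[mu]_w (c w * k (z, w)))).
  apply: eq_Rint => z; congr (_ * _).
  rewrite -(RintB (intg_trig b x ic) (intg_trig b (x - z) ic)).
  by apply: eq_Rint => w; rewrite /k/= [RHS]mulrBr.
rewrite F; apply: eq_Rint => w; rewrite -mulrA; congr (_ * _).
(* The values [r = -1] and [r = 1] are exchanged by [z |-> - z]; the addition formula evaluates
   their sum. *)
pose T r z := sker e z * trig b (w * x + r * (w * z)).
have iT r : intg (T r).
  apply: (@intgM_bounded _ 1 _ _ ik); last by move=> z; exact: trig_bounded.
  have m : measurable_fun [set: R] (fun z => w * x + r * (w * z)).
    by apply: measurable_funD => //; do 2 apply: measurable_funM => //.
  exact: (measurableT_comp mt m).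
have ic1 := intgZ (trig b (w * x)) ik.
have -> : \int[mu]_z (sker e z * k (z, w)) =
    \int[mu]_z (trig b (w * x) * sker e z) - \int[mu]_z T (-1) z.
  rewrite -(RintB ic1 (iT (-1))); apply: eq_Rint => z; rewrite /k /T/=.
  have -> : w * (x - z) = w * x + -1 * (w * z) by ring.
  by ring.
have TT : \int[mu]_z T (-1) z = \int[mu]_z T 1 z.
  rewrite -(integral_reflect 0 (iT 1)); apply: eq_Rint => z.
  by rewrite /T sub0r skerN; congr (_ * trig b _); ring.
have TTE : \int[mu]_z T (-1) z = trig b (w * x) * \int[mu]_z (sker e z * cos (z * w)).
  have icos := intg_trig false w ik.
  have : \int[mu]_z T (-1) z + \int[mu]_z T 1 z =
      2 * (trig b (w * x) * \int[mu]_z (sker e z * cos (z * w))).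
    rewrite -(RintD (iT (-1)) (iT 1)) -(RintZ _ icos) -(RintZ _ (intgZ _ icos)).
    apply: eq_Rint => z; rewrite /T mulN1r mul1r (mulrC w z).
    by case: b {A mt k mk k2 F iA T iT ic1 TT icos} => /=; rewrite ?(sinD, cosD, cosN, sinN); ring.
  by rewrite -TT -mulr2n -[X in X = _]mulr_natl => /mulfI; apply; rewrite pnatr_eq0.
rewrite TTE (RintZ _ ik) -mulrBr mulrC; congr (_ * _).
rewrite -(RintB ik (intg_trig false w ik)); apply: eq_Rint => z.
by rewrite /= mulrBr mulr1.
Qed.

End half_laplacian_symbol.

Section half_laplacian_synthesis.
Context {R : realType}.
Implicit Types (f g p q c s v : R -> R) (b : bool) (e x y z w : R).
Local Notation mu := (@lebesgue_measure R).

Definition decay c := [/\ sqint c, intg c, sqint (fun w => w ^+ 2 * c w) &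
  intg (fun w => w ^+ 2 * c w)].

(** One factor [1 + w^2] covers the weight in [decay]; the other is spent in Cauchy-Schwarz against
    [poisker 1] to pass from L2 to L1. Their product is the weight of the Sobolev space of order
    4. *)
Lemma decay_weight c : meas c -> sqint (fun w => (1 + w ^+ 2) ^+ 2 * c w) -> decay c.
Proof.
move=> mc sh; have mw : meas (fun w : R => w ^+ 2 * c w).
  by apply: measurable_funM => //; exact: measurable_funX.
have w1 w : 1 <= 1 + w ^+ 2 by rewrite lerDl sqr_ge0.
have w0 w : 0 <= 1 + w ^+ 2 by exact: le_trans ler01 (w1 w).
have w2 w : w ^+ 2 <= 1 + w ^+ 2 by rewrite lerDr.
have w4 w : 1 + w ^+ 2 <= (1 + w ^+ 2) ^+ 2 by rewrite [leRHS]expr2 -[leLHS]mulr1 ler_wpM2l.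
have le1 (r k : R -> R) : (forall w, 0 <= r w <= k w) ->
    forall w, `|r w * c w| <= `|k w * c w|.
  move=> rk w; rewrite !normrM; apply: ler_wpM2r => //.
  have /andP[r0 rk'] := rk w; rewrite !ger0_norm//; exact: le_trans rk'.
have s1 : sqint c.
  apply: (sqint_le mc _ sh) => w; rewrite -[X in `|X| <= _]mul1r.
  apply: (le1 (cst 1) (fun w => (1 + w ^+ 2) ^+ 2)) => {}w /=.
  by rewrite ler01/=; exact: le_trans (w1 w) (w4 w).
have s2 : sqint (fun w => w ^+ 2 * c w).
  apply: (sqint_le mw _ sh) => w.
  apply: (le1 (fun w => w ^+ 2) (fun w => (1 + w ^+ 2) ^+ 2)) => {}w.
  by rewrite sqr_ge0/=; exact: le_trans (w2 w) (w4 w).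
have i0 : intg (fun w => (1 + w ^+ 2) * c w).
  apply: eq_intg (intgZ 2^-1 (sqintM sh (sqint_poisker ltr01))) => w.
  rewrite /poisker expr1n mulr1; field.
  by rewrite gt_eqF// (lt_le_trans ltr01).
split => //.
  apply: (intg_le mc _ i0) => w; rewrite -[X in `|X| <= _]mul1r.
  by apply: (le1 (cst 1) (fun w => 1 + w ^+ 2)) => {}w /=; rewrite ler01 w1.
apply: (intg_le mw _ i0) => w.
by apply: (le1 (fun w => w ^+ 2) (fun w => 1 + w ^+ 2)) => {}w; rewrite sqr_ge0 w2.
Qed.

(** Splitting at the cut-off 1 gives [symb0 w <= w^2 + 2 * smass 1]. *)
Lemma decay_symb0 c : decay c ->
  intg (fun w => c w * symb0 w) /\ sqint (fun w => c w * symb0 w).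
Proof.
move=> [sc ic sc2 ic2]; pose C := 2 * smass (1 : R).
have C0 : 0 <= C by apply: mulr_ge0 => //; apply: integral_ge0_real => z; exact: sker_ge0.
have m0 : meas (fun w => c w * symb0 w).
  by apply: measurable_funM; [exact: sc.1|exact: meas_symb0].
pose B w := `|w ^+ 2 * c w| + C * `|c w|.
have bnd w : `|c w * symb0 w| <= `|B w|.
  rewrite [leRHS]ger0_norm /B; last by rewrite addr_ge0// mulr_ge0.
  rewrite normrM (normrM (w ^+ 2)) -mulrDl mulrC.
  apply: ler_wpM2r => //.
  have /andP[h1 h2] := symb0B w (@ltr01 R); have h3 := symb_bounded w (@ltr01 R).
  rewrite (ger0_norm (sqr_ge0 w)); rewrite mul1r in h2.
  have -> : symb0 w = symb0 w - symb 1 w + symb 1 w by rewrite subrK.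
  apply: (le_trans (ler_normD _ _)); apply: lerD; last exact: h3.
  by rewrite ger0_norm.
split.
  exact: (intg_le m0 bnd (intgD (intg_norm ic2) (intgZ _ (intg_norm ic)))).
exact: (sqint_le m0 bnd (sqintD (sqint_norm sc2) (sqintZ _ (sqint_norm sc)))).
Qed.

Definition dsymb e c w := c w * (symb0 w - symb e w).

Lemma dsymb_le e c w : 0 < e -> `|dsymb e c w| <= `|e * (w ^+ 2 * c w)|.
Proof.
move=> e0; have /andP[h1 h2] := symb0B w e0.
rewrite /dsymb mulrA [leRHS]normrM normrM mulrC; apply: ler_wpM2r => //.
by rewrite ger0_norm//; apply: (le_trans h2); exact: ler_norm.
Qed.

Lemma decay_dsymb e c : 0 < e -> decay c ->
  [/\ intg (dsymb e c), sqint (dsymb e c),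
      \int[mu]_w `|dsymb e c w| <= e * \int[mu]_w `|w ^+ 2 * c w| &
      sqnorm (dsymb e c) <= e ^+ 2 * sqnorm (fun w => w ^+ 2 * c w)].
Proof.
move=> e0 [sc ic sc2 ic2].
have m : meas (dsymb e c).
  apply: measurable_funM; first exact: sc.1.
  by apply: measurable_funB; [exact: meas_symb0|exact: meas_symb].
have i1 : intg (dsymb e c).
  exact: (intg_le m (fun w => dsymb_le c w e0) (intgZ _ ic2)).
have s1 : sqint (dsymb e c).
  exact: (sqint_le m (fun w => dsymb_le c w e0) (sqintZ _ sc2)).
split => //.
  rewrite -(RintZ _ (intg_norm ic2)).
  apply: (le_integral_intg (intg_norm i1) (intgZ _ (intg_norm ic2))) => w.
  by apply: (le_trans (dsymb_le c w e0)); rewrite normrM (gtr0_norm e0).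
rewrite -(sqnormZ _ sc2).
exact: (le_sqnorm s1 (sqintZ _ sc2) (fun w => dsymb_le c w e0)).
Qed.

Lemma decay_symb e c : 0 < e -> decay c -> intg (fun w => c w * symb e w).
Proof.
move=> e0 [sc ic _ _].
apply: (intgM_bounded ic (meas_symb e)) => w; exact: symb_bounded.
Qed.

Definition lap_part b c x := trigT b (fun w => c w * symb0 w) x.

Lemma lap_partB b c e x : 0 < e -> decay c ->
  lap_part b c x - trigT b (fun w => c w * symb e w) x = trigT b (dsymb e c) x.
Proof.
move=> e0 dc; have [i0 _] := decay_symb0 dc; have i1 := decay_symb e0 dc.
rewrite -(trigTB b x i0 i1); apply: eq_Rint => w.
by rewrite /dsymb mulrBr.
Qed.

Definition lap_synthesis c s x :=
  (2 * pi)^-1 * (pi^-1 * (lap_part false c x + lap_part true s x)).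

Context (c s v : R -> R) (dc : decay c) (ds : decay s)
  (vE : forall x, v x = (2 * pi)^-1 * synthesis c s x).

Let K : R := (2 * pi)^-1 * pi^-1.

Let diff e x : 0 < e ->
  lap_synthesis c s x - trunc_lap e v x =
  K * (trigT false (dsymb e c) x + trigT true (dsymb e s) x).
Proof.
move=> e0; have [_ ic _ _] := dc; have [_ is_ _ _] := ds.
have E : trunc_lap e v x = K *
    (trigT false (fun w => c w * symb e w) x + trigT true (fun w => s w * symb e w) x).
  have ib b h : intg h ->
      intg (fun y => (trigT b h x - trigT b h y) * sker e (x - y)).
    move=> ih; apply: (@eq_intg _ (fun y => sker e (x - y) * (trigT b h x - trigT b h y))).
      by move=> y; rewrite mulrC.
    apply: (@intgM_bounded _ (2 * \int[mu]_w `|h w|) _ _ (intg_sker_reflect x e0)).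
      apply: measurable_funB; first exact: measurable_cst.
      by apply: meas_trigT; exact: intg_meas.
    move=> z; apply: (le_trans (ler_normB _ _)); rewrite mulr_natl mulr2n.
    by apply: lerD; exact: trigT_bounded.
  have i1 := ib false c ic; have i2 := ib true s is_.
  rewrite -(trunc_lap_trigT false x e0 ic) -(trunc_lap_trigT true x e0 is_).
  have J : \int[mu]_y ((v x - v y) * sker e (x - y)) = (2 * pi)^-1 *
      (\int[mu]_y ((trigT false c x - trigT false c y) * sker e (x - y)) +
       \int[mu]_y ((trigT true s x - trigT true s y) * sker e (x - y))).
    rewrite -(RintD i1 i2) -(RintZ _ (intgD i1 i2)); apply: eq_Rint => y.
    by rewrite !vE /synthesis; ring.
  by rewrite /trunc_lap J mulrCA /K mulrA.
rewrite E -(lap_partB false x e0 dc) -(lap_partB true x e0 ds) /lap_synthesis /K.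
by ring.
Qed.

Lemma sqint_lap_synthesis : sqint (lap_synthesis c s).
Proof.
have [i1 s1] := decay_symb0 dc; have [i2 s2] := decay_symb0 ds.
apply: sqintZ; apply: sqintZ; apply: sqintD.
  exact: (bessel false i1 s1).1.
exact: (bessel true i2 s2).1.
Qed.

(** The error has transform [dsymb], of L1 norm [O(e)], so it is small uniformly in [x]. This yields
    the principal value at every point. *)
Let diff_bound : exists C, forall e x, 0 < e ->
  `|lap_synthesis c s x - trunc_lap e v x| <= C * e.
Proof.
pose I1 := \int[mu]_w `|w ^+ 2 * c w|; pose I2 := \int[mu]_w `|w ^+ 2 * s w|.
exists (`|K| * (I1 + I2)) => e x e0.
have [i1 _ b1 _] := decay_dsymb e0 dc; have [i2 _ b2 _] := decay_dsymb e0 ds.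
rewrite diff// normrM -mulrA; apply: ler_wpM2l => //.
apply: (le_trans (ler_normD _ _)); rewrite mulrC mulrDr; apply: lerD.
  exact: (le_trans (trigT_bounded false x i1)).
exact: (le_trans (trigT_bounded true x i2)).
Qed.

Lemma sqint_trunc_lap_synthesis e : 0 < e -> sqint (trunc_lap e v).
Proof.
move=> e0.
have [i1 s1 _ _] := decay_dsymb e0 dc; have [i2 s2 _ _] := decay_dsymb e0 ds.
have sd : sqint (fun x => K * (trigT false (dsymb e c) x + trigT true (dsymb e s) x)).
  by apply: sqintZ; apply: sqintD; [exact: (bessel false i1 s1).1|exact: (bessel true i2 s2).1].
have := sqintB sqint_lap_synthesis sd; congr sqint; apply/funext => x.
by rewrite -diff//; ring.
Qed.

(** The L2 counterpart of the uniform estimate: [bessel] turns the L2 bound on [dsymb] into norm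
    convergence at rate [e]. *)
Lemma cvg_trunc_lap_synthesis p : sqint p ->
  \int[mu]_x (p x * trunc_lap n.+1%:R^-1 v x) @[n --> \oo] -->
  \int[mu]_x (p x * lap_synthesis c s x).
Proof.
move=> sp; have d0 n : 0 < n.+1%:R^-1 :> R by rewrite invr_gt0.
pose N1 := sqnorm (fun w => w ^+ 2 * c w); pose N2 := sqnorm (fun w => w ^+ 2 * s w).
pose C := K ^+ 2 * (4 * pi * (N1 + N2)).
have bnd n : sqnorm (fun x => trunc_lap n.+1%:R^-1 v x - lap_synthesis c s x) <=
    n.+1%:R^-1 ^+ 2 * C.
  set e := n.+1%:R^-1; have e0 : 0 < e by exact: d0.
  have [i1 s1 _ b1] := decay_dsymb e0 dc; have [i2 s2 _ b2] := decay_dsymb e0 ds.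
  have [t1 l1] := bessel false i1 s1; have [t2 l2] := bessel true i2 s2.
  have -> : sqnorm (fun x => trunc_lap e v x - lap_synthesis c s x) =
      sqnorm (fun x => K * (trigT false (dsymb e c) x + trigT true (dsymb e s) x)).
    by apply: eq_Rint => x; rewrite -diff// -sqrrN opprB.
  rewrite (sqnormZ K (sqintD t1 t2)) /C mulrCA; apply: ler_wpM2l; first exact: sqr_ge0.
  apply: (le_trans (sqnormD_le t1 t2)).
  have pi0 : 0 <= 2 * pi :> R by rewrite mulr_ge0// pi_ge0.
  have h1 := le_trans l1 (ler_wpM2l pi0 b1); have h2 := le_trans l2 (ler_wpM2l pi0 b2).
  have -> : e ^+ 2 * (4 * pi * (N1 + N2)) =
      2 * (2 * pi * (e ^+ 2 * N1)) + 2 * (2 * pi * (e ^+ 2 * N2)).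
    by move: (e) (@pi R) (N1) (N2); clear => ? ? ? ?; ring.
  by apply: lerD; apply: ler_wpM2l.
have lim0 : sqnorm (fun x => trunc_lap n.+1%:R^-1 v x - lap_synthesis c s x)
    @[n --> \oo] --> 0.
  apply: (@squeeze_cvgr _ _ _ _ (cst 0) (fun n => n.+1%:R^-1 ^+ 2 * C)).
  - by apply: nearW => n; rewrite sqnorm_ge0 bnd.
  - exact: cvg_cst.
  - rewrite (_ : 0 = 0 * 0 * C); last by rewrite !mul0r.
    apply: cvgM; last exact: cvg_cst.
    by apply: cvgM; exact: cvg_harmonic.
have := @cvg_sqnorm_integral _ _ _ _ _ _ p
  (fun n => sqint_trunc_lap_synthesis (d0 n)) sqint_lap_synthesis sp lim0.
move=> h; rewrite (eq_Rint (fun x => mulrC (p x) (lap_synthesis c s x))).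
apply: cvg_trans (h _); apply: near_eq_cvg; apply: nearW => n.
by apply: eq_Rint => x; rewrite mulrC.
Qed.

Lemma half_laplacian_synthesis x : half_laplacian v x = lap_synthesis c s x.
Proof.
have [C hC] := diff_bound; have pi0 := @pi_gt0 R.
pose I e := \int[mu]_(y in [set y | e < `|x - y|]) ((v x - v y) / `|x - y| ^+ 2).
have IE e : I e = pi * trunc_lap e v x.
  rewrite /I /trunc_lap mulVKf ?gt_eqF// Rintegral_mkcond.
  apply: eq_Rint => y; rewrite patchE /sker; case: ifPn.
    by rewrite inE/= => ->; rewrite real_normK// num_real.
  by move=> /negP; rewrite inE/= => /negP/negbTE ->; rewrite mulr0.
have cI : I e @[e --> 0^'+] --> pi * lap_synthesis c s x.
  have C0 : 0 <= pi * `|C| by rewrite mulr_ge0// ltW.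
  have B0 : 0 < pi * `|C| + 1 by rewrite ltr_wpDl.
  apply/cvgrPdist_le => r r0; have rB : 0 < r / (pi * `|C| + 1) by exact: divr_gt0.
  near=> e; have e0 : 0 < e by near: e; exact: nbhs_right_gt.
  rewrite IE -mulrBr normrM (gtr0_norm pi0).
  apply: (le_trans (ler_wpM2l (ltW pi0) (hC _ _ e0))).
  apply: (@le_trans _ _ ((pi * `|C| + 1) * e)).
    rewrite mulrA; apply: ler_wpM2r; first exact: ltW.
    apply: (@le_trans _ _ (pi * `|C|)); last by rewrite lerDl.
    by apply: ler_wpM2l; [exact: ltW|exact: ler_norm].
  rewrite mulrC -ler_pdivlMr//.
  by near: e; exact: nbhs_right_le.
rewrite /half_laplacian (cvg_lim (@Rhausdorff R) cI) mulKf// gt_eqF//.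
Unshelve. all: by end_near. Qed.

End half_laplacian_synthesis.

(** * The layer solution *)

Section layer.
Context {R : realType}.
Implicit Types (e t x y z : R).
Local Notation mu := (@lebesgue_measure R).

Definition cauchy x : R := (1 + x ^+ 2)^-1.

Lemma cauchy_den x : 0 < 1 + x ^+ 2.
Proof. by rewrite ltr_wpDr// sqr_ge0. Qed.

Lemma cauchy_gt0 x : 0 < cauchy x.
Proof. by rewrite invr_gt0 cauchy_den. Qed.

Lemma cauchy_poisker x : cauchy x = 2^-1 * poisker 1 x.
Proof. by rewrite /poisker expr1n mulr1 mulrA mulVf// mul1r. Qed.

Lemma phiN x : phi (- x) = - phi x.
Proof. by rewrite /phi atanN mulrN. Qed.

Instance is_derive_phi x : is_derive x 1 (@phi R) (2 / pi * cauchy x).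
Proof.
have -> : @phi R = (fun x => 2 / pi * atan x) by [].
exact: is_derive_eq.
Qed.

(** The double angle formula for the sine, at the angle [atan x]. *)
Lemma dpotential_phi x : dpotential (phi x) = - (2 * x * cauchy x / pi).
Proof.
have pi0 := @pi_gt0 R; rewrite /dpotential; congr (- (_ / _)).
have -> : pi * phi x = atan x *+ 2.
  rewrite /phi mulr2n; move: pi0 (atan x); move: (@pi R) => p p0 a; field.
  by rewrite gt_eqF.
have c2 : cos (atan x) ^+ 2 = cauchy x.
  by rewrite cos_atan exprVn sqr_sqrtr// ltW// cauchy_den.
have c0 : cos (atan x) != 0.
  by rewrite -sqrf_eq0 c2 gt_eqF// cauchy_gt0.
have s1 : sin (atan x) = x * cos (atan x).
  by have := atanK x; rewrite /tan => {2}<-; rewrite divfK.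
by rewrite sin_mulr2n s1 mulrCA -expr2 c2 mulr2n; ring.
Qed.

Lemma continuous_phi : continuous (@phi R).
Proof.
move=> x; apply: cvgM; first exact: cvg_cst.
exact: continuous_atan.
Qed.

Lemma phi_bounded x : `|phi x| <= 1.
Proof.
have pi0 := @pi_gt0 R; have ip : `|pi^-1 : R| = pi^-1.
  by rewrite gtr0_norm// invr_gt0.
rewrite /phi !normrM ip ger0_norm// mulrAC ler_pdivrMr// mul1r mulrC -ler_pdivlMr//.
by rewrite ler_norml (ltW (atan_gtNpi2 x)) (ltW (atan_ltpi2 x)).
Qed.

Lemma phi_le : {homo @phi R : x y / x <= y}.
Proof.
move=> x y xy; apply: ler_wpM2l; last exact: le_atan.
by rewrite divr_ge0// pi_ge0.
Qed.

Lemma phi_lt : {homo @phi R : x y / x < y}.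
Proof.
move=> x y xy; rewrite /phi ltr_pM2l ?lt_atan//.
by rewrite divr_gt0// pi_gt0.
Qed.

Lemma mvt_bound (f df : R -> R) (M e : R) : 0 < e ->
  (forall t, is_derive t 1 f (df t)) -> (forall t, 0 < t < e -> `|df t| <= M) ->
  `|f e - f 0| <= M * e.
Proof.
move=> e0 fdf dfM.
have cf x : {for x, continuous f}.
  by apply/differentiable_continuous/derivable1_diffP; have [] := fdf x.
have [|c ce ->] := @MVT _ f df 0 e e0 (fun z _ => fdf z).
  exact: continuous_subspaceT.
rewrite subr0 normrM (gtr0_norm e0); apply: ler_wpM2r; first exact: ltW.
by apply: dfM; move: ce; rewrite in_itv.
Qed.

Lemma cauchy_shift_le x t : 0 <= t <= 1 -> cauchy (x - t) <= 3 * cauchy x.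
Proof.
move=> /andP[t0 t1]; rewrite /cauchy -[leLHS]mul1r ler_pdivrMr; last exact: cauchy_den.
rewrite mulrAC ler_pdivlMr; last exact: cauchy_den.
have := sqr_ge0 (x - 2 * t); have : t ^+ 2 <= 1 by rewrite expr_le1.
by rewrite !sqrrB; clear; nra.
Qed.

(** Each shift costs a factor 3 and [|x| * cauchy x <= 1 / 2]; the constant rounds up [9 / 2]. *)
Lemma cauchy_pair_le x t : 0 <= t <= 1 ->
  `|x| * (cauchy (x - t) * cauchy (x + t)) <= 5 * cauchy x.
Proof.
move=> t01; have h1 := cauchy_shift_le x t01.
have : cauchy (- x - t) <= 3 * cauchy (- x) by exact: cauchy_shift_le.
have -> : cauchy (- x - t) = cauchy (x + t) by rewrite /cauchy -opprD sqrrN.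
have -> : cauchy (- x) = cauchy x by rewrite /cauchy sqrrN.
move=> h2; have c0 := cauchy_gt0.
have xc : `|x| * cauchy x <= 2^-1.
  rewrite ler_pdivrMr; last exact: cauchy_den.
  have := sqr_ge0 (`|x| - 1); rewrite -(real_normK (num_real x)).
  by move: `|x| => u; rewrite sqrrB; clear; nra.
have := ler_pM (ltW (c0 _)) (ltW (c0 _)) h1 h2.
move=> /(ler_wpM2l (normr_ge0 x)) /le_trans; apply.
have := ler_wpM2r (ltW (c0 x)) xc; have := ltW (c0 x).
by move: (`|x|) (cauchy x); clear => u k; nra.
Qed.

Lemma cauchy_diff x t : cauchy (x - t) - cauchy (x + t) =
  4 * x * t * (cauchy (x - t) * cauchy (x + t)).
Proof.
have := cauchy_den (x - t); have := cauchy_den (x + t); rewrite /cauchy => h1 h2.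
by field; rewrite !gt_eqF.
Qed.

(** The derivative in the increment [t] is [2 / pi * (cauchy (x - t) - cauchy (x + t))], which has a
    further factor [t] by [cauchy_diff]. This produces [e^2], and [cauchy_pair_le] the decay in [x],
    with [40 = 8 * 5]. *)
Lemma second_difference_phi x e : 0 < e <= 1 ->
  `|2 * phi x - phi (x + e) - phi (x - e)| <= 40 / pi * cauchy x * e ^+ 2.
Proof.
move=> /andP[e0 e1]; have pi0 := @pi_gt0 R.
pose d t := 2 * phi x - phi (x + t) - phi (x - t).
pose dd t := 2 / pi * (cauchy (x - t) - cauchy (x + t)).
have dP t : is_derive t 1 d (dd t).
  rewrite /d /dd; apply: is_derive_eq.
  by rewrite /cauchy /GRing.scale/=; ring.
have := @mvt_bound d dd (40 / pi * cauchy x * e) e e0 dP.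
rewrite {2}/d addr0 subr0 (_ : 2 * phi x - phi x - phi x = 0) ?subr0; last by ring.
rewrite -[leRHS]mulrA -expr2; apply => t /andP[t0 te].
rewrite /dd cauchy_diff !normrM (gtr0_norm t0).
have -> : `|2 : R| = 2 by rewrite ger0_norm.
have -> : `|4 : R| = 4 by rewrite ger0_norm.
have -> : `|pi^-1 : R| = pi^-1 by rewrite ger0_norm// invr_ge0 ltW.
rewrite !(gtr0_norm (cauchy_gt0 _)).
have t01 : 0 <= t <= 1 by rewrite (ltW t0)/= (le_trans (ltW te)).
have := cauchy_pair_le x t01; set u := `|x| * _ => hu.
rewrite [leLHS](_ : _ = 8 / pi * (u * t)); last by rewrite /u; ring.
rewrite [leRHS](_ : _ = 8 / pi * (5 * cauchy x * e)); last by ring.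
apply: ler_wpM2l; first by rewrite divr_ge0// ltW.
apply: ler_pM => //; [|exact: ltW|exact: ltW].
by rewrite /u mulr_ge0// mulr_ge0// ltW// cauchy_gt0.
Qed.

End layer.

Section layer_equation.
Context {R : realType}.
Implicit Types (e t x y z : R).
Local Notation mu := (@lebesgue_measure R).

Lemma integral_fold (f : R -> R) : intg f ->
  \int[mu]_x f x = \int[mu]_(x in `[0, +oo[) f x + \int[mu]_(x in `[0, +oo[) f (- x).
Proof.
move=> fi; have fiN : intg (fun x => f (- x)).
  by apply: eq_intg (intg_reflect 0 fi) => x; rewrite sub0r.
have EN : \int[mu]_x f (- x) = \int[mu]_x f x.
  by rewrite -[RHS](integral_reflect 0 fi); apply: eq_Rint => x; rewrite sub0r.
have i2 := intgD fi fiN.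
have : \int[mu]_x (f x + f (- x)) = 2 * \int[mu]_(x in `[0, +oo[) (f x + f (- x)).
  by rewrite -integral_even// => x; rewrite opprK addrC.
rewrite (RintD fi fiN) EN -mulr2n -[X in X = _]mulr_natl => /mulfI -> //.
by rewrite RintegralD//; [exact: integrableS fi|exact: integrableS fiN].
Qed.

Let c x : R := 2 / pi * cauchy x.

(** Primitive in [z] of [(phi x - phi (x + z)) / z^2]: one integration by parts, then partial
    fractions for the remaining [2 / pi / (z * (1 + (x + z)^2))]. *)
Definition lap_primitive x z : R := - ((phi x - phi (x + z)) / z) -
  c x * (ln z - 2^-1 * ln (1 + (x + z) ^+ 2) - x * atan (x + z)).

Lemma is_derive_lap_primitive x z : 0 < z ->
  is_derive z 1 (lap_primitive x) ((phi x - phi (x + z)) / z ^+ 2).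
Proof.
move=> z0; have zn : z != 0 by rewrite gt_eqF.
have d1 : is_derive z 1 (fun t => 1 + (x + t) ^+ 2) (2 * (x + z)).
  by apply: is_derive_eq; rewrite /GRing.scale/=; ring.
have d2 : is_derive z 1 (fun t => ln (1 + (x + t) ^+ 2))
    ((1 + (x + z) ^+ 2)^-1 * (2 * (x + z))).
  exact: (@is_derive1_comp _ (@ln R) (fun t => 1 + (x + t) ^+ 2) z _ _
    (is_derive1_ln (cauchy_den (x + z))) d1).
have d3 : is_derive z 1 (fun t => t^-1) (- z ^- 2).
  have := @is_deriveV R id z 1 1 zn (is_derive_id z 1).
  by rewrite /GRing.scale/= mulr1.
have d4 := is_derive1_ln z0.
rewrite /lap_primitive; apply: is_derive_eq.
rewrite /GRing.scale/= /c; have := cauchy_den x; have := cauchy_den (x + z).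
move: (@pi_gt0 R); rewrite /cauchy; move: (phi x) (phi (x + z)) (@pi R) => p q w w0 h1 h2.
by field; rewrite !gt_eqF.
Qed.

Lemma cvg_inv_pinfty : z^-1 @[z --> +oo] --> (0 : R).
Proof.
have h : \forall z \near (+oo : set_system R), 0 < z by exact: nbhs_pinfty_gt.
exact: (gtr0_cvgV0 h).2 cvg_id.
Qed.

Lemma cvg_lap_primitive x : lap_primitive x z @[z --> +oo] --> x * cauchy x.
Proof.
have i0 := cvg_inv_pinfty.
have l0 : ln z - 2^-1 * ln (1 + (x + z) ^+ 2) @[z --> +oo] --> (0 : R).
  have h1 : 1 + 2 * x * z^-1 + (1 + x ^+ 2) * (z^-1 * z^-1) @[z --> +oo] --> (1 : R).
    rewrite [X in _ --> X](_ : _ = 1 + 2 * x * 0 + (1 + x ^+ 2) * (0 * 0)); last by ring.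
    apply: cvgD; last by apply: cvgM; [exact: cvg_cst|exact: cvgM].
    by apply: cvgD; [exact: cvg_cst|apply: cvgM; [exact: cvg_cst|exact: i0]].
  have h2 := cvg_comp _ _ h1 (continuous_ln (@ltr01 R)); rewrite ln1 in h2.
  have h3 : - (2^-1 * ln (1 + 2 * x * z^-1 + (1 + x ^+ 2) * (z^-1 * z^-1))) @[z --> +oo] --> (0 : R).
    rewrite -[X in _ --> X]oppr0 -[X in _ --> - X](mulr0 2^-1).
    by apply: cvgN; apply: cvgM; [exact: cvg_cst|exact: h2].
  apply: cvg_trans h3; apply: near_eq_cvg; near=> z.
  have z0 : 0 < z by near: z; exact: nbhs_pinfty_gt.
  have -> : 1 + 2 * x * z^-1 + (1 + x ^+ 2) * (z^-1 * z^-1) = (1 + (x + z) ^+ 2) / z ^+ 2.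
    by field; rewrite gt_eqF.
  rewrite ln_div ?posrE ?cauchy_den ?exprn_gt0// lnXn// mulr2n.
  by field.
rewrite /lap_primitive [X in _ --> X](_ : _ = - ((phi x - 1) * 0) - c x * (0 - x * (pi / 2))).
  have hx : x + z @[z --> (+oo : set_system R)] --> +oo by exact: cvg_addrl.
  have ha : atan (x + z) @[z --> +oo] --> (pi / 2 : R).
    exact: (cvg_comp _ _ hx (@cvgy_atan R)).
  apply: cvgB; last first.
    apply: cvgM; first exact: cvg_cst.
    by apply: cvgB; [exact: l0|apply: cvgM; [exact: cvg_cst|exact: ha]].
  apply: cvgN; apply: cvgM; last exact: i0.
  apply: cvgB; first exact: cvg_cst.
  rewrite [X in _ --> X](_ : _ = 2 / pi * (pi / 2)); last first.
    by move: (@pi_gt0 R); move: (@pi R) => p p0; field; rewrite gt_eqF.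
  by apply: cvgM; [exact: cvg_cst|exact: ha].
move: (@pi_gt0 R); rewrite /c; move: (@pi R) (cauchy x) => p k p0.
by rewrite mulr0 oppr0 sub0r sub0r; field; rewrite gt_eqF.
Unshelve. all: by end_near. Qed.

Lemma integral_phi_far x e : 0 < e ->
  \int[mu]_(z in `[0, +oo[) ((phi x - phi (x + z)) * sker e z) =
  x * cauchy x - lap_primitive x e.
Proof.
move=> e0.
have -> : \int[mu]_(z in `[0, +oo[) ((phi x - phi (x + z)) * sker e z) =
    \int[mu]_(z in `[e, +oo[) ((phi x - phi (x + z)) / z ^+ 2).
  rewrite Rintegral_mkcond [RHS]Rintegral_mkcond; apply: ae_Rintegral.
  (* [sker] excludes the endpoint [z = e] and the interval includes it; this is a null set. *)
  have [N [mN N0 hN]] := ae_norm_neq e; exists N; split => // z /= hz.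
  apply: hN => /= ze; apply: hz; rewrite !patchE !mem_setE !in_itv/= !andbT /sker.
  have [z0|z0] := leP 0 z; last first.
    by rewrite leNgt (lt_trans z0 e0).
  rewrite ger0_norm// in ze *; rewrite le_eqVlt eq_sym (negbTE ze)/=.
  by case: ifP => //; rewrite mulr0.
have dF z : e < z -> derivable (lap_primitive x) z 1.
  by move=> ez; have [] := is_derive_lap_primitive x (lt_trans e0 ez).
rewrite /Rintegral (@le0_continuous_FTC2y _ _ (lap_primitive x) _ (x * cauchy x))//.
- move=> z ez; have z0 := lt_le_trans e0 ez.
  rewrite mulr_le0_ge0// ?invr_ge0 ?sqr_ge0// subr_le0; apply: phi_le.
  by rewrite lerDl ltW.
- apply: continuous_in_subspaceT => z; rewrite inE/= in_itv/= andbT => ez.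
  have z0 := lt_le_trans e0 ez.
  apply: cvgM.
    apply: cvgB; first exact: cvg_cst.
    have cz : x + t @[t --> z] --> x + z by apply: cvgD; [exact: cvg_cst|exact: cvg_id].
    exact: (cvg_comp _ _ cz (@continuous_phi R (x + z))).
  apply: cvgV; first by rewrite gt_eqF// exprn_gt0.
  exact: exprn_continuous.
- exact: cvg_lap_primitive.
- apply: cvg_at_right_filter.
  have [d _] := is_derive_lap_primitive x e0.
  by move/derivable1_diffP/differentiable_continuous : d.
- move=> z; rewrite in_itv/= andbT => ez; rewrite derive1E.
  exact: (@derive_val _ _ _ _ _ _ _ (is_derive_lap_primitive x (lt_trans e0 ez))).
Qed.

Lemma intg_phi_sker x e : 0 < e -> intg (fun z => (phi x - phi (x + z)) * sker e z).
Proof.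
move=> e0; apply: (@eq_intg _ (fun z => sker e z * (phi x - phi (x + z)))).
  by move=> z; rewrite mulrC.
apply: (@intgM_bounded _ 2 _ _ (intg_sker e0)).
  apply: measurable_funB; first exact: measurable_cst.
  have m : measurable_fun [set: R] (fun z => x + z) by exact: measurable_funD.
  exact: (measurableT_comp (meas_continuous continuous_phi) m).
move=> z; apply: (le_trans (ler_normB _ _)); rewrite (_ : 2 = 1 + 1); last by ring.
by apply: lerD; exact: phi_bounded.
Qed.

(** The two half-lines contribute the limits of the primitives at infinity, [x * cauchy x] each, and
    [2 / pi * x * cauchy x] is [- dpotential (phi x)]. The layer equation is thus exact up to the
    values of the primitives at the cut-off. *)
Lemma trunc_lap_phi x e : 0 < e -> trunc_lap e phi x + dpotential (phi x) =
  pi^-1 * (lap_primitive (- x) e - lap_primitive x e).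
Proof.
move=> e0; have i := intg_phi_sker x e0.
have cN : cauchy (- x) = cauchy x by rewrite /cauchy sqrrN.
have -> : trunc_lap e phi x =
    pi^-1 * (x * cauchy x - lap_primitive x e - (- x * cauchy x - lap_primitive (- x) e)).
  rewrite -{2}cN -(integral_phi_far x e0) -(integral_phi_far (- x) e0); congr (_ * _).
  transitivity (\int[mu]_z ((phi x - phi (x + z)) * sker e z)).
    rewrite -(integral_shift (- x) i); apply: eq_Rint => y.
    have -> : x + (y - x) = y by ring.
    by rewrite -(skerN e (x - y)) opprB.
  rewrite (integral_fold i); congr (_ + _).
  rewrite -mulN1r -RintegralZl//; last first.
    by apply: integrableS (intg_phi_sker (- x) e0).
  apply: eq_Rintegral => z _; rewrite skerN !phiN.
  by rewrite (_ : phi (x - z) = - phi (- x + z)); [ring|rewrite -phiN opprD opprK].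
by rewrite dpotential_phi; ring.
Qed.

(** The singular term [ln e] is the same in both primitives and cancels. What remains is a second
    difference of [phi] divided by [e], and a function [r] vanishing at [e = 0] with derivative at
    most 20. The decay in [x] is needed to pair the error with L2 functions. *)
Lemma trunc_lap_phi_bound : exists C : R, 0 <= C /\ forall e x, 0 < e <= 1 ->
  `|trunc_lap e phi x + dpotential (phi x)| <= C * e * cauchy x.
Proof.
have pi0 := @pi_gt0 R.
exists (pi^-1 * (40 / pi + 2 / pi * 20)); split.
  by rewrite mulr_ge0 ?addr_ge0 ?mulr_ge0 ?invr_ge0 ?ltW.
move=> e x e01; have /andP[e0 e1] := e01.
rewrite trunc_lap_phi// normrM (gtr0_norm (_ : 0 < pi^-1)) ?invr_gt0// -!mulrA.
apply: ler_wpM2l; first by rewrite invr_ge0 ltW.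
pose r t := 2^-1 * ln (1 + (x + t) ^+ 2) - 2^-1 * ln (1 + (x - t) ^+ 2) +
            x * (atan (x + t) - atan (x - t)).
pose dr t := 4 * x * (1 + x ^+ 2) * (cauchy (x - t) * cauchy (x + t)).
have drP t : is_derive t 1 r (dr t).
  have d1 : is_derive t 1 (fun t => 1 + (x + t) ^+ 2) (2 * (x + t)).
    by apply: is_derive_eq; rewrite /GRing.scale/=; ring.
  have d2 : is_derive t 1 (fun t => ln (1 + (x + t) ^+ 2))
      ((1 + (x + t) ^+ 2)^-1 * (2 * (x + t))).
    exact: (@is_derive1_comp _ (@ln R) (fun t => 1 + (x + t) ^+ 2) t _ _
      (is_derive1_ln (cauchy_den (x + t))) d1).
  have d3 : is_derive t 1 (fun t => 1 + (x - t) ^+ 2) (- (2 * (x - t))).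
    by apply: is_derive_eq; rewrite /GRing.scale/=; ring.
  have d4 : is_derive t 1 (fun t => ln (1 + (x - t) ^+ 2))
      ((1 + (x - t) ^+ 2)^-1 * - (2 * (x - t))).
    exact: (@is_derive1_comp _ (@ln R) (fun t => 1 + (x - t) ^+ 2) t _ _
      (is_derive1_ln (cauchy_den (x - t))) d3).
  rewrite /r; apply: is_derive_eq; rewrite /GRing.scale/= /dr /cauchy.
  have := cauchy_den (x + t); have := cauchy_den (x - t) => h1 h2.
  by field; rewrite !gt_eqF.
have rb : `|r e| <= 20 * e.
  have := @mvt_bound _ r dr 20 e e0 drP.
  have -> : r 0 = 0 by rewrite /r addr0 subr0 !subrr mulr0 addr0.
  rewrite subr0; apply => t /andP[t0 te].
  have t01 : 0 <= t <= 1 by rewrite (ltW t0)/= (le_trans (ltW te)).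
  have h := cauchy_pair_le x t01; have c0 := cauchy_den x.
  rewrite /dr !normrM (gtr0_norm c0) !(gtr0_norm (cauchy_gt0 _)) (@ger0_norm _ 4)//.
  have -> : 4 * `|x| * (1 + x ^+ 2) * (cauchy (x - t) * cauchy (x + t)) =
      4 * (1 + x ^+ 2) * (`|x| * (cauchy (x - t) * cauchy (x + t))) by ring.
  apply: (le_trans (ler_wpM2l _ h)); first by rewrite mulr_ge0// ltW.
  by rewrite /cauchy le_eqVlt; apply/orP; left; apply/eqP; field; rewrite gt_eqF.
have -> : lap_primitive (- x) e - lap_primitive x e =
    (2 * phi x - phi (x + e) - phi (x - e)) / e - c x * r e.
  rewrite /lap_primitive /c /r /cauchy !sqrrN.
  have -> : (- x + e) ^+ 2 = (x - e) ^+ 2 by ring.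
  have -> : atan (- x + e) = - atan (x - e) by rewrite -atanN; congr atan; ring.
  have -> : phi (- x + e) = - phi (x - e) by rewrite -phiN; congr phi; ring.
  by rewrite phiN; ring.
apply: (le_trans (ler_normB _ _)); rewrite [leRHS]mulrDl; apply: lerD.
  rewrite normrM normfV (gtr0_norm e0) ler_pdivrMr//.
  apply: (le_trans (second_difference_phi x e01)).
  by rewrite le_eqVlt; apply/orP; left; apply/eqP; ring.
have cc : 0 < c x by rewrite /c mulr_gt0 ?divr_gt0 ?cauchy_gt0.
rewrite normrM (gtr0_norm cc); apply: (le_trans (ler_wpM2l (ltW cc) rb)).
by rewrite /c le_eqVlt; apply/orP; left; apply/eqP; ring.
Qed.

End layer_equation.

(** * Weak form of the flow *)

Section weak_solutions.
Context {R : realType}.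
Implicit Types (f g p c s : R -> R) (x t r xi : R).
Local Notation mu := (@lebesgue_measure R).

Lemma ae_sqint f g : meas f -> sqint g -> ae_equal f g -> sqint f.
Proof.
move=> mf sg fg; apply: L2norm_lty_sqint => //.
by rewrite (ae_L2norm fg) L2norm_sqint// ltry.
Qed.

Lemma ae_equal_trans f g p : ae_equal f g -> ae_equal g p -> ae_equal f p.
Proof.
move=> [N [mN N0 fgN]] [M [mM M0 gpM]]; exists (N `|` M); split.
- exact: measurableU.
- apply/eqP; rewrite eq_le measure_ge0 andbT.
  have NM0 : (mu N + mu M <= 0)%E by rewrite N0 M0 adde0.
  exact: le_trans (measureU2 mu mN mM) NM0.
- move=> x /= fp; have [fg|fg] := pselect (f x = g x); last by left; exact: fgN.
  by right; apply: gpM => /= gp; apply: fp; rewrite fg.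
Qed.

Lemma meas_square_integrable f : meas f -> square_integrable f -> sqint f.
Proof. by move=> mf /square_integrableP[g sg fg]; exact: ae_sqint fg. Qed.

Lemma meas_sqrt f : meas f -> meas (fun x => Num.sqrt (f x)).
Proof.
move=> mf; have ms : meas (@Num.sqrt R) by apply: meas_continuous; exact: sqrt_continuous.
exact: (measurableT_comp ms mf).
Qed.

Lemma meas_sobolev_weight (a : R) : meas (fun xi : R => (1 + xi ^+ 2) `^ a).
Proof.
have m : measurable_fun [set: R] (fun xi : R => 1 + xi ^+ 2).
  by apply: measurable_funD => //; exact: measurable_funX.
exact: (measurableT_comp (measurable_powR a) m).
Qed.

Lemma sobolev_normE (a : R) f c s :
  ae_equal (fourier f).1 c -> ae_equal (fourier f).2 s ->
  sobolev_norm a f =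
  L2norm (fun xi => (1 + xi ^+ 2) `^ (a / 2) * Num.sqrt (c xi ^+ 2 + s xi ^+ 2)).
Proof.
move=> fc fs; apply: ae_L2norm.
have h := ae_equal2 (fun x y => Num.sqrt (x ^+ 2 + y ^+ 2)) fc fs.
exact: (ae_equal2 *%R (ae_equal_refl (fun xi => (1 + xi ^+ 2) `^ (a / 2))) h).
Qed.

Lemma meas_sobolev_integrand (a : R) c s : meas c -> meas s ->
  meas (fun xi => (1 + xi ^+ 2) `^ (a / 2) * Num.sqrt (c xi ^+ 2 + s xi ^+ 2)).
Proof.
move=> mc ms; apply: measurable_funM; first exact: meas_sobolev_weight.
by apply: meas_sqrt; apply: measurable_funD; exact: measX2.
Qed.

Lemma norm_le_modulus (a b : R) : `|a| <= Num.sqrt (a ^+ 2 + b ^+ 2).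
Proof. by rewrite -sqrtr_sqr ler_wsqrtr// lerDl sqr_ge0. Qed.

Lemma norm_le_modulusr (a b : R) : `|b| <= Num.sqrt (a ^+ 2 + b ^+ 2).
Proof. by rewrite addrC norm_le_modulus. Qed.

Lemma sobolev4_decay f : meas f -> sobolev 4%:R f ->
  exists c s, [/\ ft f c s, decay c & decay s].
Proof.
move=> mf [/(meas_square_integrable mf) sf nf].
have [c [s [fcs fc fs]]] := fourier_rep sf (ae_equal_refl f).
have [_ sc ss _ _] := fcs.
rewrite (sobolev_normE _ fc fs) in nf.
have mm := meas_sobolev_integrand 4%:R sc.1 ss.1.
have sm := L2norm_lty_sqint mm nf.
have wE xi : (1 + xi ^+ 2) `^ (4%:R / 2) = (1 + xi ^+ 2) ^+ 2.
  rewrite (_ : 4%:R / 2 = 2%:R); last by field.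
  by rewrite powR_mulrn// ltW// cauchy_den.
have w0 xi : 0 <= (1 + xi ^+ 2) ^+ 2 :> R by exact: sqr_ge0.
have mw k : meas k -> meas (fun xi : R => (1 + xi ^+ 2) ^+ 2 * k xi).
  move=> mk; apply: measurable_funM => //; apply: measurable_funX.
  by apply: measurable_funD => //; exact: measurable_funX.
exists c, s; split => //; (apply: decay_weight; first by [case: sc|case: ss]).
  apply: (sqint_le (mw _ sc.1) _ sm) => xi; rewrite wE !normrM.
  apply: ler_wpM2l => //; rewrite [leRHS]ger0_norm ?sqrtr_ge0//.
  exact: norm_le_modulus.
apply: (sqint_le (mw _ ss.1) _ sm) => xi; rewrite wE !normrM.
apply: ler_wpM2l => //; rewrite [leRHS]ger0_norm ?sqrtr_ge0//.
exact: norm_le_modulusr.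
Qed.

Lemma cvg_L2norm_sqnorm (T : Type) (F : set_system T) {FF : Filter F}
    (g : T -> R -> R) : (\forall h \near F, sqint (g h)) ->
  L2norm (g h) @[h --> F] --> 0%E -> sqnorm (g h) @[h --> F] --> 0.
Proof.
move=> sg /fine_cvg h; have h2 := cvgM h h; rewrite mulr0 in h2.
apply: cvg_trans (h2 FF); apply: near_eq_cvg; near=> x.
have sx : sqint (g x) by near: x.
by rewrite /= L2norm_sqint//= -expr2 sqr_sqrtr// sqnorm_ge0.
Unshelve. all: by end_near. Qed.

Definition reaction f x : R := - dpotential (f x + phi x) + dpotential (phi x).

(** Says that the half-Laplacian of [f] is [reaction f - g]: the equation for [f = u - phi] at a
    fixed time, with [g] in the place of the time derivative. *)
Definition weakly_solves f g := forall p, sqint p ->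
  \int[mu]_x (p x * trunc_lap n.+1%:R^-1 f x) @[n --> \oo] -->
  \int[mu]_x (p x * (reaction f x - g x)).

(** The form in which a solution enters the comparison. Operators are tested against L2 functions
    only, so that positive parts are admissible without any regularity. *)
Record weak_flow (v g : R -> R -> R) : Prop := WeakFlow {
  weak_flow_continuous : forall t, 0 < t -> continuous (v t) ;
  weak_flow_sqint : forall t, 0 < t -> sqint (v t) ;
  weak_flow_dsqint : forall t, 0 < t -> sqint (g t) ;
  weak_flow_equation : forall t, 0 < t -> weakly_solves (v t) (g t) ;
  weak_flow_derivative : forall t, 0 < t ->
    sqnorm (fun x => h^-1 * (v (t + h) x - v t x) - g t x) @[h --> 0^'] --> 0 }.

Lemma near_dnbhs_time_gt0 t : 0 < t -> \forall h \near (0 : R)^', 0 < t + h.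
Proof.
move=> t0; apply: nbhs_dnbhs; near=> h.
have : - t < h by near: h; apply: lt_nbhsr; rewrite oppr_lt0.
by rewrite -subr_gt0 opprK addrC.
Unshelve. all: by end_near. Qed.

Lemma continuous_dpotential : continuous (@dpotential R).
Proof.
move=> x; apply: cvgN; apply: cvgM; last exact: cvg_cst.
have cz : pi * t @[t --> x] --> pi * x by apply: cvgM; [exact: cvg_cst|exact: cvg_id].
exact: (cvg_comp _ _ cz (@continuous_sin R (pi * x))).
Qed.

Lemma meas_reaction f : meas f -> meas (reaction f).
Proof.
move=> mf; have md := meas_continuous continuous_dpotential.
have mp := meas_continuous (@continuous_phi R).
apply: measurable_funD; last exact: (measurableT_comp md mp).
have m : measurable_fun [set: R] (fun x => f x + phi x) by exact: measurable_funD.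
by have := measurableT_comp md m => /measurable_funN.
Qed.

Lemma solution_weak_flow (u0 : R -> R) (u : R -> R -> R) : is_solution u0 u ->
  exists g : R -> R -> R, weak_flow (fun t => u t \- phi) g.
Proof.
move=> [uc us ui ue ur].
pose v (t : R) : R -> R := u t \- phi.
have cv t : 0 < t -> continuous (v t).
  by move=> t0 x; apply: cvgB; [exact: ur|exact: continuous_phi].
have mv t : 0 < t -> meas (v t) by move=> t0; apply: meas_continuous; exact: cv.
(* One time derivative in the Sobolev space of order 4, the order at which [decay_weight]
   applies. *)
have [w hw _] := us 1%N 4%N isT isT.
have sob t : 0 < t -> sobolev 4%:R (v t).
  by move=> t0; have [|hs _ _] := hw t; [rewrite /= in_itv/= t0|exact: hs].
have sv t : 0 < t -> sqint (v t).
  by move=> t0; apply: meas_square_integrable; [exact: mv|exact: (sob t t0).1].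
have ex t : exists L, 0 < t -> [/\ sqint L, half_laplacian (v t) = L &
    forall p, sqint p -> \int[mu]_x (p x * trunc_lap n.+1%:R^-1 (v t) x) @[n --> \oo] -->
    \int[mu]_x (p x * L x)].
  have [t0|t0] := ltP 0 t; last by exists (cst 0).
  have [c [s [fcs dc ds]]] := sobolev4_decay (mv t t0) (sob t t0).
  have [_ ic _ _] := dc; have [_ is_ _ _] := ds.
  have vE x : v t x = (2 * pi)^-1 * synthesis c s x.
    rewrite -(fourier_inversion fcs ic is_ (cv t t0)) mulKf//.
    by rewrite gt_eqF// mulr_gt0// pi_gt0.
  exists (lap_synthesis c s) => _; split.
  - exact: sqint_lap_synthesis.
  - by apply/funext => x; exact: half_laplacian_synthesis.
  - by move=> p sp; exact: cvg_trunc_lap_synthesis.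
pose L t := projT1 (cid (ex t)).
have LP t : 0 < t -> [/\ sqint (L t), half_laplacian (v t) = L t &
    forall p, sqint p -> \int[mu]_x (p x * trunc_lap n.+1%:R^-1 (v t) x) @[n --> \oo] -->
    \int[mu]_x (p x * L t x)].
  by move=> t0; rewrite /L; case: cid => l /= /(_ t0).
(* The derivative is defined by the equation, hence Borel and satisfying it at every point; it
   agrees almost everywhere with the given derivative. *)
pose g (t x : R) : R := reaction (v t) x - L t x.
have mg t : 0 < t -> meas (g t).
  move=> t0; have [sL _ _] := LP t t0.
  by apply: measurable_funB; [exact: meas_reaction (mv t t0)|exact: sL.1].
have gP t : 0 < t -> sqint (g t) /\
    L2norm (fun x => h^-1 * (v (t + h) x - v t x) - g t x) @[h --> 0^'] --> 0%E.
  move=> t0; have [k [/square_integrableP[k' sk' kk'] dk kE]] := ue t t0.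
  have kg : ae_equal k (g t).
    move: kE; have [_ -> _] := LP t t0; congr ae_equal; apply/funext => x.
    by rewrite /g /reaction; ring.
  split.
    apply: (ae_sqint (mg t t0) sk').
    exact: (ae_equal_trans (ae_equal_sym kg) kk').
  have E h : L2norm (fun x => h^-1 * (v (t + h) x - v t x) - g t x) =
      L2norm (fun x => h^-1 * (v (t + h) x - v t x) - k x).
    apply: ae_L2norm; apply: (ae_equal2 (fun x y => x - y) (ae_equal_refl _)).
    exact: ae_equal_sym.
  by under eq_cvg do rewrite E; exact: dk.
exists g; split => //.
- by move=> t t0; exact: (gP t t0).1.
- move=> t t0 p sp; have [_ _ h] := LP t t0; have := h p sp.
  rewrite (_ : \int[mu]_x (p x * L t x) =
    \int[mu]_x (p x * (reaction (v t) x - g t x)))//.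
  by apply: eq_Rint => x; rewrite /g; congr (_ * _); ring.
- move=> t t0; apply: cvg_L2norm_sqnorm; last exact: (gP t t0).2.
  near=> h; apply: sqintB; last exact: (gP t t0).1.
  apply: sqintZ; apply: sqintB; last exact: sv.
  apply: sv; near: h; exact: near_dnbhs_time_gt0.
Unshelve. all: by end_near. Qed.

End weak_solutions.

Section translates.
Context {R : realType}.
Implicit Types (a b c s x A : R).
Local Notation mu := (@lebesgue_measure R).

Lemma cauchy_translate_le A x s : `|s| <= A ->
  cauchy (x - s) <= 2 * (1 + A ^+ 2) * cauchy x.
Proof.
move=> sA; have s2 : s ^+ 2 <= A ^+ 2.
  by rewrite -(real_normK (num_real s)) lerXn2r// nnegrE (le_trans _ sA).
rewrite /cauchy -[leLHS]mul1r ler_pdivrMr; last exact: cauchy_den.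
rewrite mulrAC ler_pdivlMr; last exact: cauchy_den.
have := sqr_ge0 (x - 2 * s); have := sqr_ge0 (x - s); have := sqr_ge0 A.
by move: (A ^+ 2) s2 => A2; rewrite !sqrrB; clear; nra.
Qed.

(** By the mean value theorem the difference is [b - a] times [2 / pi * cauchy (x - c)] with
    [|c| <= A], and such a shift changes [cauchy] at most by the factor [2 * (1 + A^2)]. The lower
    bound measures the mass of the two gaps, the upper one the cost of moving an endpoint. *)
Lemma phi_translate_le A a b x : `|a| <= A -> `|b| <= A -> a <= b ->
  (b - a) * (pi * (1 + A ^+ 2))^-1 * cauchy x <= phi (x - a) - phi (x - b) <=
  (b - a) * (4 / pi * (1 + A ^+ 2)) * cauchy x.
Proof.
move=> aA bA; rewrite le_eqVlt => /orP[/eqP ->|ab]; first by rewrite !subrr !mul0r lexx.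
have pi0 := @pi_gt0 R; have A0 := cauchy_den A.
have xab : x - b < x - a by rewrite ltrD2l ltrN2.
have [|c] := @MVT _ phi (fun x => 2 / pi * cauchy x) _ _ xab (fun z _ => is_derive_phi z).
  by apply: continuous_subspaceT; exact: continuous_phi.
rewrite in_itv/= => /andP[c1 c2] ->.
have -> : x - a - (x - b) = b - a by ring.
have cA : `|x - c| <= A.
  move: aA bA; rewrite !ler_norml => /andP[a1 _] /andP[_ b1].
  by move: c1 c2 a1 b1; clear => ? ? ? ?; apply/andP; split; lra.
have h1 := cauchy_translate_le x cA.
have := cauchy_translate_le c (_ : `|- (x - c)| <= A); rewrite normrN => /(_ cA).
move: h1; have -> : x - (x - c) = c by ring.
have -> : c - - (x - c) = x by ring.
have -> : (pi * (1 + A ^+ 2))^-1 = 2 / pi * (2 * (1 + A ^+ 2))^-1.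
  by move: pi0 A0; move: (pi : R) (1 + A ^+ 2) => p k p0 k0; field; rewrite !gt_eqF.
have -> : 4 / pi * (1 + A ^+ 2) = 2 / pi * (2 * (1 + A ^+ 2)) :> R by ring.
rewrite (mulrC _ (b - a)) -!mulrA !ler_pM2l ?subr_gt0// ?invr_gt0// !mulrA => h1 h2.
rewrite h1 andbT ler_pdivrMl ?mulr_gt0//.
Qed.

Lemma sqint_cauchy : sqint (@cauchy R).
Proof.
have := sqintZ (2^-1) (sqint_poisker (@ltr01 R)); congr sqint; apply/funext => x.
by rewrite cauchy_poisker.
Qed.

(** A translate of the layer seen as a perturbation of [phi], which puts it in L2 next to
    [u t - phi]. *)
Definition layer_shift c x : R := phi (x - c) - phi x.

Lemma continuous_translate c : continuous (fun x => phi (x - c)).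
Proof.
move=> x; have cz : z - c @[z --> x] --> x - c by apply: cvgB; [exact: cvg_id|exact: cvg_cst].
exact: (cvg_comp _ _ cz (@continuous_phi R (x - c))).
Qed.

Lemma continuous_layer_shift c : continuous (layer_shift c).
Proof. by move=> x; apply: cvgB; [exact: continuous_translate|exact: continuous_phi]. Qed.

Lemma sqint_layer_shift c : sqint (layer_shift c).
Proof.
apply: (sqint_le _ _ (sqintZ (`|c| * (4 / pi * (1 + c ^+ 2))) sqint_cauchy)).
  by apply: meas_continuous; exact: continuous_layer_shift.
move=> x; rewrite /layer_shift -{2}[x]subr0.
have n0 : `|0 : R| <= `|c| by rewrite normr0.
have c0 := ltW (cauchy_gt0 x).
have [cp|cn] := leP 0 c.
  have /andP[h1 h2] := phi_translate_le x n0 (lexx `|c|) cp.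
  rewrite ler0_norm.
    rewrite opprB; apply: le_trans h2 _; rewrite subr0 real_normK ?num_real//.
    by rewrite (ger0_norm cp) ler_norm.
  by rewrite subr_le0 phi_le// lerD2l lerN2.
have /andP[h1 h2] := phi_translate_le x (lexx `|c|) n0 (ltW cn).
rewrite ger0_norm.
  by apply: le_trans h2 _; rewrite sub0r real_normK ?num_real// (ltr0_norm cn) ler_norm.
by rewrite subr_ge0 phi_le// lerD2l lerN2 ltW.
Qed.

End translates.

(** * Attainment of the initial trapping through the Fourier side *)

Section initial_time.
Context {R : realType}.
Implicit Types (f g p c s : R -> R) (x t r xi a : R).
Local Notation mu := (@lebesgue_measure R).

Lemma sqnorm_trunc_tail N g : sqint g -> sqnorm g = sqnorm (trunc N g) + tail N g.
Proof.
move=> sg; rewrite /tail /sqnorm -RintD; last 2 first.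
- exact: (sqint_trunc N sg).2.
- exact: (sqint_tail N sg).2.
by apply: eq_Rint => x; rewrite truncE; case: ifP => _; ring.
Qed.

Lemma continuous_posp g : continuous g -> continuous (posp g).
Proof.
move=> cg x; apply: (@continuous_max _ _ g (cst 0)); first exact: cg.
exact: cst_continuous.
Qed.

(* Testing [f = v - v0] against the truncation of [(v - k)^+], a continuous
   function with compact support, makes the bound independent of [N]. *)
Lemma sqnorm_posp_le (sg : R) f c s q q0 : `|sg| = 1 -> ft f c s -> sqint q ->
  continuous q -> (forall x, q x = sg * f x + q0 x) -> {ae mu, forall x, q0 x <= 0} ->
  2 * pi * sqnorm (posp q) <= (Num.sqrt (sqnorm c) + Num.sqrt (sqnorm s)) ^+ 2.
Proof.
move=> sg1 fcs sq cq qE q0le; have [sf _ _ _ _] := fcs.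
have pi0 : 0 < 2 * pi :> R by rewrite mulr_gt0// pi_gt0.
have sp := sqint_posp sq; have cp := continuous_posp cq.
set B := Num.sqrt (sqnorm c) + _.
have B0 : 0 <= B by rewrite addr_ge0// sqrtr_ge0.
have key N : 0 <= N -> 2 * pi * sqnorm (trunc N (posp q)) <= B ^+ 2.
  move=> N0; have sN := sqint_trunc N sp.
  have := fourier_duality_bound fcs cp N0.
  (* Where [posp q] is positive, [q <= sg * f] because [q0 <= 0]; so the square of [posp q] is
     bounded by its product with [sg * f]. *)
  have h : sqnorm (trunc N (posp q)) <= `|\int[mu]_z (f z * trunc N (posp q) z)|.
    rewrite -[leRHS]mul1r -sg1 -normrM -(RintZ _ (sqintM sf sN)).
    apply: (le_trans _ (ler_norm _)).
    have i1 := intgZ sg (sqintM sf sN); have i2 := sqintM sq sN.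
    have -> : sqnorm (trunc N (posp q)) = \int[mu]_x (q x * trunc N (posp q) x).
      apply: eq_Rint => x; rewrite truncE; case: ifP => _; last by rewrite mulr0 expr0n.
      by rewrite mulrC posp_mul.
    rewrite -subr_ge0 -RintB//.
    (* As [q0 <= 0] holds only almost everywhere, the integrand is replaced by its absolute value,
       to which it is almost everywhere equal. *)
    have -> : \int[mu]_x (sg * (f x * trunc N (posp q) x) - q x * trunc N (posp q) x) =
      \int[mu]_x `|sg * (f x * trunc N (posp q) x) - q x * trunc N (posp q) x|.
      apply: ae_Rintegral; have [M [mM M0 hM]] := q0le; exists M; split => // x /= nx.
      apply: hM => /= q0x; apply: nx; rewrite mulrA -mulrBl qE opprD addrA subrr sub0r.
      rewrite ger0_norm// mulr_ge0 ?oppr_ge0// truncE; case: ifP => // _.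
      exact: posp_ge0.
    exact: integral_ge0_real.
  set S := sqnorm (trunc N (posp q)) in h *; have S0 : 0 <= S by exact: sqnorm_ge0.
  move=> /(le_trans (ler_wpM2l (ltW pi0) h)).
  have : 0 <= 2 * pi * S by rewrite mulr_ge0// ltW.
  (* With [Y] the square root of [2 * pi * S], the bound reads [Y^2 <= Y * B], whence
     [Y^2 <= B^2]. *)
  move: (2 * pi * S) => X X0; have := sqrtr_ge0 X; rewrite -{2 4}(sqr_sqrtr X0).
  move: (Num.sqrt X) => Y Y0; rewrite expr2; clear -Y0 B0.
  move: Y0; rewrite le_eqVlt => /orP[/eqP <-|Y0]; first by rewrite !mul0r sqr_ge0.
  by rewrite ler_pM2l// => YB; rewrite expr2 ler_pM// ltW.
apply: (@cvg_ger _ nat \oo _ (fun n => B ^+ 2 + 2 * pi * tail n%:R (posp q))).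
  rewrite [X in _ --> X](_ : _ = B ^+ 2 + 2 * pi * 0); last by rewrite mulr0 addr0.
  apply: cvgD; first exact: cvg_cst.
  by apply: cvgM; [exact: cvg_cst|exact: cvg_tail].
apply: nearW => n; rewrite (sqnorm_trunc_tail n%:R sp) mulrDr lerD2r.
exact: key.
Qed.

Lemma sqnorm_le_sobolev_norm f c s : ae_equal (fourier f).1 c ->
  ae_equal (fourier f).2 s -> sqint c -> sqint s ->
  (sobolev_norm 2^-1 f < +oo)%E -> exists S : R,
  [/\ sobolev_norm 2^-1 f = S%:E, Num.sqrt (sqnorm c) <= S & Num.sqrt (sqnorm s) <= S].
Proof.
move=> fc fs sc ss; rewrite (sobolev_normE _ fc fs) => nf.
have mm := meas_sobolev_integrand 2^-1 sc.1 ss.1.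
have sm := L2norm_lty_sqint mm nf.
have w1 xi : 1 <= (1 + xi ^+ 2) `^ (2^-1 / 2).
  rewrite -[leLHS](powRr0 (1 + xi ^+ 2)); apply: ler_powR.
    by rewrite lerDl sqr_ge0.
  by rewrite divr_ge0.
eexists; split; first exact: L2norm_sqint.
  apply: ler_wsqrtr; apply: le_sqnorm => // xi.
  rewrite normrM (ger0_norm (sqrtr_ge0 _)) -[leLHS]mul1r ler_pM//.
    by rewrite (le_trans (w1 xi))// ler_norm.
  exact: norm_le_modulus.
apply: ler_wsqrtr; apply: le_sqnorm => // xi.
rewrite normrM (ger0_norm (sqrtr_ge0 _)) -[leLHS]mul1r ler_pM//.
  by rewrite (le_trans (w1 xi))// ler_norm.
exact: norm_le_modulusr.
Qed.

(** The excess at time [t] is [sg * (v t - v 0)] plus an almost everywhere nonpositive function, so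
    [sqnorm_posp_le] bounds its positive part by the transform of [v t - v 0]. The Sobolev weight is
    at least 1, so the norm of order 1/2 dominates that transform in L2. *)
Lemma initial_excess (u0 : R -> R) (u : R -> R -> R) (sg : R) a :
  is_solution u0 u -> sg = 1 \/ sg = -1 ->
  (forall x, sg * (u0 x - phi (x - a)) <= 0) ->
  sqnorm (posp (fun x => sg * ((u t \- phi) x - layer_shift a x))) @[t --> 0^'+] --> 0.
Proof.
move=> us sgE u0a; have [g [cv sv _ _ _]] := solution_weak_flow us.
have [uc _ ui _ _] := us; pose v (t : R) : R -> R := u t \- phi.
have at0 : `[0, +oo[%classic (0 : R) by rewrite /= in_itv/= lexx.
have [[/square_integrableP[w sw vw] _] lim] := uc 0 at0.
have sg1 : `|sg| = 1 by case: sgE => ->; rewrite ?normrN normr1.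
have sq t : 0 < t -> sqint (fun x => sg * (v t x - layer_shift a x)).
  by move=> t0; apply: sqintZ; apply: sqintB; [exact: sv|exact: sqint_layer_shift].
have cq t : 0 < t -> continuous (fun x => sg * (v t x - layer_shift a x)).
  move=> t0 x; apply: cvgM; first exact: cvg_cst.
  by apply: cvgB; [exact: cv|exact: continuous_layer_shift].
have q0le : {ae mu, forall x, sg * (w x - layer_shift a x) <= 0}.
  have wu := ae_equal_trans (ae_equal_sym vw) ui.
  have [M [mM M0 hM]] := wu; exists M; split => // x /= nx; apply: hM => /= wx.
  apply: nx; rewrite wx /layer_shift.
  suff -> : sg * ((u0 \- phi) x - (phi (x - a) - phi x)) = sg * (u0 x - phi (x - a)) by [].
  by rewrite /=; ring.
have bound t (e : R) : 0 < t -> (sobolev_norm 2^-1 (v t \- v 0)%R < e%:E)%E ->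
    sqnorm (posp (fun x => sg * (v t x - layer_shift a x))) <= e ^+ 2.
  move=> t0 lte.
  have fg : ae_equal (v t \- v 0) (fun x => v t x - w x).
    exact: (ae_equal2 (fun x y => x - y) (ae_equal_refl (v t)) vw).
  have sf := sqintB (sv t t0) sw.
  have [c [s [fcs fc fs]]] := fourier_rep sf fg.
  have [_ sc ss _ _] := fcs.
  have [|S [SE cS sS]] := sqnorm_le_sobolev_norm fc fs sc ss.
    by apply: lt_trans lte _; rewrite ltry.
  rewrite SE lte_fin in lte.
  have qE x : sg * (v t x - layer_shift a x) =
      sg * (v t x - w x) + sg * (w x - layer_shift a x) by ring.
  have := sqnorm_posp_le sg1 fcs (sq t t0) (cq t t0) qE q0le.
  have := sqnorm_ge0 (posp (fun x => sg * (v t x - layer_shift a x))).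
  move: (sqnorm (posp _)) => X X0 XB; have p2 := @pi_ge2 R.
  have := sqrtr_ge0 (sqnorm c); have := sqrtr_ge0 (sqnorm s).
  move: cS sS XB; move: (Num.sqrt (sqnorm c)) (Num.sqrt (sqnorm s)) => A B AS BS XB B0 A0.
  (* The factor 4 gained here is compensated by [2 * pi >= 4]. *)
  have AB : (A + B) ^+ 2 <= (2 * e) ^+ 2.
    rewrite lerXn2r ?nnegrE; [|lra|lra|lra] => //.
  have h4 : 4 * X <= 2 * pi * X by rewrite ler_wpM2r//; lra.
  by move: h4 AB XB; rewrite exprMn; clear; lra.
apply/cvgr0Pnorm_lt => e e0.
have se0 : 0 < Num.sqrt e / 2 by rewrite divr_gt0// sqrtr_gt0.
have hn : \forall r \near within `[0, +oo[ (nbhs (0 : R)),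
    (sobolev_norm 2^-1 (v r \- v 0)%R < (Num.sqrt e / 2)%:E)%E.
  have l0 : \forall y \near (0 : \bar R)%E, (y < (Num.sqrt e / 2)%:E)%E.
    have se0E : ((0 : R)%:E < (Num.sqrt e / 2)%:E)%E by rewrite lte_fin.
    exact: lt_nbhsl.
  exact: (lim _ l0).
near=> t; have t0 : 0 < t by near: t; exact: nbhs_right_gt.
rewrite ger0_norm ?sqnorm_ge0//.
apply: (le_lt_trans (bound t (Num.sqrt e / 2) t0 _)).
  have : `[0, +oo[%classic t -> (sobolev_norm 2^-1 (v t \- v 0)%R < (Num.sqrt e / 2)%:E)%E.
    by near: t; apply: cvg_within; exact: hn.
  by apply; rewrite /= in_itv/= ltW.
rewrite exprMn sqr_sqrtr ?(ltW e0)//; move: e0; clear; lra.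
Unshelve. all: by end_near. Qed.

End initial_time.

(** * Time derivatives of pairings and of the energy of a positive part *)

Section energy_derivatives.
Context {R : realType}.
Implicit Types (D k : R -> R) (Q : R -> R -> R) (a b h t x l : R).
Local Notation mu := (@lebesgue_measure R).

Lemma is_derive_squeeze (F B : R -> R) t l :
  (\forall h \near 0^', `|h^-1 * (F (t + h) - F t) - l| <= B h) ->
  B h @[h --> 0^'] --> 0 -> is_derive t 1 F l.
Proof.
move=> FB B0.
have q : h^-1 *: ((F \o shift t) (h *: 1) - F t) @[h --> 0^'] --> l.
  apply/subr_cvg0; apply: norm_cvg0.
  apply: (@squeeze_cvgr _ _ _ _ (cst 0) B); [|exact: cvg_cst|exact: B0].
  near=> h; rewrite normr_ge0/= /GRing.scale/= mulr1 [h + t]addrC.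
  by near: h; exact: FB.
by apply: DeriveDef; [apply/cvg_ex; exists l|exact: cvg_lim q].
Unshelve. all: by end_near. Qed.

Lemma gronwall_le (F dF : R -> R) (c : R) a b : a <= b ->
  (forall t, a <= t <= b -> is_derive t 1 F (dF t)) ->
  (forall t, a <= t <= b -> dF t <= c * F t) ->
  F b <= expR (c * (b - a)) * F a.
Proof.
move=> ab dFP dFle; pose G t := expR (- (c * t)) * F t.
have dG t : a <= t <= b -> is_derive t 1 G (expR (- (c * t)) * (dF t - c * F t)).
  move=> tab; have dFt := dFP t tab; rewrite /G; apply: is_derive_eq.
  by rewrite /GRing.scale/=; ring.
have itvE t : t \in `[a, b] -> a <= t <= b by rewrite in_itv.
have itvoE t : t \in `]a, b[ -> a <= t <= b.
  by rewrite in_itv/= => /andP[? ?]; rewrite !ltW.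
have : G b <= G a.
  apply: (@ler0_derive1_nincr _ G a b) => //.
  - by move=> t /itvoE/dG[].
  - move=> t /itvoE tab; have d := dG t tab; rewrite derive1E derive_val.
    by rewrite pmulr_rle0 ?expR_gt0// subr_le0 dFle.
  - apply: derivable_within_continuous => t /itvE/dG[]//.
rewrite /G => Gba.
move: Gba => /(ler_wpM2l (expR_ge0 (c * b))).
by rewrite !mulrA -!expRD subrr expR0 mul1r mulrBr.
Qed.

(** Integrability is asked near [t] only, since a weak flow is controlled at positive times
    alone. *)
Definition L2_derivative Q t D := [/\ \forall h \near 0^', sqint (Q (t + h)),
  sqint (Q t), sqint D &
  sqnorm (fun x => h^-1 * (Q (t + h) x - Q t x) - D x) @[h --> 0^'] --> 0].

Lemma is_derive_pairing Q t D k : L2_derivative Q t D -> sqint k ->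
  is_derive t 1 (fun s => \int[mu]_x (Q s x * k x)) (\int[mu]_x (D x * k x)).
Proof.
move=> [sQ sQt sD QD] sk.
pose r h x := h^-1 * (Q (t + h) x - Q t x) - D x.
apply: (@is_derive_squeeze _ (fun h => Num.sqrt (sqnorm (r h)) * Num.sqrt (sqnorm k))).
  near=> h; have sQh : sqint (Q (t + h)) by near: h.
  have sr : sqint (r h) by apply: sqintB => //; apply: sqintZ; exact: sqintB.
  have := cauchy_schwarz_sqrt sr sk; congr (`|_| <= _).
  rewrite -RintB; [|exact: sqintM|exact: sqintM].
  rewrite -RintZ; last by apply: intgB; exact: sqintM.
  rewrite -RintB; [|by apply: intgZ; apply: intgB; exact: sqintM|exact: sqintM].
  by apply: eq_Rint => x; rewrite /r; ring.
rewrite -[X in _ --> X](mul0r (Num.sqrt (sqnorm k))).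
apply: cvgM; last exact: cvg_cst.
rewrite -[X in _ --> X](@sqrtr0 R).
exact: (cvg_comp _ _ QD (@sqrt_continuous R 0)).
Unshelve. all: by end_near. Qed.

(** The square of the positive part has derivative [2 * max s 0], which is 2-Lipschitz; hence a
    Taylor remainder of second order despite the kink of the positive part. *)
Lemma posp_sqr_diff (s d : R) :
  `|Num.max (s + d) 0 ^+ 2 - Num.max s 0 ^+ 2 - 2 * Num.max s 0 * d| <= d ^+ 2.
Proof.
have := sqr_ge0 d; rewrite ler_norml.
case: (leP (s + d) 0) => h1; case: (leP s 0) => h2 h3; apply/andP; split.
all: nra.
Qed.

Lemma is_derive_sqnorm_posp Q t D : L2_derivative Q t D ->
  is_derive t 1 (fun s => sqnorm (posp (Q s))) (2 * \int[mu]_x (posp (Q t) x * D x)).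
Proof.
move=> [sQ sQt sD QD]; have sp := sqint_posp sQt.
pose r h x := h^-1 * (Q (t + h) x - Q t x) - D x.
apply: (@is_derive_squeeze _ (fun h => 2 * (Num.sqrt (sqnorm (posp (Q t))) *
  Num.sqrt (sqnorm (r h))) + `|h| * (2 * sqnorm D + 2 * sqnorm (r h)))).
  near=> h; have sQh : sqint (Q (t + h)) by near: h.
  have h0 : h != 0 by near: h; exact: nbhs_dnbhs_neq.
  have sr : sqint (r h) by apply: sqintB => //; apply: sqintZ; exact: sqintB.
  have sph := sqint_posp sQh.
  have sDr := sqintD sD sr.
  (* [A] is the error of the difference quotient in the linear term, [C] the Taylor remainder
     divided by [h], at most [|h| * (D + r h)^2]. *)
  pose A x := 2 * (posp (Q t) x * r h x).
  pose C x := h^-1 * (posp (Q (t + h)) x ^+ 2 - posp (Q t) x ^+ 2) - 2 * (posp (Q t) x * (D x + r h x)).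
  have iA : intg A by apply: intgZ; exact: sqintM.
  have iC : intg C.
    apply: intgB; last by apply: intgZ; exact: sqintM.
    by apply: intgZ; apply: intgB; [exact: sph.2|exact: sp.2].
  have -> : h^-1 * (sqnorm (posp (Q (t + h))) - sqnorm (posp (Q t))) -
      2 * \int[mu]_x (posp (Q t) x * D x) = \int[mu]_x A x + \int[mu]_x C x.
    rewrite /sqnorm -(RintB sph.2 sp.2) -(RintZ _ (intgB sph.2 sp.2)).
    rewrite -(RintZ _ (sqintM sp sD)) -(RintB (intgZ _ (intgB sph.2 sp.2)) (intgZ _ (sqintM sp sD))).
    by rewrite -(RintD iA iC); apply: eq_Rint => x; rewrite /A /C; ring.
  apply: (le_trans (ler_normD _ _)); apply: lerD.
    rewrite /A (RintZ _ (sqintM sp sr)) normrM (ger0_norm (_ : 0 <= 2))//.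
    by apply: ler_wpM2l => //; exact: cauchy_schwarz_sqrt.
  apply: (@le_trans _ _ (`|h| * sqnorm (fun x => D x + r h x))); last first.
    by apply: ler_wpM2l => //; exact: sqnormD_le.
  rewrite /sqnorm -(RintZ _ sDr.2); apply: (ler_normr_integral iC).
    exact: (intgZ _ sDr.2).
  move=> x; have := posp_sqr_diff (Q t x) (h * (D x + r h x)).
  have -> : Q t x + h * (D x + r h x) = Q (t + h) x by rewrite /r; field.
  rewrite -(ler_pM2l (_ : 0 < `|h^-1|)); last by rewrite normr_gt0 invr_eq0.
  rewrite -normrM => /le_trans hh.
  have -> : C x = h^-1 * (Num.max (Q (t + h) x) 0 ^+ 2 - Num.max (Q t x) 0 ^+ 2 -
     2 * Num.max (Q t x) 0 * (h * (D x + r h x))).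
    by rewrite /C /posp; field.
  apply: hh; rewrite exprMn -(real_normK (num_real h)) normfV expr2 -!mulrA mulKf//.
  by rewrite normr_eq0.
rewrite [X in _ --> X](_ : _ = 2 * (Num.sqrt (sqnorm (posp (Q t))) * 0) + `|0 : R| * (2 * sqnorm D + 2 * 0)); last first.
  by rewrite normr0 mul0r !mulr0 addr0.
apply: cvgD.
  apply: cvgM; first exact: cvg_cst.
  apply: cvgM; first exact: cvg_cst.
  rewrite -[X in _ --> X](@sqrtr0 R).
  exact: (cvg_comp _ _ QD (@sqrt_continuous R 0)).
apply: cvgM.
  have n0 : `|h| @[h --> (0 : R)] --> `|0 : R| by exact: norm_continuous.
  exact: (cvg_trans (cvg_app _ (@nbhs_dnbhs _ _)) n0).
by apply: cvgD; [exact: cvg_cst|apply: cvgM; [exact: cvg_cst|exact: QD]].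
Unshelve. all: by end_near. Qed.

End energy_derivatives.

(** * Half-Laplacians tested against L2, and translates of the layer *)

Section weak_laplacian.
Context {R : realType}.
Implicit Types (f g p q h L : R -> R) (a b c e s r x y : R).
Local Notation mu := (@lebesgue_measure R).

Lemma dpotential_lipschitz s r : `|dpotential s - dpotential r : R| <= `|s - r|.
Proof.
have pi0 := @pi_gt0 R.
have d x : is_derive x 1 (@dpotential R) (- cos (pi * x)).
  have -> : @dpotential R = (fun x => - (pi^-1 * sin (pi * x))).
    by apply/funext => y; rewrite /dpotential mulrC.
  apply: is_derive_eq; rewrite /GRing.scale/= mulr1.
  by move: pi0 (cos _); move: (pi : R) => p p0 k; field; rewrite gt_eqF.
rewrite -[leRHS]mul1r; apply: (lipschitz_derive d) => x.
by rewrite normrN cos_max.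
Qed.

Lemma sconv_linear e a b f g x : 0 < e -> sqint f -> sqint g ->
  sconv e (fun x => a * f x + b * g x) x = a * sconv e f x + b * sconv e g x.
Proof.
move=> e0 sf sg; have sk := sqint_sker_reflect x e0.
rewrite /sconv -(RintZ a (sqintM sf sk)) -(RintZ b (sqintM sg sk)).
rewrite -RintD; [|exact: intgZ (sqintM sf sk)|exact: intgZ (sqintM sg sk)].
by apply: eq_Rint => y; ring.
Qed.

Lemma trunc_lap_linear e a b f g x : 0 < e -> sqint f -> sqint g ->
  trunc_lap e (fun x => a * f x + b * g x) x = a * trunc_lap e f x + b * trunc_lap e g x.
Proof.
move=> e0 sf sg; have sfg := sqintD (sqintZ a sf) (sqintZ b sg).
by rewrite !trunc_lapE// sconv_linear//; ring.
Qed.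

Definition weak_lap f L := forall p, sqint p ->
  \int[mu]_x (p x * trunc_lap n.+1%:R^-1 f x) @[n --> \oo] --> \int[mu]_x (p x * L x).

Lemma weak_lap_linear a b f g L K : sqint f -> sqint g -> sqint L -> sqint K ->
  weak_lap f L -> weak_lap g K ->
  weak_lap (fun x => a * f x + b * g x) (fun x => a * L x + b * K x).
Proof.
move=> sf sg sL sK fL gK p sp.
have -> : \int[mu]_x (p x * (a * L x + b * K x)) =
    a * \int[mu]_x (p x * L x) + b * \int[mu]_x (p x * K x).
  rewrite -(RintZ a (sqintM sp sL)) -(RintZ b (sqintM sp sK)).
  rewrite -RintD; [|exact: intgZ (sqintM sp sL)|exact: intgZ (sqintM sp sK)].
  by apply: eq_Rint => x; ring.
have E n : \int[mu]_x (p x * trunc_lap n.+1%:R^-1 (fun x => a * f x + b * g x) x) =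
    a * \int[mu]_x (p x * trunc_lap n.+1%:R^-1 f x) +
    b * \int[mu]_x (p x * trunc_lap n.+1%:R^-1 g x).
  have n0 : 0 < n.+1%:R^-1 :> R by rewrite invr_gt0.
  have [i1 _] := trunc_lap_pairing n0 sp sf; have [i2 _] := trunc_lap_pairing n0 sp sg.
  rewrite -(RintZ a i1) -(RintZ b i2) -RintD; [|exact: intgZ|exact: intgZ].
  by apply: eq_Rint => x; rewrite trunc_lap_linear//; ring.
under eq_cvg do rewrite E.
apply: cvgD; (apply: cvgM; first exact: cvg_cst); [exact: fL|exact: gK].
Qed.

(** Symmetry is exact for each truncated operator and passes to the limit. It moves the operator
    from the excess to [bump] in [deficit_le]. *)
Lemma weak_lap_symm f L g K : sqint f -> sqint g -> weak_lap f L -> weak_lap g K ->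
  \int[mu]_x (g x * L x) = \int[mu]_x (f x * K x).
Proof.
move=> sf sg fL gK; apply: (cvg_eqr (fL g sg) (gK f sf)) => n /=.
by apply: trunc_lap_symm => //; rewrite invr_gt0.
Qed.

Lemma trunc_lap_translate e c x : 0 < e ->
  trunc_lap e (fun x => phi (x - c)) x = trunc_lap e phi (x - c).
Proof.
move=> e0; rewrite /trunc_lap; congr (_ * _).
have i : intg (fun y => (phi (x - c) - phi y) * sker e (x - c - y)).
  have := intg_shift (- (x - c)) (intg_phi_sker (x - c) e0).
  apply: eq_intg => y; have -> : x - c + (y - (x - c)) = y by ring.
  by congr (_ * _); rewrite -skerN opprB.
rewrite -[RHS](integral_shift (- c) i); apply: eq_Rint => y.
by congr (_ * sker _ _); ring.
Qed.

Lemma intg_layer_sker e c x : 0 < e ->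
  intg (fun y => (phi (x - c) - phi (y - c)) * sker e (x - y)).
Proof.
move=> e0.
have := intg_shift (- x) (intg_phi_sker (x - c) e0).
apply: eq_intg => y; have -> : x - c + (y - x) = y - c by ring.
by congr (_ * _); rewrite -skerN opprB.
Qed.

Lemma trunc_lap_layer_shift e c x : 0 < e ->
  trunc_lap e (layer_shift c) x = trunc_lap e phi (x - c) - trunc_lap e phi x.
Proof.
move=> e0; rewrite -trunc_lap_translate// /trunc_lap -mulrBr; congr (_ * _).
have i0 : intg (fun y => (phi x - phi y) * sker e (x - y)).
  by apply: eq_intg (intg_layer_sker 0 x e0) => y; rewrite !subr0.
rewrite -(RintB (intg_layer_sker c x e0) i0).
by apply: eq_Rint => y; rewrite /layer_shift; ring.
Qed.

Definition layer_reaction c x : R := dpotential (phi x) - dpotential (phi (x - c)).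

Lemma sqint_layer_reaction c : sqint (layer_reaction c).
Proof.
apply: (sqint_le _ _ (sqint_layer_shift c)).
  apply: meas_continuous => x; apply: cvgB.
    exact: (cvg_comp _ _ (@continuous_phi R x) (@continuous_dpotential R (phi x))).
  exact: (cvg_comp _ _ (@continuous_translate R c x) (@continuous_dpotential R (phi (x - c)))).
by move=> x; rewrite /layer_shift distrC; exact: dpotential_lipschitz.
Qed.

(** Both [phi] and its translate satisfy the layer equation up to [O(e)] times [cauchy] or its
    translate, an error that vanishes when paired with an L2 function. *)
Lemma weak_lap_layer_shift c : weak_lap (layer_shift c) (layer_reaction c).
Proof.
move=> p sp; have [C [C0 hC]] := @trunc_lap_phi_bound R.
have sc : sqint (fun x => cauchy x + cauchy (x - c)).
  apply: sqintD; first exact: sqint_cauchy.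
  have [_ i2] := @sqint_cauchy R; split; last exact: (intg_shift (- c) i2).
  have mt : measurable_fun [set: R] (fun x => x - c) by exact: measurable_funB.
  exact: (measurableT_comp (@sqint_cauchy R).1 mt).
have sr := sqint_layer_reaction c; have ss := sqint_layer_shift c.
pose I := \int[mu]_x (`|p x| * (cauchy x + cauchy (x - c))).
apply/subr_cvg0; apply: norm_cvg0.
apply: (@squeeze_cvgr _ _ _ _ (cst 0) (fun n => C * I * n.+1%:R^-1)); last 2 first.
- exact: cvg_cst.
- rewrite -[X in _ --> X](mulr0 (C * I)); apply: cvgM; first exact: cvg_cst.
  exact: cvg_harmonic.
apply: nearW => n; rewrite normr_ge0/=.
have n0 : 0 < n.+1%:R^-1 :> R by rewrite invr_gt0.
have n1 : 0 < (n.+1%:R^-1 : R) <= 1 by apply/andP; split=> //; rewrite invf_le1// ler1n.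
have [i1 _] := trunc_lap_pairing n0 sp ss.
have iI := intgZ (C * n.+1%:R^-1) (sqintM (sqint_norm sp) sc).
rewrite -(RintB i1 (sqintM sp sr)).
have -> : C * I * n.+1%:R^-1 = (C * n.+1%:R^-1) * I by ring.
rewrite -(RintZ (C * n.+1%:R^-1) (sqintM (sqint_norm sp) sc)).
apply: ler_normr_integral => //; first exact: (intgB i1 (sqintM sp sr)).
move=> x; rewrite -mulrBr normrM mulrCA; apply: ler_wpM2l => //.
rewrite trunc_lap_layer_shift// /layer_reaction mulrDr.
have h1 := hC _ x n1; have h2 := hC _ (x - c) n1.
set A := trunc_lap _ _ x in h1 *; set B := trunc_lap _ _ (x - c) in h2 *.
rewrite [X in `|X|](_ : _ = (B + dpotential (phi (x - c))) - (A + dpotential (phi x))).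
  by rewrite [leRHS]addrC (le_trans (ler_normB _ _))// lerD.
by ring.
Qed.

Lemma indic_poisker e z : 0 < e -> `|z| <= e -> 1 <= e * poisker e z.
Proof.
move=> e0 ze; have z2 : z ^+ 2 <= e ^+ 2.
  by rewrite -(real_normK (num_real z)) lerXn2r// nnegrE ltW.
rewrite /poisker mulrA ler_pdivlMr ?mul1r; last first.
  by rewrite ltr_wpDr ?sqr_ge0// exprn_gt0.
by move: z2; rewrite mulrCA -expr2; lra.
Qed.

(** Without truncation the bound is [(x - y)^2 <= 2 * (1 + x^2) * (1 + y^2)]. For [|x - y| <= e] the
    kernel is 0; there the Poisson factor makes the left-hand side nonpositive, and its mass
    [2 * pi * e] disappears in the limit. *)
Lemma sker_lower_bound e x y : 0 < e ->
  2^-1 * cauchy x * cauchy y * (1 - e * poisker e (x - y)) <= sker e (x - y).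
Proof.
move=> e0; have cx := cauchy_gt0 x; have cy := cauchy_gt0 y.
have c0 : 0 <= 2^-1 * cauchy x * cauchy y by rewrite !mulr_ge0// ltW.
rewrite /sker; case: ltP => [exy|xye]; last first.
  by rewrite mulr_ge0_le0// subr_le0; exact: indic_poisker.
apply: (@le_trans _ _ (2^-1 * cauchy x * cauchy y)).
  rewrite -[leRHS]mulr1 ler_wpM2l// gerBl mulr_ge0 ?(ltW e0)//.
  exact: poisker_ge0.
have xy0 : 0 < (x - y) ^+ 2.
  by rewrite exprn_even_gt0//= -normr_gt0 (lt_trans e0).
rewrite /cauchy -!invfM lef_pV2 ?posrE//; last by rewrite !mulr_gt0// cauchy_den.
have := sqr_ge0 (x + y); have := sqr_ge0 (x * y); rewrite exprMn sqrrB sqrrD.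
by move: (x ^+ 2) (y ^+ 2) (x * y) ; clear => X Y Z XY h; lra.
Qed.

End weak_laplacian.

(** * Comparison with barriers *)

Section barrier.
Context {R : realType}.
Implicit Types (f g p q h L : R -> R) (a al b c e k sg x y : R).
Local Notation mu := (@lebesgue_measure R).

Lemma cauchy_le1 x : cauchy x <= 1.
Proof. by rewrite invf_le1 ?cauchy_den// lerDl sqr_ge0. Qed.

(** The bound [B] serves to estimate the Poisson correction by [e * B * 2 * pi], uniformly in [x];
    it drops out as [e] tends to 0. *)
Lemma sconv_negp_ge q e B x : 0 < e -> sqint q -> (forall x, `|q x| <= B) ->
  2^-1 * cauchy x * (\int[mu]_y (negp q y * cauchy y) - e * (B * (2 * pi))) <=
  sconv e (negp q) x.
Proof.
move=> e0 sq qB; have sn := sqint_negp sq; have sc := @sqint_cauchy R.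
have inc := sqintM sn sc.
have n0 := negp_ge0 q.
have nB y : `|negp q y| <= B by exact: le_trans (negp_le q y) (qB y).
have iP := intg_reflect x (intg_poisker e0).
have P0 y : 0 <= poisker e (x - y) by exact: poisker_ge0.
have c0 y : 0 <= cauchy y by rewrite ltW// cauchy_gt0.
have ncB y : `|negp q y * cauchy y| <= B.
  rewrite normrM -[leRHS]mulr1 ler_pM//.
  by rewrite (ger0_norm (c0 y)) cauchy_le1.
have inP : intg (fun y => poisker e (x - y) * (negp q y * cauchy y)).
  exact: (intgM_bounded iP (intg_meas inc) ncB).
have lP : \int[mu]_y (poisker e (x - y) * (negp q y * cauchy y)) <= B * (2 * pi).
  rewrite -(integral_poisker e0) -(integral_reflect x (intg_poisker e0)) -(RintZ B iP).
  apply: le_integral_intg => //; first exact: intgZ.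
  move=> y; rewrite mulrC; apply: ler_wpM2r => //.
  exact: le_trans (ler_norm _) (ncB y).
apply: (@le_trans _ _ (2^-1 * cauchy x * (\int[mu]_y (negp q y * cauchy y) -
    e * \int[mu]_y (poisker e (x - y) * (negp q y * cauchy y))))).
  apply: ler_wpM2l; first by rewrite mulr_ge0.
  by rewrite lerD2l lerN2 ler_wpM2l// ltW.
rewrite -(RintZ e inP) -(RintB inc (intgZ e inP)).
rewrite -(RintZ _ (intgB inc (intgZ e inP))).
apply: le_integral_intg; [exact: intgZ (intgB inc (intgZ e inP))| |move=> y].
  by apply: sqintM => //; exact: sqint_sker_reflect.
have := ler_wpM2l (n0 y) (sker_lower_bound x y e0).
by apply: le_trans; rewrite le_eqVlt; apply/orP; left; apply/eqP; ring.
Qed.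

(* The Dirichlet form of [q] pairs [q^+] with [q^-] through the kernel
   [(x - y)^-2], which is at least [cauchy x * cauchy y / 2]. *)
Lemma weak_lap_posp_ge q L B : sqint q -> sqint L -> weak_lap q L ->
  (forall x, `|q x| <= B) ->
  (2 * pi)^-1 * (\int[mu]_x (posp q x * cauchy x) * \int[mu]_x (negp q x * cauchy x)) <=
  \int[mu]_x (posp q x * L x).
Proof.
move=> sq sL qL qB; have sp := sqint_posp sq; have pi0 := @pi_gt0 R.
have sc := @sqint_cauchy R; set P := \int[mu]_x _; set J := \int[mu]_x _.
have P0 : 0 <= P.
  by apply: integral_ge0_real => x; rewrite mulr_ge0 ?posp_ge0// ltW// cauchy_gt0.
have lim : (2 * pi)^-1 * (P * (J - n.+1%:R^-1 * (B * (2 * pi)))) @[n --> \oo] -->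
    (2 * pi)^-1 * (P * (J - 0 * (B * (2 * pi)))).
  apply: cvgM; first exact: cvg_cst.
  apply: cvgM; first exact: cvg_cst.
  apply: cvgB; first exact: cvg_cst.
  by apply: cvgM; [exact: cvg_harmonic|exact: cvg_cst].
rewrite mul0r subr0 in lim; apply: (ler_cvg_to lim (qL _ sp)).
apply: nearW => n; have n0 : 0 < n.+1%:R^-1 :> R by rewrite invr_gt0.
apply: le_trans (trunc_lap_posp n0 sq); rewrite invfM (mulrC _ pi^-1) -mulrA.
apply: ler_wpM2l; first by rewrite invr_ge0 ltW.
set K := J - _; have iP := sqintM sp sc.
have -> : 2^-1 * (P * K) = (2^-1 * K) * P by ring.
rewrite /P -(RintZ (2^-1 * K) iP); apply: le_integral_intg; first exact: intgZ.
  by have [] := sconv_symm n0 sp (sqint_negp sq).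
move=> x; have := ler_wpM2l (posp_ge0 q x) (sconv_negp_ge x n0 sq qB).
by apply: le_trans; rewrite le_eqVlt; apply/orP; left; apply/eqP; rewrite /K/J; ring.
Qed.

Lemma weak_lap_posp_ge0 q L : sqint q -> weak_lap q L ->
  0 <= \int[mu]_x (posp q x * L x).
Proof.
move=> sq qL; apply: (cvg_ger (qL _ (sqint_posp sq))); apply: nearW => n.
have n0 : 0 < n.+1%:R^-1 :> R by rewrite invr_gt0.
apply: le_trans (trunc_lap_posp n0 sq).
rewrite mulr_ge0 ?invr_ge0 ?pi_ge0//; apply: integral_ge0_real => x.
rewrite mulr_ge0 ?posp_ge0//; apply: integral_ge0_real => y.
by rewrite mulr_ge0 ?negp_ge0 ?sker_ge0.
Qed.

(** Comparable to [cauchy], and a difference of translates of the layer: its half-Laplacian is a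
    difference of values of [dpotential], hence bounded by [bump] itself. It serves both as weight
    for the masses and as shape of the barrier. *)
Definition bump x : R := phi (x + 1) - phi (x - 1).

Lemma bumpE x : bump x = 1 * layer_shift (-1) x + (-1) * layer_shift 1 x.
Proof. by rewrite /bump /layer_shift opprK; ring. Qed.

Lemma bump_bounds x : (pi)^-1 * cauchy x <= bump x <= 16 / pi * cauchy x.
Proof.
have h1 : `|-1 : R| <= 1 by rewrite normrN1.
have h2 : `|1 : R| <= 1 by rewrite normr1.
have h3 : (-1 : R) <= 1 by lra.
have pi0 := @pi_gt0 R.
have := phi_translate_le x h1 h2 h3; rewrite opprK expr1n /bump.
have -> : (1 + 1) * (pi * (1 + 1))^-1 = pi^-1 :> R.
  by move: pi0; move: (pi : R) => p p0; field; rewrite gt_eqF.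
have -> // : (1 + 1) * (4 / pi * (1 + 1)) = 16 / pi :> R by ring.
Qed.

Lemma bump_gt0 x : 0 < bump x.
Proof.
have /andP[h _] := bump_bounds x; apply: lt_le_trans h.
by rewrite mulr_gt0 ?cauchy_gt0// invr_gt0 pi_gt0.
Qed.

Lemma bump_ge0 x : 0 <= bump x.
Proof. by rewrite ltW// bump_gt0. Qed.

Lemma bump_le2 x : bump x <= 2.
Proof.
have := phi_bounded (x + 1); have := phi_bounded (x - 1); rewrite /bump.
by rewrite !ler_norml => /andP[? ?] /andP[? ?]; lra.
Qed.

Lemma sqint_bump : sqint bump.
Proof.
have := sqintD (sqintZ 1 (sqint_layer_shift (-1 : R))) (sqintZ (-1) (sqint_layer_shift 1)).
by congr sqint; apply/funext => x; rewrite bumpE.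
Qed.

Lemma continuous_bump : continuous bump.
Proof.
have -> : bump = (fun x => phi (x - -1) - phi (x - 1)).
  by apply/funext => x; rewrite opprK.
by move=> x; apply: cvgB; exact: continuous_translate.
Qed.

Definition bump_reaction x : R := 1 * layer_reaction (-1) x + (-1) * layer_reaction 1 x.

Lemma sqint_bump_reaction : sqint bump_reaction.
Proof. by apply: sqintD; apply: sqintZ; exact: sqint_layer_reaction. Qed.

Lemma weak_lap_bump : weak_lap bump bump_reaction.
Proof.
rewrite (_ : bump = (fun x => 1 * layer_shift (-1) x + (-1) * layer_shift 1 x)).
  apply: weak_lap_linear.
  - exact: sqint_layer_shift.
  - exact: sqint_layer_shift.
  - exact: sqint_layer_reaction.
  - exact: sqint_layer_reaction.
  - exact: weak_lap_layer_shift.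
  - exact: weak_lap_layer_shift.
by apply/funext => x; exact: bumpE.
Qed.

Lemma bump_reaction_le x : `|bump_reaction x| <= bump x.
Proof.
rewrite /bump_reaction /layer_reaction (opprK 1).
rewrite [X in `|X|](_ : _ = dpotential (phi (x - 1)) - dpotential (phi (x + 1))); last by ring.
by rewrite distrC (le_trans (dpotential_lipschitz _ _))// ger0_norm// bump_ge0.
Qed.

(** With [sg = 1] this is the height above the upper translate, with [sg = -1] the depth below the
    lower one; trapping means that both are nonpositive. *)
Definition excess (sg c : R) f x : R := sg * (f x - layer_shift c x).

Lemma continuous_excess sg c f : continuous f -> continuous (excess sg c f).
Proof.
move=> cf x; apply: cvgM; first exact: cvg_cst.
by apply: cvgB; [exact: cf|exact: continuous_layer_shift].
Qed.

Lemma sqint_excess sg c f : sqint f -> sqint (excess sg c f).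
Proof. by move=> sf; apply: sqintZ; apply: sqintB => //; exact: sqint_layer_shift. Qed.

Definition excess_lap sg c f g x : R := sg * (reaction f x - g x - layer_reaction c x).

Lemma sqint_reaction f : sqint f -> sqint (reaction f).
Proof.
move=> sf; apply: (sqint_le (meas_reaction sf.1) _ sf) => x.
rewrite /reaction addrC (le_trans (dpotential_lipschitz _ _))//.
by rewrite opprD addrCA subrr addr0 normrN.
Qed.

Lemma sqint_excess_lap sg c f g : sqint f -> sqint g -> sqint (excess_lap sg c f g).
Proof.
move=> sf sg'; apply: sqintZ; apply: sqintB; last exact: sqint_layer_reaction.
by apply: sqintB => //; exact: sqint_reaction.
Qed.

Lemma weak_lap_excess sg c f g : sqint f -> sqint g -> weakly_solves f g ->
  weak_lap (excess sg c f) (excess_lap sg c f g).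
Proof.
move=> sf sG fg.
have -> : excess sg c f = (fun x => sg * f x + (- sg) * layer_shift c x).
  by apply/funext => x; rewrite /excess; ring.
have -> : excess_lap sg c f g =
    (fun x => sg * (reaction f x - g x) + (- sg) * layer_reaction c x).
  by apply/funext => x; rewrite /excess_lap; ring.
apply: weak_lap_linear => //.
- exact: sqint_layer_shift.
- by apply: sqintB => //; exact: sqint_reaction.
- exact: sqint_layer_reaction.
- exact: weak_lap_layer_shift.
Qed.

(** Time derivative plus half-Laplacian of the excess leave a difference of [dpotential] at the
    translate and at [u], and [dpotential] is 1-Lipschitz. *)
Lemma excess_reaction sg c f g x : `|sg| = 1 ->
  `|sg * g x + excess_lap sg c f g x| <= `|excess sg c f x|.
Proof.
move=> sg1; rewrite /excess_lap /excess -mulrDr !normrM sg1 !mul1r.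
rewrite /reaction /layer_reaction /layer_shift.
rewrite [X in `|X|](_ : _ = dpotential (phi (x - c)) - dpotential (f x + phi x)); last by ring.
apply: (le_trans (dpotential_lipschitz _ _)); rewrite distrC.
by rewrite le_eqVlt; apply/orP; left; apply/eqP; congr `|_|; ring.
Qed.

(** Nonpositivity says that the gap is at least [al * bump]. The factor 1 fits the form of
    [weak_lap_linear]. *)
Definition barred sg c al f x : R := 1 * excess sg c f x + al * bump x.

Definition barred_lap sg c al f g x : R := 1 * excess_lap sg c f g x + al * bump_reaction x.

Lemma sqint_barred sg c al f : sqint f -> sqint (barred sg c al f).
Proof.
move=> sf; apply: sqintD; apply: sqintZ; first exact: sqint_excess.
exact: sqint_bump.
Qed.

Lemma sqint_barred_lap sg c al f g : sqint f -> sqint g -> sqint (barred_lap sg c al f g).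
Proof.
move=> sf sG; apply: sqintD; apply: sqintZ; first exact: sqint_excess_lap.
exact: sqint_bump_reaction.
Qed.

Lemma weak_lap_barred sg c al f g : sqint f -> sqint g -> weakly_solves f g ->
  weak_lap (barred sg c al f) (barred_lap sg c al f g).
Proof.
move=> sf sG fg; apply: weak_lap_linear.
- exact: sqint_excess.
- exact: sqint_bump.
- exact: sqint_excess_lap.
- exact: sqint_bump_reaction.
- exact: weak_lap_excess.
- exact: weak_lap_bump.
Qed.

(** Where [barred] is positive, the excess is at most [barred + al * bump] in absolute value. The
    reaction thus costs one [al], the half-Laplacian of [bump] another one, and the growth of the
    barrier costs [k]. *)
Lemma barrier_le sg c al k f g p : p = posp (barred sg c al f) ->
  `|sg| = 1 -> 0 <= al -> sqint f -> sqint g ->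
  \int[mu]_x (p x * (sg * g x + k * bump x)) +
    \int[mu]_x (p x * barred_lap sg c al f g x) <=
  sqnorm p + (2 * al + k) * \int[mu]_x (p x * bump x).
Proof.
move=> pE sg1 al0 sf sG; have sp : sqint p by rewrite pE; apply: sqint_posp; exact: sqint_barred.
have sb := sqint_bump.
have i1 : intg (fun x => p x * (sg * g x + k * bump x)).
  by apply: sqintM => //; apply: sqintD; exact: sqintZ.
have i2 := sqintM sp (sqint_barred_lap sg c al sf sG).
have i3 := sqintM sp sb.
rewrite -(RintD i1 i2) /sqnorm -(RintZ (2 * al + k) i3) -(RintD sp.2 (intgZ (2 * al + k) i3)).
apply: le_integral_intg; [exact: intgD|exact: intgD sp.2 (intgZ _ i3)|move=> x].
rewrite pE -mulrDr; have [q0|q0] := leP (barred sg c al f x) 0.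
  have -> : posp (barred sg c al f) x = 0 by exact/max_idPr.
  by rewrite !mul0r mulr0 addr0 expr0n.
have -> : posp (barred sg c al f) x = barred sg c al f x by apply/max_idPl; exact: ltW.
rewrite -[leRHS](_ : barred sg c al f x * (barred sg c al f x + (2 * al + k) * bump x) = _);
  last by ring.
apply: ler_wpM2l; first exact: ltW.
have h1 := le_trans (ler_norm _) (excess_reaction c f g x sg1).
have h2 := le_trans (ler_norm _) (bump_reaction_le x).
have h3 : `|excess sg c f x| <= barred sg c al f x + al * bump x.
  have ab : 0 <= al * bump x by rewrite mulr_ge0// bump_ge0.
  move: q0; rewrite /barred ler_norml => q0; apply/andP; split; lra.
have h4 := ler_wpM2l al0 h2.
rewrite /barred_lap; move: h1 h3 h4 => /le_trans h /h; clear; lra.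
Qed.

End barrier.

Section flow_comparison.
Context {R : realType}.
Implicit Types (q p : R -> R) (c k sg t r s x : R).
Local Notation mu := (@lebesgue_measure R).

Lemma sqnorm_posp0 q : (forall x, q x <= 0) -> sqnorm (posp q) = 0.
Proof.
move=> q0; rewrite /sqnorm -[RHS](@mul0r R (fine (mu setT))) -Rintegral_cst//.
by apply: eq_Rint => x; rewrite /posp (max_idPr (q0 x)) expr0n.
Qed.

Lemma sqnorm_posp_le0 q : sqint q -> continuous q -> sqnorm (posp q) <= 0 ->
  forall x, q x <= 0.
Proof.
move=> sq cq qle x; have sp := sqint_posp sq.
pose f y := posp q y ^+ 2.
have cf : continuous f.
  by move=> y; rewrite /f; under eq_fun do rewrite expr2; apply: cvgM; exact: continuous_posp.
have f0 y : 0 <= f y by exact: sqr_ge0.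
have N0 : 0 < `|x| + 1 by rewrite ltr_wpDl.
have iN := intg_trunc_continuous (`|x| + 1) cf.
have I0 : \int[mu]_y trunc (`|x| + 1) f y = 0.
  apply/eqP; rewrite eq_le; apply/andP; split.
    apply: le_trans qle; apply: le_integral_intg => //; first exact: sp.2.
    by move=> y; rewrite (le_trans (ler_norm _))// (le_trans (trunc_le _ _ _))// ger0_norm.
  by apply: integral_ge0_real => y; rewrite truncE; case: ifP.
have := integral0_continuous N0 cf f0 iN I0 (_ : `|x| < `|x| + 1).
rewrite ltrDl ltr01 => /(_ isT) /eqP; rewrite /f sqrf_eq0 => /eqP p0.
by apply: le_trans (_ : posp q x <= 0); [rewrite /posp le_max lexx|rewrite p0].
Qed.

Context (v g : R -> R -> R) (vg : weak_flow v g).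

Lemma L2_derivative_barred sg c k s t : `|sg| = 1 -> 0 < t ->
  L2_derivative (fun r => barred sg c (k * (r - s)) (v r)) t
    (fun x => sg * g t x + k * bump x).
Proof.
move=> sg1 t0; split.
- near=> h; apply: sqint_barred; apply: (weak_flow_sqint vg).
  by near: h; exact: near_dnbhs_time_gt0.
- by apply: sqint_barred; exact: (weak_flow_sqint vg).
- apply: sqintD; apply: sqintZ; last exact: sqint_bump.
  exact: (weak_flow_dsqint vg).
- apply: cvg_trans (weak_flow_derivative vg t0); apply: near_eq_cvg; near=> h.
  have h0 : h != 0 by near: h; exact: nbhs_dnbhs_neq.
  apply: eq_Rint => x.
  rewrite -[LHS]mul1r -[X in X * _](expr1n _ 2) -sg1 real_normK ?num_real// -exprMn.
  by congr (_ ^+ 2); rewrite /barred /excess; field.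
Unshelve. all: by end_near. Qed.

(** The hypothesis on [p] asks the Dirichlet form to absorb the forcing [(2 * al + k) * bump] left
    by [barrier_le]. What remains is [E' <= 2 E] for the energy [E] of the positive part. *)
Lemma barred_gronwall sg c k t0 s t : `|sg| = 1 -> 0 < s -> t0 <= s -> s <= t -> 0 <= k ->
  (forall r p, s <= r <= t -> p = posp (barred sg c (k * (r - t0)) (v r)) ->
    (2 * (k * (r - t0)) + k) * \int[mu]_x (p x * bump x) <=
    \int[mu]_x (p x * barred_lap sg c (k * (r - t0)) (v r) (g r) x)) ->
  sqnorm (posp (barred sg c (k * (t - t0)) (v t))) <=
  expR (2 * (t - s)) * sqnorm (posp (barred sg c (k * (s - t0)) (v s))).
Proof.
move=> sg1 s0 t0s st k0 hr.
pose Q r := barred sg c (k * (r - t0)) (v r).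
pose dF r := 2 * \int[mu]_x (posp (Q r) x * (sg * g r x + k * bump x)).
apply: (@gronwall_le _ (fun r => sqnorm (posp (Q r))) dF 2 s t) => // r /andP[sr rt].
  have r0 : 0 < r by exact: lt_le_trans sr.
  by apply: is_derive_sqnorm_posp; exact: L2_derivative_barred.
have r0 : 0 < r by exact: lt_le_trans sr.
have sv := weak_flow_sqint vg r0; have sG := weak_flow_dsqint vg r0.
have al0 : 0 <= k * (r - t0) by rewrite mulr_ge0// subr_ge0 (le_trans t0s).
apply: ler_wpM2l => //.
have hb := @barrier_le _ sg c (k * (r - t0)) k (v r) (g r) _ erefl sg1 al0 sv sG.
have h := hr r _ _ erefl; rewrite sr rt in h.
have := le_trans hb (lerD (lexx _) (h isT)).
by rewrite lerD2r.
Qed.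

Lemma barred0 sg c f : barred sg c 0 f = excess sg c f.
Proof. by apply/funext => x; rewrite /barred mul1r mul0r addr0. Qed.

(** The case of a barrier with speed 0, where nonnegativity of the form is enough. *)
Lemma excess_gronwall sg c s t : `|sg| = 1 -> 0 < s -> s <= t ->
  sqnorm (posp (excess sg c (v t))) <=
  expR (2 * (t - s)) * sqnorm (posp (excess sg c (v s))).
Proof.
move=> sg1 s0 st; have := @barred_gronwall sg c 0 s s t sg1 s0 (lexx s) st (lexx 0).
rewrite !mul0r !barred0; apply => r p /andP[sr _] ->.
rewrite !mul0r mulr0 addr0 mul0r.
have r0 : 0 < r by exact: lt_le_trans sr.
have sv := weak_flow_sqint vg r0; have sG := weak_flow_dsqint vg r0.
apply: weak_lap_posp_ge0; first exact: sqint_barred.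
by apply: weak_lap_barred => //; exact: (weak_flow_equation vg).
Qed.

Lemma excess_le0_preserved sg c s t : `|sg| = 1 -> 0 < s -> s <= t ->
  (forall x, excess sg c (v s) x <= 0) -> forall x, excess sg c (v t) x <= 0.
Proof.
move=> sg1 s0 st es; have t0 : 0 < t by exact: lt_le_trans st.
apply: sqnorm_posp_le0; first by apply: sqint_excess; exact: (weak_flow_sqint vg).
  by apply: continuous_excess; exact: (weak_flow_continuous vg).
by apply: le_trans (excess_gronwall c sg1 s0 st) _; rewrite sqnorm_posp0// mulr0.
Qed.

(** The energy inequality starts at a positive time [s]; letting [s] tend to 0 imports the initial
    information. *)
Lemma excess_le0_initial sg c : `|sg| = 1 ->
  sqnorm (posp (excess sg c (v t))) @[t --> 0^'+] --> 0 ->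
  forall t, 0 < t -> forall x, excess sg c (v t) x <= 0.
Proof.
move=> sg1 lim t t0; apply: sqnorm_posp_le0.
- by apply: sqint_excess; exact: (weak_flow_sqint vg).
- by apply: continuous_excess; exact: (weak_flow_continuous vg).
have lim2 : expR (2 * t) * sqnorm (posp (excess sg c (v s))) @[s --> 0^'+] --> 0.
  by rewrite -[X in _ --> X](mulr0 (expR (2 * t))); apply: cvgM; [exact: cvg_cst|exact: lim].
apply: (cvg_ger lim2); near=> s.
have s0 : 0 < s by near: s; exact: nbhs_right_gt.
have st : s <= t by near: s; exact: nbhs_right_le.
apply: le_trans (excess_gronwall c sg1 s0 st) _.
rewrite ler_wpM2r ?sqnorm_ge0// ler_expR; move: s0; clear; lra.
Unshelve. all: by end_near. Qed.

(** Minus the mass of the gap: nonpositive as long as the trapping holds. *)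
Definition deficit sg c t := \int[mu]_x (excess sg c (v t) x * bump x).

(** In the derivative of the mass the half-Laplacian falls on [bump], where it is at most [bump],
    and the reaction is at most the gap. Each costs the mass at most itself, so the mass cannot
    decay faster than at rate 2. *)
Lemma deficit_le sg c s t : `|sg| = 1 -> 0 < s -> s <= t ->
  (forall x, excess sg c (v s) x <= 0) ->
  deficit sg c t <= expR (- 2 * (t - s)) * deficit sg c s.
Proof.
move=> sg1 s0 st es.
apply: (@gronwall_le _ (deficit sg c) (fun r => \int[mu]_x ((sg * g r x + 0 * bump x) * bump x)) (- 2)) => // r /andP[sr rt].
  have r0 : 0 < r by exact: lt_le_trans sr.
  have := is_derive_pairing (L2_derivative_barred c 0 0 sg1 r0) sqint_bump.
  congr is_derive; apply/funext => r'; apply: eq_Rint => x.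
  by rewrite mul0r barred0.
have r0 : 0 < r by exact: lt_le_trans sr.
have er := excess_le0_preserved sg1 s0 sr es.
have sv := weak_flow_sqint vg r0; have sG := weak_flow_dsqint vg r0.
have sb := @sqint_bump R; have se := sqint_excess sg c sv.
have sL := sqint_excess_lap sg c sv sG; have sBR := @sqint_bump_reaction R.
have S := weak_lap_symm se sb (@weak_lap_excess _ sg c _ _ sv sG (weak_flow_equation vg r0)) (@weak_lap_bump R).
have i1 := sqintM se sb; have i2 := sqintM sb sL; have i3 := sqintM se sBR.
have iD : intg (fun x => (sg * g r x + 0 * bump x) * bump x).
  by apply: sqintM => //; apply: sqintD; exact: sqintZ.
have e0 x : `|excess sg c (v r) x| = - excess sg c (v r) x by rewrite ler0_norm.
have b0 := @bump_ge0 R.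
have h1 : \int[mu]_x ((sg * g r x + 0 * bump x) * bump x) <=
    - deficit sg c r - \int[mu]_x (bump x * excess_lap sg c (v r) (g r) x).
  rewrite -opprD /deficit -(RintD i1 i2) -mulN1r -(RintZ (-1) (intgD i1 i2)).
  apply: le_integral_intg => //; first exact: intgZ (intgD i1 i2).
  move=> x; have := le_trans (ler_norm _) (excess_reaction c (v r) (g r) x sg1).
  by rewrite e0 mul0r addr0 => /(ler_wpM2r (b0 x)); clear; lra.
have h2 : - (\int[mu]_x (excess sg c (v r) x * bump_reaction x)) <= - deficit sg c r.
  rewrite lerN2; apply: le_integral_intg => // x.
  have := ler_wpM2l (normr_ge0 (excess sg c (v r) x)) (bump_reaction_le x).
  by rewrite -normrM e0 mulNr ler_norml opprK => /andP[].
by move: h1 h2; rewrite S; clear; lra.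
Qed.

End flow_comparison.

Section gain.
Context {R : realType}.
Implicit Types (v g : R -> R -> R) (c k sg t r s x : R).
Local Notation mu := (@lebesgue_measure R).

(** The barrier is [k * (r - t0) * bump]. If [barred] becomes positive somewhere, its positive part
    interacts with the negative one, whose mass is at least [m - k * beta]: [m] bounds the mass of
    the gap from below over the unit interval and [k * beta] is the most the barrier takes from it.
    The interaction dominates the forcing, so the positive part stays zero. *)
Lemma gain : exists kap : R, 0 < kap /\ forall v g sg c t0, weak_flow v g ->
  `|sg| = 1 -> 0 < t0 ->
  (forall r x, t0 <= r -> `|excess sg c (v r) x| <= 2) ->
  (forall x, excess sg c (v t0) x <= 0) ->
  forall x, excess sg c (v (t0 + 1)) x <= kap * deficit v sg c t0 * bump x.
Proof.
(* [H] compares [bump] with [cauchy]; [G] is the constant of [weak_lap_posp_ge] after replacing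
   [cauchy] by [bump] in both masses. *)
have pi0 := @pi_gt0 R; pose H : R := 16 / pi; pose G : R := (2 * pi)^-1 * (H^-1 * H^-1).
have H0 : 0 < H by rewrite divr_gt0.
have G0 : 0 < G by rewrite !mulr_gt0// ?invr_gt0// ?mulr_gt0.
pose beta := sqnorm (@bump R); have beta0 : 0 <= beta by exact: sqnorm_ge0.
have den : 0 < 3 + G * beta by rewrite ltr_wpDr// mulr_ge0// ltW.
exists (G * expR (- 2) / (3 + G * beta)); split.
  by rewrite divr_gt0// mulr_gt0// expR_gt0.
move=> v g sg c t0 vg sg1 t00 bd es.
pose M0 := - deficit v sg c t0; pose m := expR (- 2) * M0.
have M00 : 0 <= M0.
  rewrite /M0 /deficit -mulN1r -RintZ; last first.
    by apply: sqintM; [apply: sqint_excess; exact: (weak_flow_sqint vg)|exact: sqint_bump].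
  apply: integral_ge0_real => x; rewrite mulN1r oppr_ge0.
  by rewrite mulr_le0_ge0// bump_ge0.
have m0 : 0 <= m by rewrite mulr_ge0// expR_ge0.
(* The solution of [3 * k = G * (m - k * beta)], which balances forcing and interaction; [kap] is
   the factor of proportionality between [k] and the initial mass. *)
pose k := G * m / (3 + G * beta).
have k0 : 0 <= k by rewrite mulr_ge0 ?invr_ge0 ?(ltW den)// mulr_ge0// ltW.
have kE : 3 * k = G * (m - k * beta).
  rewrite /k; move: den; clearbody m beta G; clear => den.
  by field; rewrite gt_eqF.
have kapE : G * expR (- 2) / (3 + G * beta) * deficit v sg c t0 = - k.
  by rewrite /k /m /M0; clear; ring.
have main : sqnorm (posp (barred sg c (k * (t0 + 1 - t0)) (v (t0 + 1)))) <= 0.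
  have t01 : t0 <= t0 + 1 by rewrite lerDl.
  apply: (le_trans (barred_gronwall vg sg1 t00 (lexx t0) t01 k0 _)); last first.
    by rewrite subrr mulr0 barred0 (sqnorm_posp0 es) mulr0.
  move=> r p /andP[t0r rt1]; pose al := k * (r - t0); rewrite -/al => pE.
  have r0 : 0 < r by exact: lt_le_trans t0r.
  have al0 : 0 <= al by rewrite mulr_ge0// subr_ge0.
  have alk : al <= k by rewrite -[leRHS]mulr1 ler_wpM2l// lerBlDl.
  have sv := weak_flow_sqint vg r0; have sG := weak_flow_dsqint vg r0.
  have sb := @sqint_bump R; have se := sqint_excess sg c sv; have sc := @sqint_cauchy R.
  pose q := barred sg c al (v r); have sq : sqint q by exact: sqint_barred.
  have sp : sqint p by rewrite pE; exact: sqint_posp.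
  have sn := sqint_negp sq.
  have qB x : `|q x| <= 2 + k * 2.
    rewrite /q /barred mul1r (le_trans (ler_normD _ _))// lerD ?bd// normrM ler_pM//.
      by rewrite ger0_norm.
    by rewrite (ger0_norm (bump_ge0 x)) bump_le2.
  have := weak_lap_posp_ge sq (sqint_barred_lap sg c al sv sG)
    (@weak_lap_barred _ sg c al _ _ sv sG (weak_flow_equation vg r0)) qB.
  rewrite -pE; apply: le_trans.
  have p0 x : 0 <= p x by rewrite pE posp_ge0.
  have b_c x : H^-1 * bump x <= cauchy x.
    by have /andP[_ h] := bump_bounds x; rewrite ler_pdivrMl.
  have hp : H^-1 * \int[mu]_x (p x * bump x) <= \int[mu]_x (p x * cauchy x).
    rewrite -(RintZ _ (sqintM sp sb)); apply: le_integral_intg => [||x].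
    - exact: intgZ (sqintM sp sb).
    - exact: sqintM.
    - by rewrite mulrCA ler_wpM2l.
  have hn : H^-1 * \int[mu]_x (negp q x * bump x) <= \int[mu]_x (negp q x * cauchy x).
    rewrite -(RintZ _ (sqintM sn sb)); apply: le_integral_intg => [||x].
    - exact: intgZ (sqintM sn sb).
    - exact: sqintM.
    - by rewrite mulrCA ler_wpM2l// negp_ge0.
  have hm : m - k * beta <= \int[mu]_x (negp q x * bump x).
    have h1 : m <= - deficit v sg c r.
      rewrite /m /M0 mulrN lerN2; apply: le_trans (deficit_le vg sg1 t00 t0r es) _.
      rewrite ler_wnM2r// -?oppr_ge0// ler_expR.
      by move: rt1; clear; lra.
    have i1 := intgZ (-1) (sqintM se sb); have i2 := intgZ (- al) sb.2.
    apply: (@le_trans _ _ (- deficit v sg c r - al * beta)).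
      by rewrite lerD// lerN2 ler_wpM2r.
    have -> : - deficit v sg c r - al * beta =
        \int[mu]_x (-1 * (excess sg c (v r) x * bump x) + - al * bump x ^+ 2).
      by rewrite (RintD i1 i2) (RintZ (-1) (sqintM se sb)) (RintZ (- al) sb.2) mulN1r mulNr.
    apply: le_integral_intg => [||x]; [exact: intgD|exact: sqintM|].
    have : - q x <= negp q x by rewrite /negp le_max lexx.
    move=> /(ler_wpM2r (bump_ge0 x)); apply: le_trans.
    by rewrite le_eqVlt; apply/orP; left; apply/eqP; rewrite /q /barred; ring.
  set P := \int[mu]_x (p x * bump x) in hp *.
  have P0 : 0 <= P by apply: integral_ge0_real => x; rewrite mulr_ge0// bump_ge0.
  set PC := \int[mu]_x (p x * cauchy x) in hp *.
  have nc0 : 0 <= \int[mu]_x (negp q x * cauchy x).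
    by apply: integral_ge0_real => x; rewrite mulr_ge0 ?negp_ge0// ltW// cauchy_gt0.
  set NC := \int[mu]_x (negp q x * cauchy x) in hn nc0 *.
  (* On the unit interval [al <= k], so [3 * k] bounds [2 * al + k]. *)
  apply: (@le_trans _ _ (3 * k * P)).
    by apply: ler_wpM2r => //; move: alk; clear; lra.
  have Hi0 : 0 <= H^-1 by rewrite invr_ge0 ltW.
  rewrite kE /G.
  have -> : (2 * pi)^-1 * (H^-1 * H^-1) * (m - k * beta) * P =
    (2 * pi)^-1 * (H^-1 * P * (H^-1 * (m - k * beta))) by ring.
  apply: ler_wpM2l; first by rewrite invr_ge0 mulr_ge0// ltW.
  apply: (@le_trans _ _ (H^-1 * P * NC)).
    apply: ler_wpM2l; first by rewrite mulr_ge0.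
    by apply: le_trans hn; exact: ler_wpM2l.
  exact: ler_wpM2r.
have t10 : 0 < t0 + 1 by rewrite ltr_wpDr.
have sv1 := weak_flow_sqint vg t10.
have := sqnorm_posp_le0 (sqint_barred sg c _ sv1) _ main.
move=> hx x; rewrite kapE mulNr -subr_le0 opprK.
have := hx _ x; rewrite /barred mul1r (_ : t0 + 1 - t0 = 1) ?mulr1; last by ring.
apply=> y; apply: cvgD; (apply: cvgM; first exact: cvg_cst).
  by apply: continuous_excess; exact: (weak_flow_continuous vg).
exact: continuous_bump.
Qed.

End gain.

(** * Contraction and convergence *)

Section convergence.
Context {R : realType}.
Implicit Types (f : R -> R) (v g : R -> R -> R) (a b A t r s x y : R) (n : nat).
Local Notation mu := (@lebesgue_measure R).

Definition trapped_by f a b :=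
  (forall x, excess 1 a f x <= 0) /\ (forall x, excess (-1) b f x <= 0).

Lemma trapped_byP f a b : trapped_by f a b <->
  forall x, phi (x - b) <= f x + phi x <= phi (x - a).
Proof.
rewrite /trapped_by /excess /layer_shift; split=> [[h1 h2] x|h].
  by have := h1 x; have := h2 x; clear; lra.
by split=> x; have /andP[] := h x; clear; lra.
Qed.

Lemma trapped_by_preserved v g a b s t : weak_flow v g -> 0 < s -> s <= t ->
  trapped_by (v s) a b -> trapped_by (v t) a b.
Proof.
move=> vg s0 st [ha hb]; split.
  by apply: (excess_le0_preserved vg _ s0 st ha); rewrite normr1.
by apply: (excess_le0_preserved vg _ s0 st hb); rewrite normrN1.
Qed.

Lemma trapped_by_excess f a b sg c x : `|sg| = 1 -> trapped_by f a b ->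
  `|excess sg c f x| <= 2.
Proof.
move=> sg1 /trapped_byP /(_ x) /andP[h1 h2]; rewrite /excess normrM sg1 mul1r /layer_shift.
have := phi_bounded (x - c); have := phi_bounded (x - a); have := phi_bounded (x - b).
rewrite !ler_norml => /andP[? ?] /andP[? ?] /andP[? ?]; apply/andP; split; lra.
Qed.

(** Strict monotonicity of [phi] at one point. Applied at a common time, it bounds every left
    endpoint by every right endpoint. *)
Lemma trapped_by_le f a b a' b' : trapped_by f a b -> trapped_by f a' b' -> a <= b'.
Proof.
move=> /trapped_byP /(_ 0) /andP[_ h1] /trapped_byP /(_ 0) /andP[h2 _].
rewrite leNgt; apply/negP => ba.
have := le_lt_trans (le_trans h2 h1) (phi_lt (_ : 0 - a < 0 - b')).
by rewrite ltxx ltrD2l ltrN2 => /(_ ba).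
Qed.

Lemma integral_cauchy_bump_gt0 : 0 < \int[mu]_x (cauchy x * bump x).
Proof.
have sb := @sqint_bump R; have sc := @sqint_cauchy R; have pi0 := @pi_gt0 R.
rewrite ltNge; apply/negP => h.
have : sqnorm (posp (@bump R)) <= 0.
  apply: (@le_trans _ _ (16 / pi * \int[mu]_x (cauchy x * bump x))).
    rewrite /sqnorm -(RintZ _ (sqintM sc sb)); apply: le_integral_intg => [||x].
    - exact: (sqint_posp sb).2.
    - exact: intgZ (sqintM sc sb).
    - rewrite mulrA /posp (max_idPl (bump_ge0 x)) expr2 ler_wpM2r ?bump_ge0//.
      by have /andP[] := bump_bounds x.
  by rewrite mulr_ge0_le0// divr_ge0// ltW.
move=> /(sqnorm_posp_le0 sb (@continuous_bump R)) /(_ 0).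
by rewrite leNgt bump_gt0.
Qed.

(** The two deficits add up to at most [- 2 * m * (b - a)], so one of them is at most
    [- m * (b - a)]. [gain] opens a gap of [kap * m * (b - a) * bump] at that end, and shifting the
    endpoint by [d = eta * (b - a)] uses no more than this. *)
Lemma contraction_step A : exists theta : R, 0 <= theta < 1 /\
  forall v g a b t, weak_flow v g -> 0 < t -> `|a| <= A -> `|b| <= A -> a <= b ->
  trapped_by (v t) a b -> exists a' b', [/\ a <= a', a' <= b', b' <= b,
    b' - a' <= theta * (b - a) & trapped_by (v (t + 1)) a' b'].
Proof.
have pi0 := @pi_gt0 R; have [kap [kap0 hkap]] := @gain R.
have A0 := cauchy_den A; have sb := @sqint_bump R; have sc := @sqint_cauchy R.
pose m := (pi * (1 + A ^+ 2))^-1 * \int[mu]_x (cauchy x * bump x) / 2.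
have m0 : 0 < m.
  by rewrite !mulr_gt0 ?invr_gt0// ?mulr_gt0//; exact: integral_cauchy_bump_gt0.
pose K : R := 4 / pi * (1 + A ^+ 2).
have K0 : 0 < K by rewrite !mulr_gt0 ?invr_gt0.
(* The second bound makes the shift affordable, [K] being its cost and [pi^-1] the ratio of [bump]
   to [cauchy] from below; the first keeps the endpoints in order. *)
pose eta := Num.min 2^-1 (kap * m / pi / K).
have eta0 : 0 < eta.
  rewrite lt_min; apply/andP; split; first by rewrite invr_gt0.
  exact: divr_gt0 (divr_gt0 (mulr_gt0 kap0 m0) pi0) K0.
have eta1 : eta <= 2^-1 by rewrite ge_min lexx.
have etaK : eta * K <= kap * m / pi by rewrite -ler_pdivlMr// ge_min lexx orbT.
exists (1 - eta); split; first by move: eta0 eta1; clear; lra.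
move=> v g a b t vg t0 aA bA ab tr; have [ha hb] := tr.
have n1 : `|1 : R| = 1 by rewrite normr1.
have nN1 : `|-1 : R| = 1 by rewrite normrN1.
have trl r : t <= r -> trapped_by (v r) a b by move=> tr'; exact: (trapped_by_preserved vg t0 tr' tr).
have sv := weak_flow_sqint vg t0.
have sum : deficit v 1 a t + deficit v (-1) b t <= - (2 * m * (b - a)).
  have i1 := sqintM (sqint_excess 1 a sv) sb; have i2 := sqintM (sqint_excess (-1) b sv) sb.
  pose C := - ((b - a) * (pi * (1 + A ^+ 2))^-1).
  have -> : - (2 * m * (b - a)) = C * \int[mu]_x (cauchy x * bump x).
    by rewrite /m /C; move: ((pi * _)^-1) (\int[mu]_x _) => Y I; field.
  rewrite /deficit -(RintD i1 i2) -(RintZ C (sqintM sc sb)).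
  apply: le_integral_intg => [||x]; [exact: intgD|exact: intgZ (sqintM sc sb)|].
  rewrite -mulrDl mulrA ler_wpM2r ?bump_ge0//.
  have /andP[h _] := phi_translate_le x aA bA ab.
  rewrite /C mulNr lerNr; apply: le_trans h _.
  by rewrite le_eqVlt; apply/orP; left; apply/eqP; rewrite /excess /layer_shift; ring.
clearbody m; pose d : R := eta * (b - a).
have ba0 : 0 <= b - a by rewrite subr_ge0.
have d0 : 0 <= d by rewrite mulr_ge0// ltW.
have dba : d <= 2^-1 * (b - a) by rewrite ler_wpM2r.
have moved a1 b1 x : `|a1| <= A -> `|b1| <= A -> b1 - a1 = d ->
    phi (x - a1) - phi (x - b1) <= kap * (m * (b - a)) * bump x.
  move=> a1A b1A dE; have a1b1 : a1 <= b1 by rewrite -subr_ge0 dE.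
  have /andP[_ h] := phi_translate_le x a1A b1A a1b1; apply: le_trans h _.
  have /andP[hb1 _] := bump_bounds x.
  have kk : 0 <= kap * (m * (b - a)) by exact: mulr_ge0 (ltW kap0) (mulr_ge0 (ltW m0) ba0).
  apply: le_trans (ler_wpM2l kk hb1); rewrite [leRHS]mulrA ler_wpM2r ?(ltW (cauchy_gt0 x))//.
  rewrite dE /d -/K mulrAC (_ : kap * _ / pi = kap * m / pi * (b - a)); last by ring.
  exact: ler_wpM2r.
have inA y : a <= y -> y <= b -> `|y| <= A.
  move: aA bA; rewrite !ler_norml => /andP[? ?] /andP[? ?] ? ?; apply/andP; split; lra.
have t1 : t <= t + 1 by rewrite lerDl.
have push sg c x : `|sg| = 1 -> (forall y, excess sg c (v t) y <= 0) ->
    deficit v sg c t <= - (m * (b - a)) ->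
    excess sg c (v (t + 1)) x <= - (kap * (m * (b - a)) * bump x).
  move=> sg1 hc dc; apply: le_trans (hkap v g sg c t vg sg1 t0 _ hc x) _.
    by move=> r y tr'; exact: (trapped_by_excess c y sg1 (trl r tr')).
  rewrite -mulNr ler_wpM2r ?bump_ge0// -mulrN ler_wpM2l//.
  exact: ltW.
have [t1a t1b] := trl _ t1.
(* Either the upper translate has enough mass below it and [a] moves right, or the lower one has
   enough above it and [b] moves left. *)
have [ga|ga] := leP (deficit v 1 a t) (- (m * (b - a))).
  have ad : a <= a + d by rewrite lerDl.
  have adb : a + d <= b by move: dba ba0; clear; lra.
  exists (a + d), b; split => //; first by rewrite /d; clear; lra.
  split=> // x; have h1 := push 1 a x n1 ha ga.
  have dE : a + d - a = d by ring.
  have h2 := moved a (a + d) x aA (inA _ ad adb) dE; move: h2 h1.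
  rewrite /excess /layer_shift !mul1r.
  by move: (kap * _ * _) (phi (x - (a + d))) (phi _) (v _ _) (phi x); clear => ? ? ? ? ?; lra.
have bd : b - d <= b by rewrite gerBl.
have abd : a <= b - d by move: dba ba0; clear; lra.
have gb : deficit v (-1) b t <= - (m * (b - a)) by move: sum ga; clear; lra.
exists a, (b - d); split => //; first by rewrite /d; clear; lra.
split=> // x; have h1 := push (-1) b x nN1 hb gb.
have dE : b - (b - d) = d by ring.
have h2 := moved (b - d) b x (inA _ abd bd) bA dE; move: h2 h1.
rewrite /excess /layer_shift mulN1r.
by move: (kap * _ * _) (phi (x - (b - d))) (phi _) (v _ _) (phi x); clear => ? ? ? ? ?; lra.
Qed.

(** All intervals stay inside [[a, b]], so the same [A], and hence the same [theta], can be used at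
    every unit of time. *)
Lemma trapped_by_contracts v g a b t : weak_flow v g -> 0 < t -> a <= b ->
  trapped_by (v t) a b -> forall e : R, 0 < e -> exists a' b' T,
  [/\ 0 < T, b' - a' <= e & trapped_by (v T) a' b'].
Proof.
move=> vg t0 ab tr e e0; pose A := Num.max `|a| `|b|.
have [theta [/andP[th0 th1] step]] := contraction_step A.
have inA y : a <= y -> y <= b -> `|y| <= A.
  have : `|a| <= A by rewrite le_max lexx.
  have : `|b| <= A by rewrite le_max lexx orbT.
  by rewrite !ler_norml => /andP[? ?] /andP[? ?] ? ?; apply/andP; split; lra.
have seq n : exists a' b', [/\ a <= a', a' <= b', b' <= b,
    b' - a' <= theta ^+ n * (b - a) & trapped_by (v (t + n%:R)) a' b'].
  elim: n => [|n [a' [b' [aa' ab' bb' hab tr']]]].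
    by exists a, b; rewrite expr0 mul1r addr0.
  have tn : 0 < t + n%:R by rewrite ltr_wpDr.
  have [] := step v g a' b' _ vg tn _ _ ab' tr'.
  - by apply: inA => //; exact: le_trans bb'.
  - by apply: inA => //; exact: le_trans ab'.
  move=> a2 [b2 [h1 h2 h3 h4 h5]]; exists a2, b2; split => //.
  - exact: le_trans h1.
  - exact: le_trans bb'.
  - by rewrite exprS -mulrA; apply: le_trans h4 _; rewrite ler_wpM2l.
  - by rewrite -natr1 addrA.
have lim : theta ^+ n * (b - a) @[n --> \oo] --> 0 * (b - a).
  by apply: cvgM; [apply: cvg_expr; rewrite ger0_norm|exact: cvg_cst].
rewrite mul0r in lim.
have [n _ /(_ n (leqnn n)) hn] := cvgr_lt _ lim _ e0.
have [a' [b' [_ _ _ hab tr']]] := seq n.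
exists a', b', (t + n%:R); split => //; first by rewrite ltr_wpDr.
by rewrite (le_trans hab)// ltW.
Qed.

Lemma attains_maximum f (K : R) : continuous f -> (forall x, 0 <= f x) ->
  (forall x, f x <= K * cauchy x) -> exists c, forall x, f x <= f c.
Proof.
move=> cf f0 fK; have [[x1 fx1]|h] := pselect (exists x, 0 < f x); last first.
  exists 0 => x; apply: le_trans (f0 0); rewrite leNgt; apply/negP => fx.
  by apply: h; exists x.
(* Beyond [N] the bound [K * cauchy x] is below [f x1], and [x1] lies within [N]; the maximum over
   [[- N, N]] is therefore global. *)
pose N := Num.max `|x1| (K / f x1).
have x1N : `|x1| <= N by rewrite le_max lexx.
have KN : K / f x1 <= N by rewrite le_max lexx orbT.
have N0 : 0 <= N by rewrite (le_trans _ x1N).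
have [||c _ hc] := @EVT_max _ f (- N) N; first by rewrite ge0_cp.
  exact: continuous_subspaceT.
exists c => x; have [xN|xN] := leP `|x| N.
  by apply: hc; rewrite in_itv/= -ler_norml.
apply: (@le_trans _ _ (f x1)); last by apply: hc; rewrite in_itv/= -ler_norml.
apply: le_trans (fK x) _; rewrite ler_pdivrMr ?cauchy_den// mulrC -ler_pdivrMr//.
apply: le_trans KN _; apply: (le_trans (ltW xN)).
rewrite -(real_normK (num_real x)); have := sqr_ge0 (`|x| - 1); have := normr_ge0 x.
by rewrite sqrrB; clear; lra.
Qed.

Lemma trapped_by_distance f a b x0 x : trapped_by f a b -> a <= x0 -> x0 <= b ->
  `|f x + phi x - phi (x - x0)| <= phi (x - a) - phi (x - b).
Proof.
move=> /trapped_byP/(_ x)/andP[h1 h2] ax xb.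
have : phi (x - b) <= phi (x - x0) by apply: phi_le; rewrite lerD2l lerN2.
have : phi (x - x0) <= phi (x - a) by apply: phi_le; rewrite lerD2l lerN2.
by move=> ? ?; rewrite ler_norml; apply/andP; split; lra.
Qed.

Lemma phi_lipschitz x y : `|phi x - phi y| <= `|x - y|.
Proof.
rewrite -[leRHS]mul1r; apply: (lipschitz_derive (@is_derive_phi R)) => z.
have p2 := @pi_ge2 R; have p0 := @pi_gt0 R.
rewrite ger0_norm; last exact: mulr_ge0 (divr_ge0 (ler0n _ _) (ltW p0)) (ltW (cauchy_gt0 z)).
apply: (le_trans (ler_wpM2l _ (cauchy_le1 z))).
  by rewrite divr_ge0// ltW.
by rewrite mulr1 ler_pdivrMr// mul1r.
Qed.

End convergence.

Theorem theorem2p9 (R : realType) (u0 : R -> R)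
  (energy_finite : (energy u0 < +oo)%E)
  (trapped : exists a b : R, a <= b /\
    forall x : R, phi (x - b) <= u0 x <= phi (x - a))
  (u : R -> R -> R) (u_solution : is_solution u0 u) :
  exists (x0 : R) (b : R -> R),
    (forall t : R, 0 < t ->
      is_maximum [set `|u t x - phi (x - x0)| | x in [set: R]] (b t)) /\
    b t @[t --> +oo] --> (0 : R).
Proof.
have [g vg] := solution_weak_flow u_solution; have [a [b [ab u0ab]]] := trapped.
pose v (t : R) : R -> R := u t \- phi.
have tr t : 0 < t -> trapped_by (v t) a b.
  move=> t0; split.
    apply: (excess_le0_initial vg) => //; first by rewrite normr1.
    apply: (initial_excess u_solution); first by left.
    by move=> x; have /andP[_ h] := u0ab x; rewrite mul1r subr_le0.
  apply: (excess_le0_initial vg) => //; first by rewrite normrN1.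
  apply: (initial_excess u_solution); first by right.
  by move=> x; have /andP[h _] := u0ab x; rewrite mulN1r oppr_le0 subr_ge0.
have uE t x y : u t x - y = v t x + phi x - y by rewrite /v /= subrK.
(* Left endpoints of trapping intervals at all positive times. Preservation brings any two intervals
   to a common time, so each right endpoint bounds [S], and the supremum lies in every trapping
   interval. *)
pose S := [set a' : R | exists b' t, 0 < t /\ trapped_by (v t) a' b'].
have Sle a' b' t : 0 < t -> trapped_by (v t) a' b' -> ubound S b'.
  move=> t0 tr' a2 [b2 [s [s0 tr2]]].
  have ts : t <= Num.max t s by rewrite le_max lexx.
  have st : s <= Num.max t s by rewrite le_max lexx orbT.
  exact: (trapped_by_le (trapped_by_preserved vg s0 st tr2) (trapped_by_preserved vg t0 ts tr')).
have Sa : S a by exists b, 1; split => //; exact: tr.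
have Sub : has_ubound S by exists b; exact: (Sle a b 1 ltr01 (tr 1 ltr01)).
pose x0 := sup S.
have x0P a' b' t : 0 < t -> trapped_by (v t) a' b' -> a' <= x0 /\ x0 <= b'.
  move=> t0 tr'; split; first by apply: ub_le_sup => //; exists b', t.
  by apply: ge_sup; [exists a|exact: (Sle a' b' t)].
pose D (t : R) := [set `|u t x - phi (x - x0)| | x in [set: R]].
have Dmax t : 0 < t -> exists m, is_maximum (D t) m.
  move=> t0; have [ax xb] := x0P _ _ _ t0 (tr t t0).
  pose A := Num.max `|a| `|b|.
  have aA : `|a| <= A by rewrite le_max lexx.
  have bA : `|b| <= A by rewrite le_max lexx orbT.
  have [||x|c hc] := @attains_maximum _ (fun x => `|u t x - phi (x - x0)|)
    ((b - a) * (4 / pi * (1 + A ^+ 2))).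
  - move=> x; have h : u t y - phi (y - x0) @[y --> x] --> u t x - phi (x - x0).
      by apply: cvgB; [exact: (solution_representative u_solution t0)|exact: continuous_translate].
    exact: (cvg_norm h).
  - by move=> x.
  - rewrite uE; apply: le_trans (trapped_by_distance x (tr t t0) ax xb) _.
    by have /andP[] := phi_translate_le x aA bA ab.
  exists `|u t c - phi (c - x0)|; split; first by exists c.
  by move=> _ [x _ <-]; exact: hc.
(* A choice of the maximum, with the default 0 only where there is none; it is a maximum at every
   positive time. *)
pose m t := xget 0 [set m | is_maximum (D t) m].
have mP t : 0 < t -> is_maximum (D t) (m t).
  by move=> t0; exact: (xgetPex 0 (Dmax t t0)).
exists x0, m; split => //; apply/cvgr0Pnorm_le => e e0.
(* From time [T] on, [u] and the translate by [x0] lie between the same two translates, which differ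
   by at most [b' - a'] since [phi] is 1-Lipschitz. *)
have [a' [b' [T [T0 hab trT]]]] := trapped_by_contracts vg ltr01 ab (tr 1 ltr01) e0.
near=> t; have Tt : T <= t by near: t; apply: nbhs_pinfty_ge; exact: num_real.
have t0 : 0 < t by exact: lt_le_trans Tt.
have [[x _ <-] _] := mP t t0; have [ax xb] := x0P _ _ _ T0 trT.
rewrite normr_id uE.
apply: le_trans (trapped_by_distance x (trapped_by_preserved vg T0 Tt trT) ax xb) _.
apply: le_trans (ler_norm _) _; apply: le_trans (phi_lipschitz _ _) _.
have -> : x - a' - (x - b') = b' - a' by ring.
by rewrite ger0_norm// subr_ge0 (le_trans ax).
Unshelve. all: by end_near. Qed.
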